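(* Let $n\ge5$ and let $F\subseteq E(K_n)$ be a flat of the generic $C_2^1$-cofactor matroid $\mathcal{C}^1_{2,n}$, with rank function $r$. Let $\mathcal{X}^*$ be the family of all maximal cliques of the graph $K_n[F]=(V(F),F)$ that have at least five vertices. Let $F_0$ be the set of edges of $F$ not induced by any member of $\mathcal{X}^*$. Then $\mathcal{X}^*$ is a $4$-shellable, $2$-thin cover of $F\setminus F_0$, and $r(F)=|F_0|+\mathrm{val}_D(\mathcal{X}^* )$.
   Context: Vertices of $K_n$ are $v_1,\dots,v_n$. Choose $p(v_i)=(x_i,y_i)\in\mathbb{R}^2$ generic, i.e. the coordinates are algebraically independent over $\mathbb{Q}$. The $C_2^1$-cofactor matrix is the $|E(K_n)|\times 3n$ matrix with three consecutive columns for each vertex. The row of edge $v_iv_j$ with $i<j$ has $D_{ij}=((x_i-x_j)^2,(x_i-x_j)(y_i-y_j),(y_i-y_j)^2)$ in the columns of $v_i$, $-D_{ij}$ in the columns of $v_j$, and zeros elsewhere. $\mathcal{C}^1_{2,n}$ is the row matroid of this matrix. A maximal clique of a graph is a maximal vertex set inducing a complete subgraph. Let $\mathcal{X}$ be a family of subsets of $V(K_n)$. - A hinge of $\mathcal{X}$ is a pair $\{x,y\}$ with $X_i\cap X_j=\{x,y\}$ for two distinct $X_i,X_j\in\mathcal{X}$. $H(\mathcal{X})$ is the set of hinges. - $\deg_{\mathcal{X}}(h)$ is the number of members of $\mathcal{X}$ containing the hinge $h$. - $\mathcal{X}$ is $2$-thin if $|X_i\cap X_j|\le2$ for all distinct $X_i,X_j\in\mathcal{X}$.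 - $\mathcal{X}$ is $4$-shellable if its members can be ordered $(X_1,\dots,X_m)$ with $|X_i\cap\bigcup_{j<i}X_j|\le4$ for all $2\le i\le m$. - $\mathcal{X}$ is a cover of an edge set $F'$ if every member has at least five elements and every edge of $F'$ has both endpoints in some member. - $\mathrm{val}_D(\mathcal{X})=\sum_{X\in\mathcal{X}}(3|X|-6)-\sum_{h\in H(\mathcal{X})}(\deg_{\mathcal{X}}(h)-1)$. *)

(* Defs.v *)
From HB Require Import structures.
From mathcomp Require Import all_boot all_order all_algebra.
From mathcomp Require Import reals.
From mathcomp Require Import mpoly.
Set Implicit Arguments.
Unset Strict Implicit.
Unset Printing Implicit Defensive.
Import Order.TTheory GRing.Theory Num.Theory.
Local Open Scope ring_scope.

Definition edge (n : nat) := {e : 'I_n * 'I_n | (e.1 < e.2)%N}.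

(* Genericity: the 2n coordinates x_1..x_n, y_1..y_n are algebraically
   independent over Q: no nonzero rational polynomial in 2n variables
   vanishes at them. Variable i < n is x_i, variable n + i is y_i. *)
Definition coords (R : realType) (n : nat) (x y : 'I_n -> R) : 'I_(n + n) -> R :=
  fun k => match split k with inl a => x a | inr b => y b end.

Definition generic (R : realType) (n : nat) (x y : 'I_n -> R) : Prop :=
  forall p : {mpoly rat[n + n]}, p != 0 ->
    (map_mpoly (S := R) ratr p).@[coords x y] != 0.

Definition Dent (R : realType) (n : nat) (x y : 'I_n -> R) (i j : 'I_n) (k : nat) : R :=
  if k == 0%N then (x i - x j) ^+ 2
  else if k == 1%N then (x i - x j) * (y i - y j)
  else (y i - y j) ^+ 2.

(* The C^1_2 cofactor matrix: rows indexed by the edges of K_n (via enum),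
   columns indexed by 'I_(3*n); column c belongs to vertex c %/ 3 and is
   the (c %% 3)-th of its three columns. *)
Definition cofmx (R : realType) (n : nat) (x y : 'I_n -> R)
  : 'M[R]_(#|{: edge n}|, 3 * n) :=
  \matrix_(r, c)
    let e := val (enum_val r) in
    let v := (c %/ 3)%N in
    let k := (c %% 3)%N in
    if v == val e.1 then Dent x y e.1 e.2 k
    else if v == val e.2 then - Dent x y e.1 e.2 k
    else 0.

(* Rank function of the row matroid C^1_{2,n}: rank of the rows in F
   (the other rows are replaced by zero rows). *)
Definition cofrank (R : realType) (n : nat) (x y : 'I_n -> R) (F : {set edge n}) : nat :=
  \rank ((\matrix_(r, c) (if enum_val r \in F then cofmx x y r c else 0))
           : 'M[R]_(#|{: edge n}|, 3 * n)).

Definition is_flat (R : realType) (n : nat) (x y : 'I_n -> R) (F : {set edge n}) : Prop :=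
  forall e : edge n, e \notin F -> (cofrank x y F < cofrank x y (e |: F))%N.

Definition VF (n : nat) (F : {set edge n}) : {set 'I_n} :=
  [set v | [exists e in F, ((val e).1 == v) || ((val e).2 == v)]].

Definition adjF (n : nat) (F : {set edge n}) (u v : 'I_n) : bool :=
  [exists e in F, (val e == (u, v)) || (val e == (v, u))].

Definition is_clique (n : nat) (F : {set edge n}) (X : {set 'I_n}) : bool :=
  (X \subset VF F) && [forall u in X, forall v in X, (u != v) ==> adjF F u v].

Definition is_maxclique (n : nat) (F : {set edge n}) (X : {set 'I_n}) : bool :=
  is_clique F X && [forall Y : {set 'I_n}, (is_clique F Y && (X \subset Y)) ==> (Y == X)].

Definition Xstar (n : nat) (F : {set edge n}) : {set {set 'I_n}} :=
  [set X | is_maxclique F X & (5 <= #|X|)%N].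

Definition induced_by (n : nat) (X : {set 'I_n}) (e : edge n) : bool :=
  ((val e).1 \in X) && ((val e).2 \in X).

Definition F0 (n : nat) (F : {set edge n}) : {set edge n} :=
  [set e in F | ~~ [exists X in Xstar F, induced_by X e]].

Definition hinges (n : nat) (Xs : {set {set 'I_n}}) : {set {set 'I_n}} :=
  [set h : {set 'I_n} | (#|h| == 2)%N &&
     [exists Xi in Xs, exists Xj in Xs, (Xi != Xj) && (Xi :&: Xj == h)]].

Definition hdeg (n : nat) (Xs : {set {set 'I_n}}) (h : {set 'I_n}) : nat :=
  #|[set X in Xs | h \subset X]|.

Definition two_thin (n : nat) (Xs : {set {set 'I_n}}) : Prop :=
  forall Xi Xj, Xi \in Xs -> Xj \in Xs -> Xi != Xj -> (#|Xi :&: Xj| <= 2)%N.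

Definition four_shellable (n : nat) (Xs : {set {set 'I_n}}) : Prop :=
  exists s : seq {set 'I_n}, uniq s /\ (forall X, (X \in s) = (X \in Xs)) /\
    forall i, (0 < i < size s)%N ->
      (#|nth set0 s i :&: \bigcup_(j < i) nth set0 s j| <= 4)%N.

Definition is_cover (n : nat) (Xs : {set {set 'I_n}}) (F' : {set edge n}) : Prop :=
  (forall X, X \in Xs -> (5 <= #|X|)%N) /\
  (forall e, e \in F' -> exists2 X, X \in Xs & induced_by X e).

Definition valD (n : nat) (Xs : {set {set 'I_n}}) : int :=
  (\sum_(X in Xs) ((3 * #|X|)%:Z - 6))
  - \sum_(h in hinges Xs) ((hdeg Xs h)%:Z - 1).

(* Main.v *)
Require Import Defs.
From HB Require Import structures.
From mathcomp Require Import all_boot all_order all_algebra.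
From mathcomp Require Import reals.
From mathcomp Require Import mpoly.
From mathcomp Require Import zify ring.
Set Implicit Arguments.
Unset Strict Implicit.
Unset Printing Implicit Defensive.
Import Order.TTheory GRing.Theory Num.Theory.
Local Open Scope ring_scope.

(** Write [r] for the cofactor rank. Moving a generic vertex to special positions
    on the lines through its neighbours controls the star of a vertex of degree at
    most five, and by induction on the vertices the cofactor matroid turns out to
    dominate every matroid in which each edge of a K_5 is spanned by the other nine.
    Hence the stresses of a flat [F] are generated by those of its copies of K_5,
    and so of its large cliques: [|F| - r(F) <= \sum_X 'C(|X| - 3, 2)], with equality
    as soon as the cliques are 4-shellable, by supermodularity of the nullity.

    Shellability is by induction on [|F|]. In a minimal counterexample every vertex
    lies in two large cliques, and deleting it lowers the rank by at least five. The
    induction hypothesis on [F - v] and on the neighbourhood of [v], for a vertex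
    [v] not adjacent to all others, yields the rank formula for [F]; then every
    vertex [v] has degree at least [5 + \sum_(X containing v) (|X| - 4)], and adding
    these bounds up contradicts [r(F) <= 3 |V(F)| - 6]. *)

(** A vertex of degree at most five is always available: if every edge of a K_5 is spanned by the
    other nine, the complete graph on s >= 3 vertices has rank at most 3s - 6, so an independent set
    has average degree below six. Its star must then be shown independent modulo the remaining
    edges. At most three edges are independent for generic directions; a dependent star of four puts
    all edges between the neighbours in the span of the rest; a dependent star of five leaves three
    possibilities. Two of them contradict independence directly. The third is the obstacle: among
    the five neighbours the opposite edges of a K_4 become parallel and the edges at the fifth
    neighbour become spanned. It is consistent on the five vertices alone, and a separate induction
    excludes it by showing that such relations cost at least three dimensions over any graph.

    The drop by five at a vertex in two large cliques is what the final count needs: with the clique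
    terms it forces an average degree contribution of 5 + 6/5 > 6, whereas a drop by four would give
    only 5.2. *)

Lemma uniq_subseq_card (T : finType) (N : {set T}) (r : nat) : (r <= #|N|)%N ->
  exists t : seq T, [/\ size t = r, uniq t & {subset t <= N}].
Proof.
move=> h; exists (take r (enum N)); split; last by move=> z /mem_take; rewrite mem_enum.
  by rewrite size_takel // -cardE.
by apply: take_uniq; apply: enum_uniq.
Qed.

Lemma exists_uniq3 (T : finType) (N : {set T}) : (3 <= #|N|)%N ->
  exists a b c, uniq [:: a; b; c] /\ {subset [:: a; b; c] <= N}.
Proof.
by case/uniq_subseq_card => t []; case: t => [|a [|b [|c []]]] // _ u sN; exists a, b, c.
Qed.

Lemma exists_uniq4 (T : finType) (N : {set T}) : (4 <= #|N|)%N ->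
  exists a b c d, uniq [:: a; b; c; d] /\ {subset [:: a; b; c; d] <= N}.
Proof.
by case/uniq_subseq_card => t []; case: t => [|a [|b [|c [|d []]]]] // _ u sN; exists a, b, c, d.
Qed.

(** * Abstract rank functions, and ranks of families of vectors *)

Section RankFunctions.
Variable E : finType.
Implicit Types (A B : {set E}) (e f : E).

(** The local rank axioms of a matroid. [rhoP] stands in for submodularity because it only concerns
    one-element extensions, which keeps it checkable for the truncated lift built from a flat. *)
Record rank_function (rho : {set E} -> nat) : Prop := RankFunction {
  rho0 : rho set0 = 0%N;
  rhoS : forall A e, (rho A <= rho (e |: A) <= (rho A).+1)%N;
  rhoP : forall A e f, rho (e |: A) = rho A -> rho (f |: A) = rho A ->
    rho (e |: (f |: A)) = rho A
}.

Variable rho : {set E} -> nat.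
Hypothesis rhoR : rank_function rho.

Lemma rho_ind (P : {set E} -> Prop) A B : A \subset B -> P A ->
  (forall (C : {set E}) e, A \subset C -> e \in B -> P C -> P (e |: C)) -> P B.
Proof.
move=> sAB PA PS.
suff H : forall s : seq E, {subset s <= B} -> P (A :|: [set x in s]).
  have -> : B = A :|: [set x in enum B].
    by apply/setP=> x; rewrite !inE mem_enum; case: (boolP (x \in A)) => // /(subsetP sAB).
  by apply: H => x; rewrite mem_enum.
elim=> [_|x s IH sub].
  by have -> : A :|: [set x in [::]] = A by apply/setP=> x; rewrite !inE orbF.
have -> : A :|: [set y in x :: s] = x |: (A :|: [set y in s]).
  by apply/setP=> y; rewrite !inE orbCA.
apply: PS; [exact: subsetUl | by apply: sub; rewrite inE eqxx |].
by apply: IH => y ys; apply: sub; rewrite inE ys orbT.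
Qed.

Lemma rho_mono A B : A \subset B -> (rho A <= rho B)%N.
Proof.
move=> sAB; apply: (rho_ind (P := fun C => (rho A <= rho C)%N) sAB) => //.
by move=> C e _ _ h; apply: leq_trans h _; case/andP: (rhoS rhoR C e).
Qed.

Lemma rho_addS A e : (rho (e |: A) <= (rho A).+1)%N.
Proof. by case/andP: (rhoS rhoR A e). Qed.

Lemma rho_span_mono A B e : A \subset B -> rho (e |: A) = rho A ->
  rho (e |: B) = rho B.
Proof.
move=> sAB h0; apply: (rho_ind (P := fun C => rho (e |: C) = rho C) sAB) => //.
move=> C f _ _ h.
have [Hf|Hf] := eqVneq (rho (f |: C)) (rho C).
  by rewrite (rhoP rhoR h Hf) Hf.
have := rhoS rhoR C f; have := rhoS rhoR (f |: C) e; have := rhoS rhoR (e |: C) f.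
by rewrite setUCA h; move: Hf; lia.
Qed.

Lemma rho_spanU A B : (forall e, e \in B -> rho (e |: A) = rho A) ->
  rho (A :|: B) = rho A.
Proof.
move=> H; apply: (@rho_ind (fun C => rho C = rho A) A) => //; first exact: subsetUl.
move=> C e sAC; rewrite inE => eAB h.
have He : rho (e |: A) = rho A.
  case/orP: eAB => [eA|]; last exact: H.
  by congr rho; apply/setUidPr; rewrite sub1set.
by rewrite (rho_span_mono sAC He).
Qed.

Lemma rho_leU A B : (rho (A :|: B) <= rho A + #|B|)%N.
Proof.
have [m] := ubnP #|B|; elim: m B => // m IH B ltBm.
have [->|[e eB]] := set_0Vmem B; first by rewrite setU0 cards0 addn0.
have lt' : (#|B :\ e| < m)%N by move: ltBm; rewrite (cardsD1 e B) eB; lia.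
have := IH _ lt'; rewrite (cardsD1 e B) eB => h.
have -> : A :|: B = e |: (A :|: B :\ e) by rewrite setUCA setD1K.
by have := rho_addS (A :|: B :\ e) e; lia.
Qed.

Lemma rho_card A : (rho A <= #|A|)%N.
Proof. by have := rho_leU set0 A; rewrite set0U (rho0 rhoR). Qed.

Lemma rho_indep_sub A B : A \subset B -> rho B = #|B| -> rho A = #|A|.
Proof.
move=> sAB h; apply/eqP; rewrite eqn_leq rho_card /=.
have E1 : A :|: B :\: A = B.
  by apply/setP=> x; rewrite !inE; case: (boolP (x \in A)) => //= /(subsetP sAB).
by have := rho_leU A (B :\: A); rewrite E1; have := cardsID A B; rewrite (setIidPr sAB) h; lia.
Qed.

Lemma rho_indep_add A e : rho A = #|A| -> rho (e |: A) != rho A ->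
  rho (e |: A) = #|e |: A|.
Proof.
move=> h ne; have eA : e \notin A.
  by apply: contra ne => eA; rewrite (setUidPr _) // sub1set.
by have := rhoS rhoR A e; rewrite cardsU1 eA -h /= => ?; move/eqP: ne; lia.
Qed.

Lemma rho_basis_ext A0 A : A0 \subset A -> rho A0 = #|A0| ->
  exists B : {set E}, [/\ A0 \subset B, B \subset A, rho B = #|B| & rho B = rho A].
Proof.
move=> sA h0.
pose P := fun B : {set E} => [&& A0 \subset B, B \subset A & rho B == #|B|].
have P0 : P A0 by rewrite /P subxx sA h0 eqxx.
have [B maxB _] := maxset_exists P0.
have /and3P[sB sBA /eqP hB] := maxsetp maxB.
exists B; split=> //; rewrite -(setUidPr sBA) rho_spanU // => e eA.
apply/eqP/negPn/negP => ne.
have PeB : P (e |: B).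
  rewrite /P (subset_trans sB) ?subsetUr //= subUset sub1set eA sBA /=.
  by rewrite (rho_indep_add hB ne).
have := maxsetsup maxB PeB (subsetUr _ _) => eB.
by move: ne; rewrite eB eqxx.
Qed.

Lemma rho_basis A : exists B : {set E}, [/\ B \subset A, rho B = #|B| & rho B = rho A].
Proof.
have [|B [_ ? ? ?]] := @rho_basis_ext set0 A (sub0set _); last by exists B.
by rewrite (rho0 rhoR) cards0.
Qed.

End RankFunctions.

Section LinearRank.
Variables (K : fieldType) (vT : vectType K) (E : finType) (g : E -> vT).
Implicit Types (A B : {set E}) (e : E).

Definition spn A : {vspace vT} := (\sum_(e in A) <[g e]>)%VS.
Definition lrank A := \dim (spn A).

Lemma spn_mem A e : e \in A -> g e \in spn A.
Proof. by move=> eA; rewrite memvE (sumv_sup e). Qed.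

Lemma spn_subP A (V : {vspace vT}) :
  reflect (forall e, e \in A -> g e \in V) (spn A <= V)%VS.
Proof.
apply: (iffP subv_sumP) => h e eA; first by rewrite memvE h.
by rewrite -memvE h.
Qed.

Lemma spnS A B : A \subset B -> (spn A <= spn B)%VS.
Proof. by move=> sAB; apply/spn_subP => e eA; rewrite spn_mem // (subsetP sAB). Qed.

Lemma spnU A B : spn (A :|: B) = (spn A + spn B)%VS.
Proof.
apply/eqP; rewrite eqEsubv subv_add !spnS ?subsetUl ?subsetUr // !andbT.
apply/spn_subP => e; rewrite inE => /orP[] eA.
  by rewrite (subvP (addvSl _ _)) ?spn_mem.
by rewrite (subvP (addvSr _ _)) ?spn_mem.
Qed.

Lemma spn1 e : spn [set e] = <[g e]>%VS.
Proof. by rewrite /spn big_set1. Qed.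

Lemma spn0 : spn set0 = 0%VS.
Proof. by rewrite /spn big_set0. Qed.

Lemma lrank_cl A e : (lrank (e |: A) = lrank A) <-> (g e \in spn A).
Proof.
rewrite /lrank spnU spn1 addvC; split=> [h|/addv_idPl -> //].
have := dimv_leqif_eq (addvSl (spn A) <[g e]>).
by case=> _; rewrite h eqxx => /esym/eqP ->; rewrite (subvP (addvSr _ _)) ?memv_line.
Qed.

Lemma lrank_rank : rank_function lrank.
Proof.
split=> [|A e|A e f].
- by rewrite /lrank spn0 dimv0.
- rewrite /lrank dimvS ?spnS ?subsetUr //= spnU spn1 addvC.
  apply: leq_trans (dimv_add_leqif _ _) _; rewrite dim_vline.
  by case: (g e != 0); lia.
- move=> /lrank_cl he /lrank_cl hf.
  have hf' := (lrank_cl A f).2 hf.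
  by rewrite -hf'; apply/lrank_cl; rewrite spnU (subvP (addvSr _ _)).
Qed.

Lemma lrank_submod A B :
  (lrank (A :|: B) + lrank (A :&: B) <= lrank A + lrank B)%N.
Proof.
rewrite /lrank spnU -(dimv_sum_cap (spn A) (spn B)) leq_add2l dimvS // subv_cap.
by rewrite !spnS ?subsetIl ?subsetIr.
Qed.

End LinearRank.

(** * Edge sets of K_n: degrees, deletion of a vertex, complete subgraphs *)

Section EdgeSets.
Variable n : nat.
Implicit Types (A B : {set edge n}) (W U X : {set 'I_n}) (u v w i j : 'I_n).

(** A set with at most one element instead of an edge: it is symmetric in its arguments and empty
    when they coincide, so endpoints never have to be ordered. *)
Definition Ed i j : {set edge n} := [set e | (val e == (i, j)) || (val e == (j, i))].
Definition KW W : {set edge n} := [set e | induced_by W e].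
Definition del A u : {set edge n} := A :&: KW (~: [set u]).
Definition nb A u : {set 'I_n} := [set w | adjF A u w].

Lemma edge_neq (e : edge n) : (val e).1 != (val e).2.
Proof. by apply/eqP => h; have := valP e; rewrite /= h ltnn. Qed.

Lemma EdC i j : Ed i j = Ed j i.
Proof. by apply/setP=> e; rewrite !inE orbC. Qed.

Lemma Ed_neq i j : i != j -> exists2 e : edge n, Ed i j = [set e] &
  val e = (i, j) \/ val e = (j, i).
Proof.
wlog lij : i j / (i < j)%N => [H|ij].
  case: (ltngtP i j) => [|lji|/val_inj ->]; last by rewrite eqxx.
    by move=> l; apply: H.
  rewrite eq_sym => /(H _ _ lji) [e eE eV]; exists e; first by rewrite EdC.
  by case: eV; [right | left].
exists (exist _ (i, j) lij : edge n); last by left.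
apply/setP=> e; rewrite !inE; apply/orP/eqP => [[] /eqP h|->]; last by left.
  exact/val_inj.
by have := valP e; rewrite h /= => l; have := ltn_trans lij l; rewrite ltnn.
Qed.

Lemma Edii i : Ed i i = set0.
Proof.
apply/setP=> e; rewrite !inE orbb; apply/negP=> /eqP h.
by have := edge_neq e; rewrite h eqxx.
Qed.

Lemma Ed_val (e : edge n) : Ed (val e).1 (val e).2 = [set e].
Proof.
have [f fE fV] := Ed_neq (edge_neq e); rewrite fE; congr [set _].
apply/val_inj; move: fV (valP e) (valP f); case: (val e) => a b /= [->|->] //=.
by move=> l l'; have := ltn_trans l l'; rewrite ltnn.
Qed.

Lemma adjFP A i j : reflect (exists2 e, e \in A & e \in Ed i j) (adjF A i j).
Proof.
apply: (iffP existsP) => [[e /andP[eA h]]|[e eA h]]; exists e => //.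
  by rewrite inE.
by rewrite eA; rewrite inE in h.
Qed.

Lemma adjFC A i j : adjF A i j = adjF A j i.
Proof. by apply/adjFP/adjFP => [] [e ? ?]; exists e => //; rewrite EdC. Qed.

Lemma adjFii A i : adjF A i i = false.
Proof. by apply/adjFP => [] [e _]; rewrite Edii inE. Qed.

Lemma adjF_neq A i j : adjF A i j -> i != j.
Proof. by apply: contraL => /eqP ->; rewrite adjFii. Qed.

Lemma adjF_sub A i j : adjF A i j = (i != j) && (Ed i j \subset A).
Proof.
have [->|ij] := eqVneq; first by rewrite adjFii.
have [e E _] := Ed_neq ij; rewrite E sub1set /=.
by apply/adjFP/idP => [[f fA]|eA]; [rewrite E inE => /eqP <- | exists e; rewrite ?E ?inE].
Qed.

Lemma adjFS A B i j : A \subset B -> adjF A i j -> adjF B i j.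
Proof. by move=> sAB; rewrite !adjF_sub => /andP[-> h]; apply: subset_trans h sAB. Qed.

Lemma adjF_val A (e : edge n) : adjF A (val e).1 (val e).2 = (e \in A).
Proof. by rewrite adjF_sub edge_neq Ed_val sub1set. Qed.

Lemma sub_adjF A B : (forall i j, adjF A i j -> adjF B i j) -> A \subset B.
Proof. by move=> h; apply/subsetP=> e; rewrite -!adjF_val; apply: h. Qed.

Lemma in_KW W (e : edge n) : (e \in KW W) = ((val e).1 \in W) && ((val e).2 \in W).
Proof. by rewrite inE. Qed.

Lemma adjF_KW W i j : adjF (KW W) i j = [&& i != j, i \in W & j \in W].
Proof.
rewrite adjF_sub; have [//|ij] := eqVneq; have [e E V] := Ed_neq ij.
by rewrite E sub1set in_KW; case: V => -> //=; rewrite andbC.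
Qed.

Lemma adjFU A B i j : adjF (A :|: B) i j = adjF A i j || adjF B i j.
Proof.
apply/adjFP/orP => [[e]|[] /adjFP [e eA eE]].
- by rewrite inE => /orP[] eA eE; [left|right]; apply/adjFP; exists e.
- by exists e => //; rewrite inE eA.
- by exists e => //; rewrite inE eA orbT.
Qed.

Lemma adjFI A B i j : adjF (A :&: B) i j = adjF A i j && adjF B i j.
Proof. by rewrite !adjF_sub subsetI; case: (i != j). Qed.

Lemma adjF_Ed i j k l : adjF (Ed i j) k l =
  (i != j) && (((k == i) && (l == j)) || ((k == j) && (l == i))).
Proof.
apply/adjFP/andP => [[e]|[ij h]].
  rewrite !inE => h1 h2; split.
    by apply/eqP => ij; have := edge_neq e; case/orP: h1 => /eqP ->; rewrite ij eqxx.
  move: h1 h2 => /orP[] /eqP -> /orP[] /eqP [-> ->]; rewrite !eqxx ?orbT //.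
have [e E V] := Ed_neq ij; exists e; first by rewrite E inE.
by case/orP: h => /andP[/eqP -> /eqP ->]; rewrite inE; case: V => ->; rewrite eqxx ?orbT.
Qed.

Lemma adjF_del A u i j : adjF (del A u) i j = [&& adjF A i j, i != u & j != u].
Proof.
rewrite adjFI adjF_KW !inE; case h : (adjF A i j) => //=.
by rewrite (adjF_neq h).
Qed.

Lemma KWS W X : W \subset X -> KW W \subset KW X.
Proof.
move=> /subsetP sWX; apply/subsetP=> e; rewrite !in_KW.
by case/andP => /sWX -> /sWX ->.
Qed.

Lemma KWI W X : KW (W :&: X) = KW W :&: KW X.
Proof. by apply/setP=> e; rewrite in_setI !in_KW !in_setI andbACA. Qed.

Lemma del_KW A W u : A \subset KW W -> del A u \subset KW (W :\ u).
Proof. by move=> h; rewrite setDE KWI /del setSI. Qed.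

Lemma del_sub A u : del A u \subset A.
Proof. exact: subsetIl. Qed.

Lemma Ed_KW W i j : i \in W -> j \in W -> Ed i j \subset KW W.
Proof.
move=> iW jW; apply/subsetP=> e; rewrite inE in_KW.
by case/orP => /eqP ->; rewrite iW jW.
Qed.

Lemma in_nb A u w : (w \in nb A u) = adjF A u w.
Proof. by rewrite inE. Qed.

Lemma nb_KW A W u : A \subset KW W -> nb A u \subset W :\ u.
Proof.
move=> h; apply/subsetP => w; rewrite in_nb => /(adjFS h).
by rewrite adjF_KW !inE eq_sym => /and3P[-> _ ->].
Qed.

Lemma nbii A u : u \notin nb A u.
Proof. by rewrite in_nb adjFii. Qed.

Lemma del_nb A u : A = del A u :|: \bigcup_(w in nb A u) Ed u w.
Proof.
apply/eqP; rewrite eqEsubset; apply/andP; split.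
  apply: sub_adjF => i j h; rewrite adjFU adjF_del h /=.
  have [iu|iu] := eqVneq i u; last have [ju|ju] := eqVneq j u => //=.
    rewrite adjF_sub (adjF_neq h) -iu bigcup_sup // ?in_nb //.
  rewrite adjF_sub (adjF_neq h) EdC -ju bigcup_sup // ?in_nb adjFC //.
rewrite subUset del_sub; apply/bigcupsP => w; rewrite in_nb adjF_sub.
by case/andP.
Qed.

Lemma card_del A u : #|A| = (#|del A u| + #|nb A u|)%N.
Proof.
rewrite -(cardsID (KW (~: [set u])) A); congr addn.
(* On an edge at [u] this is the other endpoint, so it maps the removed edges bijectively onto the
   neighbours. *)
pose f (e : edge n) := if (val e).1 == u then (val e).2 else (val e).1.
rewrite -(card_in_imset (f := f)).
  congr #|pred_of_set _|; apply/setP => w; rewrite in_nb; apply/imsetP/adjFP.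
    case=> e; rewrite in_setD in_KW !inE negb_and !negbK => /andP[h eA] ->.
    exists e => //; rewrite inE /f; case: (val e) h => a b /=.
    by case: (eqVneq a u) => [->|_ /= /eqP ->]; rewrite eqxx ?orbT.
  case=> e eA eE; exists e.
    by rewrite in_setD in_KW !inE eA; move: eE; rewrite inE => /orP[] /eqP -> /=; rewrite eqxx ?andbF.
  have := edge_neq e; move: eE; rewrite inE /f => /orP[] /eqP -> /=; rewrite ?eqxx //.
  by move=> /negbTE ->.
move=> e e'; rewrite !in_setD !in_KW !inE !negb_and !negbK /f.
move=> /andP[h _] /andP[h' _] E; apply/val_inj.
have := valP e; have := valP e'; move: h h' E.
case: (val e) => a b; case: (val e') => c d /=.
case: (eqVneq a u) => [->|au]; case: (eqVneq c u) => [->|cu] //=.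
- by move=> _ _ ->.
- by move=> _ /eqP -> -> l l'; have := ltn_trans l l'; rewrite ltnn.
- by move=> /eqP -> _ -> l l'; have := ltn_trans l l'; rewrite ltnn.
- by move=> /eqP -> /eqP -> ->.
Qed.

Lemma sum_nb A W : A \subset KW W -> (\sum_(u in W) #|nb A u|)%N = (2 * #|A|)%N.
Proof.
have [m] := ubnP #|W|; elim: m A W => // m IH A W ltWm sAW.
have [W0|[u uW]] := set_0Vmem W.
  rewrite W0 big_set0; suff -> : A = set0 by rewrite cards0 muln0.
  apply/eqP; rewrite -subset0; apply: subset_trans sAW _.
  by apply/subsetP => e; rewrite in_KW W0 inE.
have E : (\sum_(i in W :\ u) #|nb A i| =
          \sum_(i in W :\ u) #|nb (del A u) i| + #|nb A u|)%N.
  have -> : (\sum_(i in W :\ u) #|nb A i| =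
             \sum_(i in W :\ u) (#|nb (del A u) i| + adjF A u i))%N.
    apply: eq_bigr => i; rewrite !inE => /andP[iu _].
    rewrite (cardsD1 u (nb A i)) in_nb adjFC addnC; congr addn.
    by apply: eq_card => j; rewrite !inE adjF_del iu /= andbC.
  rewrite big_split /=; congr addn.
  rewrite -big_mkcondr -sum1_card /=; apply: eq_bigl => i; rewrite in_nb.
  case h : (adjF A u i); rewrite ?andbF ?andbT //.
  by apply: (subsetP (nb_KW u sAW)); rewrite in_nb.
rewrite (big_setD1 u) //= E (IH _ _ _ (del_KW u sAW)); last first.
  by move: ltWm; rewrite (cardsD1 u W) uW add1n ltnS.
by rewrite (card_del A u) mulnDr addnCA addnn -mul2n.
Qed.

End EdgeSets.

(** * Binary quadratic forms evaluated at plane directions *)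

Section Plane.
Variable R : numFieldType.
Implicit Types (a b c d e f : R * R).

Definition det2 d e : R := d.1 * e.2 - d.2 * e.1.
(** Twice the signed area of the triangle; it vanishes exactly for collinear points. *)
Definition br a b c : R := det2 (b - a) (c - a).
(** The Veronese vector of degree two: a linear functional on these vectors is a binary quadratic
    form in [d], and [D_ij] is the value at [p i - p j]. *)
Definition ver d : 'rV[R]_3 := \row_k
  (if k == 0%N :> nat then d.1 ^+ 2 else if k == 1%N :> nat then d.1 * d.2 else d.2 ^+ 2).

Lemma det2C d e : det2 e d = - det2 d e.
Proof. by rewrite /det2; ring. Qed.

Lemma verE0 d : ver d 0 (inord 0) = d.1 ^+ 2. Proof. by rewrite mxE inordK. Qed.
Lemma verE1 d : ver d 0 (inord 1) = d.1 * d.2. Proof. by rewrite mxE inordK. Qed.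
Lemma verE2 d : ver d 0 (inord 2) = d.2 ^+ 2. Proof. by rewrite mxE inordK. Qed.

Lemma row3P (D D' : 'rV[R]_3) : D 0 (inord 0) = D' 0 (inord 0) ->
  D 0 (inord 1) = D' 0 (inord 1) -> D 0 (inord 2) = D' 0 (inord 2) -> D = D'.
Proof.
move=> h0 h1 h2; apply/rowP => k.
have [->|->|->] : [\/ k = inord 0, k = inord 1 | k = inord 2] => //.
by case: k => [[|[|[|k]]] Hk] //=; [constructor 1 | constructor 2 | constructor 3];
  apply/val_inj; rewrite /= inordK.
Qed.

Lemma verN d : ver (- d) = ver d.
Proof. by apply/row3P; rewrite !(verE0, verE1, verE2) /= ?sqrrN ?mulrNN. Qed.

Lemma verZ (c : R) d : ver (c * d.1, c * d.2) = c ^+ 2 *: ver d.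
Proof.
by apply/row3P; rewrite [RHS]mxE !(verE0, verE1, verE2) /=; ring.
Qed.

(** Each coefficient of a relation is isolated by a quadratic form that vanishes at the other two
    directions, namely a product of two determinants such as [det2 _ e * det2 _ f]. *)
Lemma ver_free d e f : det2 d e != 0 -> det2 d f != 0 -> det2 e f != 0 ->
  free [:: ver d; ver e; ver f].
Proof.
move=> de df ef; rewrite -[X in free X]/(tval [tuple ver d; ver e; ver f]).
apply/freeP => k; rewrite !big_ord_recl big_ord0 addr0 /= => h.
have E0 := congr1 (fun D : 'rV[R]_3 => D 0 (inord 0)) h.
have E1 := congr1 (fun D : 'rV[R]_3 => D 0 (inord 1)) h.
have E2 := congr1 (fun D : 'rV[R]_3 => D 0 (inord 2)) h.
move: E0 E1 E2; do ![rewrite mxE]; rewrite !inordK //=.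
set x := k ord0; set y := k (lift ord0 ord0); set z := k (lift ord0 (lift ord0 ord0)) => E0 E1 E2.
have Ex : x * (det2 d e * det2 d f) = 0.
  rewrite -[RHS](_ : (x * d.1 ^+ 2 + (y * e.1 ^+ 2 + z * f.1 ^+ 2)) * (e.2 * f.2)
   - (x * (d.1 * d.2) + (y * (e.1 * e.2) + z * (f.1 * f.2))) * (e.1 * f.2 + e.2 * f.1)
   + (x * d.2 ^+ 2 + (y * e.2 ^+ 2 + z * f.2 ^+ 2)) * (e.1 * f.1) = 0).
    by rewrite /det2; ring.
  by rewrite E0 E1 E2; ring.
have Ey : y * (det2 d e * det2 e f) = 0.
  rewrite -[RHS](_ : (x * (d.1 * d.2) + (y * (e.1 * e.2) + z * (f.1 * f.2))) * (d.1 * f.2 + d.2 * f.1)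
   - (x * d.1 ^+ 2 + (y * e.1 ^+ 2 + z * f.1 ^+ 2)) * (d.2 * f.2)
   - (x * d.2 ^+ 2 + (y * e.2 ^+ 2 + z * f.2 ^+ 2)) * (d.1 * f.1) = 0).
    by rewrite /det2; ring.
  by rewrite E0 E1 E2; ring.
have Ez : z * (det2 d f * det2 e f) = 0.
  rewrite -[RHS](_ : (x * d.1 ^+ 2 + (y * e.1 ^+ 2 + z * f.1 ^+ 2)) * (d.2 * e.2)
   - (x * (d.1 * d.2) + (y * (e.1 * e.2) + z * (f.1 * f.2))) * (d.1 * e.2 + d.2 * e.1)
   + (x * d.2 ^+ 2 + (y * e.2 ^+ 2 + z * f.2 ^+ 2)) * (d.1 * e.1) = 0).
    by rewrite /det2; ring.
  by rewrite E0 E1 E2; ring.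
have Hx : x = 0 by apply/eqP; move/eqP: Ex; rewrite !mulf_eq0 (negbTE de) (negbTE df) !orbF.
have Hy : y = 0 by apply/eqP; move/eqP: Ey; rewrite !mulf_eq0 (negbTE de) (negbTE ef) !orbF.
have Hz : z = 0 by apply/eqP; move/eqP: Ez; rewrite !mulf_eq0 (negbTE df) (negbTE ef) !orbF.
case=> [[|[|[|i]]] Hi] //.
- by rewrite -Hx; congr k; apply/val_inj.
- by rewrite -Hy; congr k; apply/val_inj.
- by rewrite -Hz; congr k; apply/val_inj.
Qed.

(* Lagrange interpolation: a binary quadratic form is killed by the
   third divided difference over four directions. *)
Lemma ver_stress a b c d :
  det2 a b != 0 -> det2 a c != 0 -> det2 a d != 0 ->
  det2 b c != 0 -> det2 b d != 0 -> det2 c d != 0 ->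
  (det2 a b * det2 a c * det2 a d)^-1 *: ver a +
  (det2 b a * det2 b c * det2 b d)^-1 *: ver b +
  (det2 c a * det2 c b * det2 c d)^-1 *: ver c +
  (det2 d a * det2 d b * det2 d c)^-1 *: ver d = 0.
Proof.
move=> ab ac ad bc bd cd.
(* Over this common denominator the claim becomes a polynomial identity times one scalar, which
   [ring] can decide. *)
set P := det2 a b * det2 a c * det2 a d * det2 b c * det2 b d * det2 c d.
have Ea : (det2 a b * det2 a c * det2 a d)^-1 = (det2 b c * det2 b d * det2 c d) / P.
  by rewrite /P; field; rewrite ?ab ?ac ?ad ?bc ?bd ?cd.
have Eb : (det2 b a * det2 b c * det2 b d)^-1 = - (det2 a c * det2 a d * det2 c d) / P.
  by rewrite /P (det2C a b); field; rewrite ?ab ?ac ?ad ?bc ?bd ?cd.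
have Ec : (det2 c a * det2 c b * det2 c d)^-1 = (det2 a b * det2 a d * det2 b d) / P.
  by rewrite /P (det2C a c) (det2C b c); field; rewrite ?ab ?ac ?ad ?bc ?bd ?cd.
have Ed : (det2 d a * det2 d b * det2 d c)^-1 = - (det2 a b * det2 a c * det2 b c) / P.
  by rewrite /P (det2C a d) (det2C b d) (det2C c d); field; rewrite ?ab ?ac ?ad ?bc ?bd ?cd.
rewrite Ea Eb Ec Ed; move: P^-1 => Q.
by apply/row3P; do ![rewrite mxE]; rewrite !inordK //= /det2; ring.
Qed.
End Plane.

(** * Rows of the cofactor matrix and the stress of K_5 *)

Section Rows.
Variables (R : numFieldType) (n : nat).
Local Notation V := 'M[R]_(n, 3).
Implicit Types (p : 'I_n -> R * R) (i j k l m u w : 'I_n) (q : R * R) (W : {vspace V}) (A : {set edge n}).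

Definition at_ w (D : 'rV[R]_3) : V := \matrix_(i, k) ((i == w)%:R * D 0 k).
(* Rows of the cofactor matrix, as n x 3 matrices. *)
Definition rw p i j : V := at_ i (ver (p i - p j)) - at_ j (ver (p i - p j)).
Definition rwe p (e : edge n) : V := rw p (val e).1 (val e).2.
Definition S p (A : {set edge n}) : {vspace V} := spn (rwe p) A.
Definition offu u : {vspace V} := lker (linfun (@row R n 3 u)).
Definition upd p u q i : R * R := if i == u then q else p i.
Definition starV p u (N : {set 'I_n}) : {vspace V} := (\sum_(w in N) <[rw p u w]>)%VS.

Lemma rwC p i j : rw p j i = - rw p i j.
Proof. by rewrite /rw -(verN (p j - p i)) !opprB. Qed.

Lemma rwii p i : rw p i i = 0.
Proof. by rewrite /rw subrr. Qed.

Lemma lineN (v : V) : <[- v]>%VS = <[v]>%VS.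
Proof.
apply/eqP; rewrite eqEsubv -!memvE; apply/andP; split.
  by rewrite memvN memv_line.
by rewrite -[X in X \in _]opprK memvN memv_line.
Qed.

Lemma rw_row p i j u : row u (rw p i j) =
  (u == i)%:R *: ver (p i - p j) - (u == j)%:R *: ver (p i - p j).
Proof. by apply/rowP => k; rewrite !mxE. Qed.

Lemma offuP u v : (v \in offu u) = (row u v == 0).
Proof. by rewrite memv_ker lfunE. Qed.

Lemma rw_offu p i j u : u != i -> u != j -> rw p i j \in offu u.
Proof.
by move=> /negbTE ui /negbTE uj; rewrite offuP rw_row ui uj !scale0r subrr.
Qed.

Lemma S_Ed p i j : S p (Ed i j) = <[rw p i j]>%VS.
Proof.
have [->|ij] := eqVneq i j.
  by rewrite Edii /S spn0 rwii; apply/esym/eqP; rewrite -dimv_eq0 dim_vline eqxx.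
have [e -> eV] := Ed_neq ij; rewrite /S spn1 /rwe.
by case: eV => -> //=; rewrite rwC lineN.
Qed.

Lemma S_adj p A i j : adjF A i j -> rw p i j \in S p A.
Proof. by rewrite adjF_sub => /andP[_ h]; rewrite memvE -S_Ed spnS. Qed.

Lemma S_del p A u : S p A = (S p (del A u) + starV p u (nb A u))%VS.
Proof.
apply/eqP; rewrite eqEsubv subv_add; apply/andP; split; last first.
  rewrite /S spnS ?del_sub //=; apply/subv_sumP => w; rewrite in_nb => h.
  by rewrite -memvE S_adj.
rewrite {1}(del_nb A u) /S spnU addvS //; apply/spn_subP => e /bigcupP[w wN eE].
apply: (subvP (sumv_sup w wN (subvv _))); rewrite -S_Ed.
exact: (subvP (spnS (rwe p) _)) (spn_mem _ eE).
Qed.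

Lemma S_KW_offu p A (Z : {set 'I_n}) u : A \subset KW Z -> u \notin Z -> (S p A <= offu u)%VS.
Proof.
move=> sA uW; apply/spn_subP => e /(subsetP sA); rewrite in_KW => /andP[h1 h2].
by apply: rw_offu; apply: contra uW => /eqP ->.
Qed.

Lemma S_del_offu p A u : (S p (del A u) <= offu u)%VS.
Proof.
apply: (@S_KW_offu _ _ (~: [set u])); first exact: subsetIr.
by rewrite !inE eqxx.
Qed.

Lemma rw_upd p u q i j : i != u -> j != u -> rw (upd p u q) i j = rw p i j.
Proof. by move=> /negbTE h1 /negbTE h2; rewrite /rw /upd h1 h2. Qed.

Lemma S_upd p u q A (Z : {set 'I_n}) : A \subset KW Z -> u \notin Z -> S (upd p u q) A = S p A.
Proof.
move=> sA uW; apply: eq_bigr => e /(subsetP sA); rewrite in_KW => /andP[h1 h2].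
by rewrite /rwe rw_upd //; apply: contra uW => /eqP <-.
Qed.

(** Taking row [u] is a linear map that kills [W], so vectors whose images are independent stay
    independent modulo [W]. *)
Lemma dim_lowstar W u (X : seq V) : (W <= offu u)%VS -> free (map (row u) X) ->
  \dim (W + <<X>>) = (\dim W + size X)%N.
Proof.
move=> sW fX; apply/eqP; rewrite eqn_leq; apply/andP; split.
  by apply: leq_trans (dimv_add_leqif _ _) _; rewrite leq_add2l dim_span.
rewrite -(limg_ker_dim (linfun (@row R n 3 u)) (W + <<X>>)) leq_add //.
  by apply: dimvS; rewrite subv_cap addvSl.
have -> : size X = \dim <<map (row u) X>>.
  by move/eqP: fX; rewrite size_map.
apply: dimvS; rewrite limgD; apply: subv_trans (addvSr _ _).
by rewrite limg_span; rewrite (eq_map (lfunE _)).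
Qed.

(** When [p u] lies on the line through [p i] and [p j], all three Veronese vectors are multiples of
    [ver d]. Rescaling the two star rows makes their entries at [u] cancel and leaves the row of
    [ij]. *)
Lemma rw_line p i j u d (s t : R) : u != i -> u != j -> s != 0 -> t != 0 ->
  p u - p i = (s * d.1, s * d.2) -> p u - p j = (t * d.1, t * d.2) ->
  p i - p j = d -> rw p i j \in (<[rw p u i]> + <[rw p u j]>)%VS.
Proof.
move=> ui uj s0 t0 Ei Ej Eij.
have -> : rw p i j = - (s ^+ 2)^-1 *: rw p u i + (t ^+ 2)^-1 *: rw p u j.
  rewrite /rw Ei Ej Eij !verZ; apply/matrixP=> a b; rewrite !mxE.
  by field; rewrite s0 t0.
by rewrite memv_add // memvZ ?memv_line.
Qed.

(* The coefficient of the edge [ij] in the stress of the K_5 on [s]. *)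
Definition kcoef p (s : seq 'I_n) i j : R :=
  (\prod_(k <- s | (k != i) && (k != j)) br (p i) (p j) (p k))^-1.
(** Rescaled rows, for which the stress of K_5 says that the ten vectors add up to zero. *)
Definition av p s i j : V := kcoef p s i j *: rw p i j.

Definition brne p (s : seq 'I_n) := forall i j k, i \in s -> j \in s -> k \in s ->
  uniq [:: i; j; k] -> br (p i) (p j) (p k) != 0.

Lemma kcoefE p s i j k l m : uniq s -> perm_eq [:: i; j; k; l; m] s ->
  kcoef p s i j = (br (p i) (p j) (p k) * br (p i) (p j) (p l) * br (p i) (p j) (p m))^-1.
Proof.
move=> us ps; rewrite /kcoef -(perm_big _ ps) /=.
move: us; rewrite -(perm_uniq ps) /= !inE !negb_or.
rewrite !big_cons big_nil !eqxx /= andbF.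
move=> /and5P[/and4P[ij ik il im] /and3P[jk jl jm] _ _ _].
by rewrite !(eq_sym k) !(eq_sym l) !(eq_sym m) ik il im jk jl jm /= mulr1 !mulrA.
Qed.

Lemma br_swap (a b c : R * R) : br b a c = - br a b c.
Proof. by rewrite /br /det2 /=; ring. Qed.

Lemma br_rot (a b c : R * R) : br b c a = br a b c.
Proof. by rewrite /br /det2 /=; ring. Qed.

Lemma perm5_swap s i j k l m : perm_eq [:: i; j; k; l; m] s -> perm_eq [:: j; i; k; l; m] s.
Proof.
move=> h; apply: perm_trans h.
by apply/permP => P /=; rewrite addnCA.
Qed.

(** All three brackets in the coefficient change sign. Since [rw] changes sign as well, [av] is
    symmetric in its endpoints. *)
Lemma kcoefC p s i j k l m : uniq s -> perm_eq [:: i; j; k; l; m] s ->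
  kcoef p s j i = - kcoef p s i j.
Proof.
move=> us ps; rewrite (kcoefE p us ps) (kcoefE p us (perm5_swap ps)) !(br_swap (p i) (p j)).
by rewrite -invrN; congr (_^-1); ring.
Qed.

Lemma avC p s i j k l m : uniq s -> perm_eq [:: i; j; k; l; m] s ->
  av p s j i = av p s i j.
Proof. by move=> us ps; rewrite /av (kcoefC p us ps) rwC scaleNr scalerN opprK. Qed.

Lemma kcoef_neq0 p s i j k l m : uniq s -> brne p s -> perm_eq [:: i; j; k; l; m] s ->
  kcoef p s i j != 0.
Proof.
move=> us bs ps; rewrite (kcoefE p us ps) invr_eq0.
have := perm_mem ps; move: us; rewrite -(perm_uniq ps) /= !inE !negb_or.
move=> /and5P[/and4P[ij ik il im] /and3P[jk jl jm] _ _ _] ms.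
by rewrite !mulf_neq0 // bs /= ?inE -?ms ?inE ?eqxx ?orbT //= negb_or ?ij ?ik ?il ?im ?jk ?jl ?jm.
Qed.

End Rows.

Ltac perm5 h := apply: perm_trans h; clear; apply/permP => ? /=; lia.

Section Par.
Variables (K : fieldType) (vT : vectType K).
Implicit Types (W U : {vspace vT}) (u v w : vT).

(* Linear dependence of two vectors modulo a subspace. *)
Definition par W u v := (\dim (W + <[u]> + <[v]>) <= (\dim W).+1)%N.

Lemma dim_addv1 W u : \dim (W + <[u]>) = (\dim W + (u \notin W))%N.
Proof.
have [uW|uW] := boolP (u \in W); first by rewrite (addv_idPl _) ?addn0 // -memvE.
rewrite dimv_disjoint_sum ?dim_vline; last first.
  apply/eqP; rewrite -subv0; apply/subvP => x /memv_capP[xW /vlineP[k E]].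
  rewrite memv0 E; have [->|k0] := eqVneq k 0; first by rewrite scale0r.
  by case/negP: uW; rewrite -[u](scalerK k0) -E memvZ.
have [u0|//] := eqVneq u 0.
by case/negP: uW; rewrite u0 mem0v.
Qed.

Lemma memv_addl W U v : v \in W -> v \in (W + U)%VS.
Proof. exact: (subvP (addvSl _ _)). Qed.
Lemma memv_addr W U v : v \in U -> v \in (W + U)%VS.
Proof. exact: (subvP (addvSr _ _)). Qed.
Lemma memv_addline W v : v \in (W + <[v]>)%VS.
Proof. by rewrite memv_addr ?memv_line. Qed.

Lemma parP W u v : reflect (u \in W \/ v \in (W + <[u]>)%VS) (par W u v).
Proof.
rewrite /par !dim_addv1; have [uW|uW] := boolP (u \in W) => /=.
  by rewrite addn0; apply: (iffP idP) => [_|_]; [left | case: (_ \notin _) => //=; rewrite ?addn0 ?addn1].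
by apply: (iffP idP) => [h|[//|->]]; [right; apply: contraTT h => ->; lia | lia].
Qed.

Lemma memv_addlineP W u v : reflect (exists2 c, v - c *: u \in W & True) (v \in (W + <[u]>)%VS).
Proof.
apply: (iffP memv_addP) => [[a aW [b /vlineP[c ->] ->]]|[c h _]].
  by exists c; rewrite ?addrK.
by exists (v - c *: u) => //; exists (c *: u); rewrite ?memvZ ?memv_line ?subrK.
Qed.

Lemma parC W u v : par W u v = par W v u.
Proof. by rewrite /par -!addvA (addvC <[u]>%VS). Qed.

Lemma memvZE W k v : k != 0 -> (k *: v \in W) = (v \in W).
Proof.
move=> k0; apply/idP/idP; last exact: memvZ.
by move=> h; rewrite -[v](scalerK k0) memvZ.
Qed.

Lemma lineZ k v : k != 0 -> <[k *: v]>%VS = <[v]>%VS.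
Proof.
move=> k0; apply/eqP; rewrite eqEsubv -!memvE memvZ ?memv_line //=.
by rewrite -(@memvZE _ k) // memv_line.
Qed.

Lemma parZ W a b u v : a != 0 -> b != 0 -> par W (a *: u) (b *: v) = par W u v.
Proof. by move=> a0 b0; rewrite /par !lineZ. Qed.

End Par.

(** Summation by parts: a sum over edges weighted by differences of vertex values equals the sum of
    those values times the equilibrium sums at the vertices. The values used are indicators of one
    matrix row. *)
Lemma stress5_aux (F : fieldType) (xi xj xk xl xm cij cik cil cim cjk cjl cjm ckl ckm clm dij dik dil dim djk djl djm dkl dkm dlm : F) :
  cij * dij + cik * dik + cil * dil + cim * dim = 0 ->
  - cij * dij + cjk * djk + cjl * djl + cjm * djm = 0 ->
  - cik * dik + - cjk * djk + ckl * dkl + ckm * dkm = 0 ->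
  - cil * dil + - cjl * djl + - ckl * dkl + clm * dlm = 0 ->
  - cim * dim + - cjm * djm + - ckm * dkm + - clm * dlm = 0 ->
  cij * ((xi - xj) * dij) + cik * ((xi - xk) * dik) + cil * ((xi - xl) * dil) + cim * ((xi - xm) * dim) + cjk * ((xj - xk) * djk) + cjl * ((xj - xl) * djl) + cjm * ((xj - xm) * djm) + ckl * ((xk - xl) * dkl) + ckm * ((xk - xm) * dkm) + clm * ((xl - xm) * dlm) = 0.
Proof.
move=> Ei Ej Ek El Em.
transitivity (xi * (cij * dij + cik * dik + cil * dil + cim * dim) + xj * (- cij * dij + cjk * djk + cjl * djl + cjm * djm) + xk * (- cik * dik + - cjk * djk + ckl * dkl + ckm * dkm) + xl * (- cil * dil + - cjl * djl + - ckl * dkl + clm * dlm) + xm * (- cim * dim + - cjm * djm + - ckm * dkm + - clm * dlm)); first by ring.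
by rewrite Ei Ej Ek El Em !mulr0 !addr0.
Qed.

Section Stress.
Variables (R : numFieldType) (n : nat).
Local Notation V := 'M[R]_(n, 3).
Implicit Types (p : 'I_n -> R * R) (i j k l m u w : 'I_n) (q : R * R) (W : {vspace V}).

(** The brackets containing [i] are determinants of pairs of directions from [p i], so equilibrium
    at [i] is [ver_stress] for its four directions. *)
Lemma vertex_stress p s i j k l m : uniq s -> brne p s -> perm_eq [:: i; j; k; l; m] s ->
  kcoef p s i j *: ver (p i - p j) + kcoef p s i k *: ver (p i - p k) +
  kcoef p s i l *: ver (p i - p l) + kcoef p s i m *: ver (p i - p m) = 0.
Proof.
move=> us bs ps.
have ps2 : perm_eq [:: i; k; j; l; m] s by perm5 ps.
have ps3 : perm_eq [:: i; l; j; k; m] s by perm5 ps.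
have ps4 : perm_eq [:: i; m; j; k; l] s by perm5 ps.
rewrite (kcoefE p us ps) (kcoefE p us ps2) (kcoefE p us ps3) (kcoefE p us ps4).
rewrite -!(verN (p i - _)) !opprB.
have := perm_mem ps; move: us; rewrite -(perm_uniq ps) /= !inE !negb_or.
move=> /and5P[/and4P[ij ik il im] /and3P[jk jl jm] /andP[kl km] lm _] ms.
apply: ver_stress; apply: (bs i); rewrite /= ?inE -?ms ?inE ?eqxx ?orbT //=;
  by rewrite negb_or ?ij ?ik ?il ?im ?jk ?jl ?jm ?kl ?km ?lm.
Qed.

Lemma stress5 p s i j k l m : uniq s -> brne p s -> perm_eq [:: i; j; k; l; m] s ->
  av p s i j + av p s i k + av p s i l + av p s i m + av p s j k + av p s j l
  + av p s j m + av p s k l + av p s k m + av p s l m = 0.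
Proof.
move=> us bs ps.
have pj : perm_eq [:: j; i; k; l; m] s by perm5 ps.
have pk : perm_eq [:: k; i; j; l; m] s by perm5 ps.
have pl : perm_eq [:: l; i; j; k; m] s by perm5 ps.
have pm : perm_eq [:: m; i; j; k; l] s by perm5 ps.
have pik : perm_eq [:: i; k; j; l; m] s by perm5 ps.
have pil : perm_eq [:: i; l; j; k; m] s by perm5 ps.
have pim : perm_eq [:: i; m; j; k; l] s by perm5 ps.
have pjk : perm_eq [:: j; k; i; l; m] s by perm5 ps.
have pjl : perm_eq [:: j; l; i; k; m] s by perm5 ps.
have pjm : perm_eq [:: j; m; i; k; l] s by perm5 ps.
have pkl : perm_eq [:: k; l; i; j; m] s by perm5 ps.
have pkm : perm_eq [:: k; m; i; j; l] s by perm5 ps.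
have plm : perm_eq [:: l; m; i; j; k] s by perm5 ps.
have Ei := vertex_stress us bs ps.
have Ej := vertex_stress us bs pj.
have Ek := vertex_stress us bs pk.
have El := vertex_stress us bs pl.
have Em := vertex_stress us bs pm.
apply/matrixP => a b.
have VC x y : ver (p x - p y) 0 b = ver (p y - p x) 0 b by rewrite -(verN (p x - p y)) opprB.
have EA (D D' : 'rV[R]_3) : (D + D') 0 b = D 0 b + D' 0 b by rewrite mxE.
have EX (c : R) (D : 'rV[R]_3) : (c *: D) 0 b = c * D 0 b by rewrite mxE.
have E0 : (0 : 'rV[R]_3) 0 b = 0 by rewrite mxE.
have AV x y : av p s x y a b = kcoef p s x y * (((a == x)%:R - (a == y)%:R) * ver (p x - p y) 0 b).
  rewrite /av [LHS]mxE; congr (_ * _); rewrite [LHS]mxE [X in _ + X]mxE.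
  by rewrite ![at_ _ _ _ _]mxE mulrBl.
have {}Ei := congr1 (fun D : 'rV[R]_3 => D 0 b) Ei.
have {}Ej := congr1 (fun D : 'rV[R]_3 => D 0 b) Ej.
have {}Ek := congr1 (fun D : 'rV[R]_3 => D 0 b) Ek.
have {}El := congr1 (fun D : 'rV[R]_3 => D 0 b) El.
have {}Em := congr1 (fun D : 'rV[R]_3 => D 0 b) Em.
rewrite /= !EA !EX E0 in Ei Ej Ek El Em.
rewrite (kcoefC p us ps) (VC j i) in Ej.
rewrite (kcoefC p us pik) (kcoefC p us pjk) (VC k i) (VC k j) in Ek.
rewrite (kcoefC p us pil) (kcoefC p us pjl) (kcoefC p us pkl) (VC l i) (VC l j) (VC l k) in El.
rewrite (kcoefC p us pim) (kcoefC p us pjm) (kcoefC p us pkm) (kcoefC p us plm) (VC m i) (VC m j) (VC m k) (VC m l) in Em.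
have EAm (M N : V) : (M + N) a b = M a b + N a b by rewrite mxE.
rewrite [RHS]mxE !EAm !AV; exact: stress5_aux Ei Ej Ek El Em.
Qed.
End Stress.

(** * Dependencies forced by moving a vertex to special positions *)

Section Star.
Variables (R : numFieldType) (n : nat).
Local Notation V := 'M[R]_(n, 3).
Local Notation offu := (@offu R n).
Implicit Types (p : 'I_n -> R * R) (i j k l m u w : 'I_n) (q : R * R) (W : {vspace V}) (N : {set 'I_n}).

(** One field per use of general position: [gen2] makes every row nonzero, [gen3] forbids collinear
    triples, [gen4] makes the lines [ij] and [kl] meet, and [gen4'] keeps the reflection of [p j] in
    [p i] off the line [kl]. *)
Record general p : Prop := General {
  gen2 : forall i j, i != j -> (p i - p j).1 != 0;
  gen3 : forall i j k, uniq [:: i; j; k] -> br (p i) (p j) (p k) != 0;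
  gen4 : forall i j k l, uniq [:: i; j; k; l] -> det2 (p i - p j) (p k - p l) != 0;
  gen4' : forall i j k l, uniq [:: i; j; k; l] -> br (p i + p i - p j) (p k) (p l) != 0
}.

Lemma general_brne p s : general p -> brne p s.
Proof. by move=> g i j k _ _ _; apply: gen3. Qed.

Lemma brne_cons p u s : (forall x y, x \in s -> y \in s -> x != y -> br (p u) (p x) (p y) != 0) ->
  brne p s -> brne p (u :: s).
Proof.
move=> H bs i j k; rewrite !inE /= andbT !inE negb_or.
move=> /orP[/eqP ->|si] /orP[/eqP ->|sj] /orP[/eqP ->|sk]; rewrite ?eqxx ?andbF ?andFb //.
- by move=> /andP[_ jk]; apply: H.
- by move=> /andP[/andP[_ ik] _]; rewrite -br_rot; apply: H => //; rewrite eq_sym.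
- by move=> /andP[/andP[ij _] _]; rewrite br_rot; apply: H.
by move=> h; apply: bs; rewrite //= andbT !inE negb_or.
Qed.

(** Every coefficient of the stress of K_5 is nonzero, so the row of [ij] can be solved for. *)
Lemma K5_cl p s i j k l m (U : {vspace V}) : uniq s -> brne p s ->
  perm_eq [:: i; j; k; l; m] s ->
  (forall x y, x \in s -> y \in s -> ~~ (((x == i) && (y == j)) || ((x == j) && (y == i))) -> rw p x y \in U) ->
  rw p i j \in U.
Proof.
move=> us bs ps H.
have := kcoef_neq0 us bs ps; have := stress5 us bs ps.
have := perm_mem ps; move: us; rewrite -(perm_uniq ps) /= !inE !negb_or.
move=> /and5P[/and4P[ij ik il im] /and3P[jk jl jm] /andP[kl km] lm _] ms E c0.
rewrite -(memvZE _ _ c0) -/(av p s i j); move: E; rewrite -!addrA => /eqP; rewrite addr_eq0 => /eqP ->.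
rewrite memvN !memvD // memvZ // H -?ms ?inE ?eqxx ?orbT //.
all: rewrite ?(negbTE ij) ?(eq_sym j) ?(eq_sym k) ?(eq_sym l) ?(eq_sym m).
all: rewrite ?(negbTE ij) ?(negbTE ik) ?(negbTE il) ?(negbTE im) ?(negbTE jk) ?(negbTE jl) ?(negbTE jm) ?(negbTE kl) ?(negbTE km) ?andbF ?orbF //=.
Qed.

Lemma starV_sub p u N N' : N \subset N' -> (starV p u N <= starV p u N')%VS.
Proof.
move=> s; apply/subv_sumP => w wN.
by apply: (sumv_sup w); rewrite ?subvv ?(subsetP s).
Qed.

Lemma starV_mem p u N w : w \in N -> rw p u w \in starV p u N.
Proof. by move=> wN; rewrite memvE (sumv_sup w). Qed.

Lemma starVU p u N N' : starV p u (N :|: N') = (starV p u N + starV p u N')%VS.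
Proof.
apply/eqP; rewrite eqEsubv subv_add !starV_sub ?subsetUl ?subsetUr // !andbT.
apply/subv_sumP => w; rewrite inE -memvE => /orP[] h.
  by rewrite memv_addl ?starV_mem.
by rewrite memv_addr ?starV_mem.
Qed.

Lemma dim_starV p u N : (\dim (starV p u N) <= #|N|)%N.
Proof.
apply: leq_trans (dimv_leq_sum _ _ _) _; rewrite -sum1_card; apply: leq_sum => w _.
by rewrite dim_vline leq_b1.
Qed.

Lemma star3 p u i j k W (U : {vspace V}) : (W <= offu u)%VS -> (W <= U)%VS ->
  u \notin [:: i; j; k] ->
  det2 (p u - p i) (p u - p j) != 0 -> det2 (p u - p i) (p u - p k) != 0 ->
  det2 (p u - p j) (p u - p k) != 0 ->
  rw p u i \in U -> rw p u j \in U -> rw p u k \in U -> (\dim W + 3 <= \dim U)%N.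
Proof.
move=> sW sWU; rewrite !inE !negb_or => /and3P[ui uj uk] ij ik jk hi hj hk.
rewrite -[3%N]/(size [:: rw p u i; rw p u j; rw p u k]) -(@dim_lowstar _ _ _ u) //.
  apply: dimvS; rewrite subv_add sWU; apply/span_subvP => x.
  by rewrite !inE => /or3P[] /eqP ->.
by rewrite /= !rw_row eqxx !scale1r (negbTE ui) (negbTE uj) (negbTE uk) !scale0r !subr0 ver_free.
Qed.

Section Specialise.
Variables (p : 'I_n -> R * R) (u : 'I_n) (N : {set 'I_n}) (W : {vspace V}).
Hypotheses (gp : general p) (uN : u \notin N) (sW : (W <= offu u)%VS).

Let neu i : i \in N -> u != i.
Proof. by move=> iN; apply: contra uN => /eqP ->. Qed.

Let st q := (W + starV (upd p u q) u N)%VS.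

Lemma upd_u q : upd p u q u = q. Proof. by rewrite /upd eqxx. Qed.
Lemma upd_N q i : i \in N -> upd p u q i = p i.
Proof. by move=> /neu; rewrite /upd eq_sym => /negbTE ->. Qed.

Lemma st_line q i j (s t : R) : i \in N -> j \in N -> s != 0 -> t != 0 ->
  q - p i = (s * (p i - p j).1, s * (p i - p j).2) ->
  q - p j = (t * (p i - p j).1, t * (p i - p j).2) -> rw p i j \in st q.
Proof.
move=> iN jN s0 t0 Ei Ej.
have ui : i != u by rewrite eq_sym neu. have uj : j != u by rewrite eq_sym neu.
rewrite memv_addr // -(rw_upd p q ui uj).
have := @rw_line _ _ (upd p u q) i j u (p i - p j) s t.
rewrite !upd_u !upd_N // => /(_ (neu iN) (neu jN) s0 t0 Ei Ej erefl).
apply: subvP; rewrite subv_add -!memvE !starV_mem //.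
Qed.

(** With [u] placed on the line [ij], the row of [ij] enters the span. The star rows to [i], [k],
    [l] already add three dimensions to any space that is zero at [u], so no room is left unless
    that row was in [W]. *)
Lemma L0_spec i j k l : (forall q, \dim (st q) <= \dim W + 3)%N ->
  uniq [:: i; j; k; l] -> {subset [:: i; j; k; l] <= N} -> rw p i j \in W.
Proof.
move=> H us sN.
have iN : i \in N by rewrite sN ?inE ?eqxx ?orbT.
have jN : j \in N by rewrite sN ?inE ?eqxx ?orbT.
have kN : k \in N by rewrite sN ?inE ?eqxx ?orbT.
have lN : l \in N by rewrite sN ?inE ?eqxx ?orbT.
set q := p i + p i - p j.
have rN : rw p i j \in st q.
  apply: (st_line (s := 1) (t := 2)) => //; rewrite ?oner_eq0 ?pnatr_eq0 //.
    by rewrite /q !mul1r addrAC addrK; case: (p i - p j).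
  by rewrite /q; congr pair => /=; ring.
have d1 : det2 (q - p i) (q - p k) != 0.
  have -> : det2 (q - p i) (q - p k) = - br (p i) (p j) (p k) * -1.
    by rewrite /q /br /det2 /=; ring.
  rewrite mulrN1 opprK gen3 //; move: us; rewrite /= !inE !negb_or.
  by move=> /and4P[/and3P[-> -> _] /andP[-> _] _ _].
have d2 : det2 (q - p i) (q - p l) != 0.
  have -> : det2 (q - p i) (q - p l) = - br (p i) (p j) (p l) * -1.
    by rewrite /q /br /det2 /=; ring.
  rewrite mulrN1 opprK gen3 //; move: us; rewrite /= !inE !negb_or.
  by move=> /and4P[/and3P[-> _ ->] /andP[_ ->] _ _].
have d3 : det2 (q - p k) (q - p l) != 0.
  have -> : det2 (q - p k) (q - p l) = br q (p k) (p l).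
    by rewrite /br /det2 /=; ring.
  by apply: gen4'.
have sWi : (W + <[rw p i j]> <= offu u)%VS.
  by rewrite subv_add sW -memvE rw_offu ?neu.
have : (\dim (W + <[rw p i j]>) + 3 <= \dim (st q))%N.
  apply: (@star3 (upd p u q) u i k l) => //; rewrite ?upd_u ?upd_N //.
  - by rewrite subv_add addvSl -memvE.
  - by rewrite !inE !negb_or !neu.
  - by rewrite memv_addr ?starV_mem.
  - by rewrite memv_addr ?starV_mem.
  - by rewrite memv_addr ?starV_mem.
have := H q; rewrite dim_addv1; case: (_ \in W) => //= h1 h2.
by have := leq_trans h2 h1; rewrite leq_add2r addn1 ltnn.
Qed.

(** With [u] placed at the intersection of the lines [ij] and [kl], both rows enter the span. The
    star rows to [i], [k], [m] account for three dimensions, so the two rows share the single one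
    that remains. *)
Lemma LX_spec i j k l m : (forall q, \dim (st q) <= \dim W + 4)%N ->
  uniq [:: i; j; k; l; m] -> {subset [:: i; j; k; l; m] <= N} ->
  par W (rw p i j) (rw p k l).
Proof.
move=> H us sN.
have iN : i \in N by rewrite sN ?inE ?eqxx ?orbT.
have jN : j \in N by rewrite sN ?inE ?eqxx ?orbT.
have kN : k \in N by rewrite sN ?inE ?eqxx ?orbT.
have lN : l \in N by rewrite sN ?inE ?eqxx ?orbT.
have mN : m \in N by rewrite sN ?inE ?eqxx ?orbT.
move: us; rewrite /= !inE !negb_or.
move=> /and5P[/and4P[ij ik il im] /and3P[jk jl jm] /andP[kl km] lm _].
set D := det2 (p i - p j) (p k - p l).
have D0 : D != 0 by apply: gen4 => //=; rewrite !inE !negb_or ij ik il jk jl kl.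
(* Cramer's rule for the intersection point [p i + s (p i - p j) = p k - t (p k - p l)]. *)
set s := det2 (p k - p i) (p k - p l) / D.
set t := det2 (p i - p j) (p k - p i) / D.
have E1 : (p i).1 + s * (p i - p j).1 = (p k).1 - t * (p k - p l).1.
  by rewrite /s /t /D /det2 /=; field; move: D0; rewrite /D /det2 /=.
have E2 : (p i).2 + s * (p i - p j).2 = (p k).2 - t * (p k - p l).2.
  by rewrite /s /t /D /det2 /=; field; move: D0; rewrite /D /det2 /=.
have s0 : s != 0.
  rewrite /s mulf_neq0 ?invr_eq0 //.
  have -> : det2 (p k - p i) (p k - p l) = br (p k) (p i) (p l) by rewrite /br /det2 /=; ring.
  by rewrite gen3 //= !inE !negb_or (eq_sym k) ik kl il.
have s1 : s + 1 != 0.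
  have -> : s + 1 = br (p k) (p j) (p l) / D.
    rewrite /s -[X in _ + X](divff D0) -mulrDl; congr (_ / _).
    by rewrite /D /br /det2 /=; ring.
  by rewrite mulf_neq0 ?invr_eq0 // gen3 //= !inE !negb_or (eq_sym k) jk kl jl.
have t0 : - t != 0.
  rewrite oppr_eq0 /t mulf_neq0 ?invr_eq0 //.
  have -> : det2 (p i - p j) (p k - p i) = - br (p i) (p j) (p k) by rewrite /br /det2 /=; ring.
  by rewrite oppr_eq0 gen3 //= !inE !negb_or ij ik jk.
have t1 : 1 - t != 0.
  have -> : 1 - t = br (p i) (p j) (p l) / D.
    rewrite /t -[X in X - _](divff D0) -mulrBl; congr (_ / _).
    by rewrite /D /br /det2 /=; ring.
  by rewrite mulf_neq0 ?invr_eq0 // gen3 //= !inE !negb_or ij il jl.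
have [q [a1 a2 b1 b2]] : exists q : R * R, [/\ q.1 = (p i).1 + s * (p i - p j).1,
    q.2 = (p i).2 + s * (p i - p j).2, q.1 = (p k).1 - t * (p k - p l).1 &
    q.2 = (p k).2 - t * (p k - p l).2].
  by exists ((p i).1 + s * (p i - p j).1, (p i).2 + s * (p i - p j).2).
have qi : q - p i = (s * (p i - p j).1, s * (p i - p j).2).
  by rewrite [LHS]surjective_pairing; congr pair; rewrite /= ?a1 ?a2 /=; ring.
have qj : q - p j = ((s + 1) * (p i - p j).1, (s + 1) * (p i - p j).2).
  by rewrite [LHS]surjective_pairing; congr pair; rewrite /= ?a1 ?a2 /=; ring.
have qk : q - p k = (- t * (p k - p l).1, - t * (p k - p l).2).
  by rewrite [LHS]surjective_pairing; congr pair; rewrite /= ?b1 ?b2 /=; ring.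
have ql : q - p l = ((1 - t) * (p k - p l).1, (1 - t) * (p k - p l).2).
  by rewrite [LHS]surjective_pairing; congr pair; rewrite /= ?b1 ?b2 /=; ring.
have rij : rw p i j \in st q by apply: st_line qi qj.
have rkl : rw p k l \in st q by apply: st_line qk ql.
have sWi : (W + <[rw p i j]> + <[rw p k l]> <= offu u)%VS.
  by rewrite !subv_add sW -!memvE !rw_offu ?neu.
have : (\dim (W + <[rw p i j]> + <[rw p k l]>) + 3 <= \dim (st q))%N.
  apply: (@star3 (upd p u q) u i k m) => //; rewrite ?upd_u ?upd_N //.
  - by rewrite !subv_add addvSl -!memvE rij.
  - by rewrite !inE !negb_or !neu.
  - rewrite qi qk; have -> : det2 (s * (p i - p j).1, s * (p i - p j).2)
        (- t * (p k - p l).1, - t * (p k - p l).2) = s * - t * D.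
      by rewrite /D /det2 /=; ring.
    by apply: mulf_neq0 => //; apply: mulf_neq0.
  - have -> : det2 (q - p i) (q - p m) = s * br (p i) (p j) (p m).
      by rewrite qi /br /det2 /= a1 a2 /=; ring.
    by rewrite mulf_neq0 // gen3 //= !inE !negb_or ij im jm.
  - have -> : det2 (q - p k) (q - p m) = - t * br (p k) (p l) (p m).
      by rewrite qk /br /det2 /= b1 b2 /=; ring.
    by rewrite mulf_neq0 // gen3 //= !inE !negb_or kl km lm.
  - by rewrite memv_addr ?starV_mem.
  - by rewrite memv_addr ?starV_mem.
  - by rewrite memv_addr ?starV_mem.
by move=> h; rewrite /par; have := leq_trans h (H q); rewrite -[4%N]/(1 + 3)%N addnA leq_add2r addn1.
Qed.

(** The vertex [u] is moved to the reflection of [p j] in [p i]. The row of [ij] enters the span,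
    and so does the part [g] away from [u] of the stress of the K_5 on [u], [i], [k], [l], [m];
    hence [g] is a multiple of that row modulo [W]. Up to edges already controlled by [LX_spec], [g]
    is minus the sum of the scaled rows of [ik], [il], [im]. *)
Lemma LV_spec s i j k l m : (forall q, \dim (st q) <= \dim W + 4)%N ->
  uniq s -> perm_eq [:: i; j; k; l; m] s -> {subset s <= N} ->
  par W (av p s i j) (av p s i j + av p s i k + av p s i l + av p s i m).
Proof.
move=> H us ps sN.
have := perm_mem ps; have us5 := us; move: us5; rewrite -(perm_uniq ps) => us5 ms.
move: (us5); rewrite /= !inE !negb_or.
move=> /and5P[/and4P[ij ik il im] /and3P[jk jl jm] /andP[kl km] lm _].
have iN : i \in N by rewrite sN -?ms ?inE ?eqxx ?orbT.
have jN : j \in N by rewrite sN -?ms ?inE ?eqxx ?orbT.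
have kN : k \in N by rewrite sN -?ms ?inE ?eqxx ?orbT.
have lN : l \in N by rewrite sN -?ms ?inE ?eqxx ?orbT.
have mN : m \in N by rewrite sN -?ms ?inE ?eqxx ?orbT.
have bs : brne p s by apply: general_brne.
have c0 : kcoef p s i j != 0 by apply: kcoef_neq0 ps.
set q := p i + p i - p j.
have rij : rw p i j \in st q.
  apply: (st_line (s := 1) (t := 2)) => //; rewrite ?oner_eq0 ?pnatr_eq0 //.
    by rewrite /q !mul1r addrAC addrK; case: (p i - p j).
  by rewrite /q; congr pair => /=; ring.
set p' := upd p u q; set s' := [:: u; i; k; l; m].
have us' : uniq s' by rewrite /= !inE !negb_or !neu //= ik il im kl km lm.
have bq x y : uniq [:: i; j; x; y] -> br q (p x) (p y) != 0 by move=> h; apply: gen4'.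
have bqi x : uniq [:: i; j; x] -> br q (p i) (p x) != 0.
  move=> h; have -> : br q (p i) (p x) = br (p i) (p j) (p x).
    by rewrite /q /br /det2 /=; ring.
  by rewrite gen3.
have rN x y : x \in N -> y \in N -> rw p' x y = rw p x y.
  by move=> xN yN; rewrite rw_upd // eq_sym neu.
have bs' : brne p' s'.
  apply: brne_cons; last first.
    move=> x y z; have sub w : w \in [:: i; k; l; m] -> w \in N.
      by rewrite !inE => /or4P[] /eqP ->.
    by move=> /sub hx /sub hy /sub hz h; rewrite /p' !upd_N // gen3.
  have br_sym (a b c : R * R) : br a c b = - br a b c by rewrite /br /det2 /=; ring.
  move=> x y; rewrite /p' upd_u !inE.
  move=> /or4P[] /eqP -> /or4P[] /eqP ->; rewrite ?eqxx // => _; rewrite !upd_N //;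
    rewrite ?[br q _ (p i)]br_sym ?oppr_eq0 ?bqi ?bq //= !inE !negb_or ?(eq_sym l) ?(eq_sym m)
      ?ij ?ik ?il ?im ?jk ?jl ?jm ?kl ?km ?lm //.
have pu w x y z : perm_eq [:: w; x; y; z] [:: i; k; l; m] -> perm_eq [:: u; w; x; y; z] s'.
  by rewrite perm_cons.
set g := av p' s' i k + av p' s' i l + av p' s' i m + av p' s' k l + av p' s' k m + av p' s' l m.
have gst : g \in st q.
  have E := stress5 us' bs' (perm_refl s').
  have -> : g = - (av p' s' u i + av p' s' u k + av p' s' u l + av p' s' u m).
    by apply/eqP; rewrite -addr_eq0 addrC /g !addrA; apply/eqP.
  by rewrite memvN !memvD // memvZ // memv_addr ?starV_mem.
have [ijW|ijW] := boolP (rw p i j \in W); first by apply/parP; left; rewrite memvZ.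
have sU : (W + <[rw p i j]> + <[g]> <= offu u)%VS.
  rewrite !subv_add sW -!memvE !rw_offu ?neu //= /g /av.
  by rewrite !memvD // memvZ // rN // rw_offu ?neu.
have gW : g \in (W + <[rw p i j]>)%VS.
  have : (\dim (W + <[rw p i j]> + <[g]>) + 3 <= \dim (st q))%N.
    apply: (@star3 p' u i k l) => //; rewrite /p' ?upd_u ?upd_N //.
    - by rewrite !subv_add addvSl -!memvE rij.
    - by rewrite !inE !negb_or !neu.
    - have -> : det2 (q - p i) (q - p k) = br (p i) (p j) (p k).
        by rewrite /q /br /det2 /=; ring.
      by rewrite gen3 //= !inE !negb_or ij ik jk.
    - have -> : det2 (q - p i) (q - p l) = br (p i) (p j) (p l).
        by rewrite /q /br /det2 /=; ring.
      by rewrite gen3 //= !inE !negb_or ij il jl.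
    - have -> : det2 (q - p k) (q - p l) = br q (p k) (p l).
        by rewrite /br /det2 /=; ring.
      by rewrite bq //= !inE !negb_or ij ik il jk jl kl.
    - by rewrite memv_addr ?starV_mem.
    - by rewrite memv_addr ?starV_mem.
    - by rewrite memv_addr ?starV_mem.
  move=> h; have := leq_trans h (H q).
  rewrite -[4%N]/(1 + 3)%N addnA leq_add2r !dim_addv1 ijW.
  by case: (g \in _) => //=; rewrite addn1 ltnn.
have parW x y z : perm_eq [:: x; y; z] [:: k; l; m] -> rw p x y \in (W + <[rw p i j]>)%VS.
  move=> pxyz; have us1 : uniq [:: i; j; x; y; z].
    rewrite (perm_uniq (_ : perm_eq _ [:: i; j; k; l; m])) //.
    by rewrite !perm_cons.
  have sub5 : {subset [:: i; j; x; y; z] <= N}.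
    move=> w; rewrite (perm_mem (_ : perm_eq _ [:: i; j; k; l; m])) ?perm_cons //.
    by rewrite ms; apply: sN.
  by have /parP[h|//] := LX_spec H us1 sub5; rewrite h in ijW.
(* Reflection in [p i] only changes the sign of the bracket of [i], [x] and the reflected point;
   this is why that point of the line is chosen. *)
have cE x y z : perm_eq [:: x; y; z] [:: k; l; m] -> av p' s' i x = - av p s i x.
  move=> pxyz; have p1 : perm_eq [:: i; x; u; y; z] s'.
    apply: (@perm_trans _ [:: u; i; x; y; z]); last by rewrite !perm_cons.
    by clear; apply/permP=> P /=; lia.
  have p2 : perm_eq [:: i; x; j; y; z] s.
    apply: perm_trans ps; apply: (@perm_trans _ [:: i; j; x; y; z]); last by rewrite !perm_cons.
    by clear; apply/permP=> P /=; lia.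
  have [xN yN zN] : [/\ x \in N, y \in N & z \in N].
    by split; apply: sN; rewrite -(perm_mem p2) !inE eqxx ?orbT.
  rewrite /av (kcoefE p' us' p1) (kcoefE p us p2) rN // /p' upd_u !upd_N //.
  have -> : br (p i) (p x) q = - br (p i) (p x) (p j) by rewrite /q /br /det2 /=; ring.
  by rewrite !mulNr invrN scaleNr.
have P1 : perm_eq [:: l; k; m] [:: k; l; m] by clear; apply/permP=> P /=; lia.
have P2 : perm_eq [:: m; k; l] [:: k; l; m] by clear; apply/permP=> P /=; lia.
have P3 : perm_eq [:: k; m; l] [:: k; l; m] by clear; apply/permP=> P /=; lia.
have P4 : perm_eq [:: l; m; k] [:: k; l; m] by clear; apply/permP=> P /=; lia.
apply/parP; right; rewrite lineZ //.
set r := av p' s' k l + av p' s' k m + av p' s' l m.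
have rW : r \in (W + <[rw p i j]>)%VS.
  rewrite !memvD // memvZ // rN //; [exact: parW (perm_refl _) | exact: parW P3 | exact: parW P4].
have Eg : g = - av p s i k - av p s i l - av p s i m + r.
  by rewrite /g /r !addrA (cE _ _ _ (perm_refl _)) (cE _ _ _ P1) (cE _ _ _ P2).
have -> : av p s i j + av p s i k + av p s i l + av p s i m = av p s i j - g + r.
  by rewrite Eg; clearbody r; rewrite !opprD !opprK !addrA subrK.
by apply: memvD => //; apply: memvB => //; rewrite memvZ // memv_addline.
Qed.
End Specialise.
End Star.

(** * Ten vectors on the edges of K_5 satisfying these dependencies *)

Section Five.
Variables (K : fieldType) (vT : vectType K) (I : eqType).
Implicit Types (u v w : vT) (i j k l m : I).

Definition dep u v := (u == 0) || (v \in <[u]>%VS).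

Lemma depC u v : dep u v = dep v u.
Proof.
rewrite /dep; wlog: u v / dep u v => [H|].
  apply/idP/idP => h; [rewrite -(H u v) // | rewrite -(H v u) //].
move=> h; rewrite [LHS]h; apply/esym; case/orP: h => [/eqP ->|/vlineP[c ->]].
  by rewrite mem0v orbT.
have [->|c0] := eqVneq c 0; first by rewrite scale0r eqxx.
by rewrite (lineZ _ c0) memv_line orbT.
Qed.

Lemma dep_mem u v : dep u v -> u != 0 -> v \in <[u]>%VS.
Proof. by case/orP => // /eqP ->; rewrite eqxx. Qed.

Lemma line_sub u v w : v \in <[u]>%VS -> w \in <[v]>%VS -> w \in <[u]>%VS.
Proof. by move=> /vlineP[c ->] /vlineP[d ->]; rewrite !memvZ // memv_line. Qed.

Lemma ndep_neq0 u v : ~~ dep u v -> u != 0 /\ v != 0.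
Proof.
move=> h; split; first by apply: contra h => /eqP ->; rewrite /dep eqxx.
by rewrite depC in h; apply: contra h => /eqP ->; rewrite /dep eqxx.
Qed.

Lemma ndep_cap u v w : ~~ dep u v -> w \in <[u]>%VS -> w \in <[v]>%VS -> w = 0.
Proof.
move=> h /vlineP[c ->] hv; have [->|c0] := eqVneq c 0; first by rewrite scale0r.
by move: hv; rewrite memvZE // => hv; case/negP: h; rewrite depC /dep hv orbT.
Qed.

Lemma dep_cap u v w : ~~ dep u v -> dep u w -> dep v w -> w = 0.
Proof.
move=> h; have [u0 v0] := ndep_neq0 h => /dep_mem/(_ u0) hu /dep_mem/(_ v0) hv.
exact: ndep_cap h hu hv.
Qed.

Variables (s : seq I) (a : I -> I -> vT).
Hypothesis aC : forall i j k l m, perm_eq [:: i; j; k; l; m] s -> a j i = a i j.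
Hypothesis HX : forall i j k l m, perm_eq [:: i; j; k; l; m] s -> dep (a i j) (a k l).
Hypothesis HV : forall i j k l m, perm_eq [:: i; j; k; l; m] s ->
  dep (a i j) (a i j + a i k + a i l + a i m).

(** The vertex sum at [j] puts [a j k] on the line of [a i j]. Were it nonzero, [a i l] and [a i m]
    would lie on that line too, and then so would [a i k]. The sums at [k] and along [kl] remove the
    last two edges, because the lines of [a i j] and [a i k] meet only in zero. *)
Lemma five_caseA i j k l m : perm_eq [:: i; j; k; l; m] s -> ~~ dep (a i j) (a i k) ->
  a j l = 0 -> a j m = 0 -> [/\ a j k = 0, a k l = 0 & a k m = 0].
Proof.
move=> ps h jl jm; have [u0 v0] := ndep_neq0 h.
have pj : perm_eq [:: j; i; k; l; m] s by perm5 ps.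
have pik : perm_eq [:: i; k; j; l; m] s by perm5 ps.
have pjk : perm_eq [:: j; k; i; l; m] s by perm5 ps.
have pjk' : perm_eq [:: j; k; i; m; l] s by perm5 ps.
have pk : perm_eq [:: k; i; j; l; m] s by perm5 ps.
have pkl : perm_eq [:: k; l; i; j; m] s by perm5 ps.
have pkm : perm_eq [:: k; m; i; j; l] s by perm5 ps.
have pijm : perm_eq [:: i; j; k; m; l] s by perm5 ps.
have jku : a j k \in <[a i j]>%VS.
  have := HV pj; rewrite jl jm !addr0 (aC ps) => /dep_mem/(_ u0) hs.
  by rewrite -[a j k](addKr (a i j)) addrC memvB ?memv_line.
have jk : a j k = 0.
  have [//|nz] := eqVneq (a j k) 0.
  have il := line_sub jku (dep_mem (HX pjk) nz).
  have im := line_sub jku (dep_mem (HX pjk') nz).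
  have hs := dep_mem (HV ps) u0.
  case/negP: h; rewrite /dep (_ : a i k = a i j + a i k + a i l + a i m - a i m - a i l - a i j).
    by rewrite !memvB ?memv_line ?orbT.
  by rewrite !addrK [a i j + _]addrC addrK.
have kl := dep_mem (HX ps) u0; have km := dep_mem (HX pijm) u0.
have sk := HV pk; rewrite (aC pik) (aC pjk) jk addr0 in sk.
have kv : a k l + a k m \in <[a i k]>%VS.
  rewrite (_ : _ + _ = a i k + a k l + a k m - a i k); last by rewrite -(addrA (a i k)) [RHS]addrC addKr.
  by rewrite memvB ?memv_line // dep_mem.
have E0 : a k l + a k m = 0 by apply: (ndep_cap h) => //; apply: memvD.
have kl0 : a k l = 0.
  have := HV pkl; rewrite (aC pik) (aC pjk) jk addr0.
  rewrite (_ : _ + _ = a i k); last by rewrite addrAC E0 add0r.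
  case/orP => [/eqP //|/(line_sub kl) hv].
  by case/negP: h; rewrite /dep hv orbT.
by split=> //; rewrite -E0 kl0 add0r.
Qed.

(** This is how the K_4 pattern arises: [l] becomes the trivial vertex, and opposite edges of the
    K_4 on [i], [j], [k], [m] carry equal vectors. Each equation comes from a vertex sum lying on
    two independent lines at once. *)
Lemma five_caseB i j k l m : perm_eq [:: i; j; k; l; m] s -> ~~ dep (a i j) (a i k) ->
  a l m = 0 -> a j l = 0 -> a k l = 0 -> a j m != 0 -> a k m != 0 ->
  [/\ a i l = 0, a j m = a i k, a k m = a i j, a i m = a j k & a i j + a i k + a j k = 0].
Proof.
move=> ps h lm jl kl jm0 km0; have [u0 v0] := ndep_neq0 h.
have pj : perm_eq [:: j; i; k; l; m] s by perm5 ps.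
have pik : perm_eq [:: i; k; j; m; l] s by perm5 ps.
have pikl : perm_eq [:: i; k; j; l; m] s by perm5 ps.
have pijm : perm_eq [:: i; j; k; m; l] s by perm5 ps.
have pjm : perm_eq [:: j; m; i; k; l] s by perm5 ps.
have pkm : perm_eq [:: k; m; i; j; l] s by perm5 ps.
have pjk : perm_eq [:: j; k; i; l; m] s by perm5 ps.
have pjk' : perm_eq [:: j; k; i; m; l] s by perm5 ps.
have pk : perm_eq [:: k; i; j; l; m] s by perm5 ps.
have pim : perm_eq [:: i; m; j; k; l] s by perm5 ps.
have plm : perm_eq [:: l; m; j; k; i] s by perm5 ps.
have pmj : perm_eq [:: m; j; i; k; l] s by perm5 ps.
have pmk : perm_eq [:: m; k; i; j; l] s by perm5 ps.
have jmv := dep_mem (HX pik) v0. have kmu := dep_mem (HX pijm) u0.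
have sj : a i j + a j k + a j m = 0.
  apply: (ndep_cap h).
    by have := HV pj; rewrite (aC ps) jl addr0 => /dep_mem; apply.
  apply: (line_sub jmv); have := HV pjm; rewrite (aC ps) jl addr0 => /dep_mem/(_ jm0).
  by rewrite -addrA addrC.
have sk : a i k + a j k + a k m = 0.
  apply: (ndep_cap h); last first.
    by have := HV pk; rewrite (aC pikl) (aC pjk) kl addr0 => /dep_mem; apply.
  apply: (line_sub kmu); have := HV pkm; rewrite (aC pikl) (aC pjk) kl addr0 => /dep_mem/(_ km0).
  by rewrite -addrA addrC.
have E : a i j - a k m = a i k - a j m.
  have e1 : a i j = - (a j k + a j m) by move/eqP: sj; rewrite -addrA addr_eq0 => /eqP.
  have e2 : a i k = - (a j k + a k m) by move/eqP: sk; rewrite -addrA addr_eq0 => /eqP.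
  by rewrite e1 e2 -!opprD addrAC.
have E0 : a i j - a k m = 0.
  by apply: (ndep_cap h); [rewrite memvB ?memv_line | rewrite E memvB ?memv_line].
have Ejm : a j m = a i k by apply/eqP; rewrite eq_sym -subr_eq0 -E E0.
have Ekm : a k m = a i j by apply/eqP; rewrite eq_sym -subr_eq0 E0.
have Es : a i j + a i k + a j k = 0 by rewrite addrAC -Ejm.
have jk0 : a j k != 0.
  apply: contra h => /eqP jk; move/eqP: Es; rewrite jk addr0 addr_eq0 => /eqP E1.
  by rewrite depC /dep E1 memvN memv_line orbT.
have il := dep_mem (HX pjk) jk0; have im := dep_mem (HX pjk') jk0.
have uv : a i j + a i k = - a j k by apply/eqP; rewrite -addr_eq0 Es.
have sm : a i m = a j k.
  have : a i m + a i k + a i j = 0.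
    apply: (ndep_cap h).
      have := HV pmk; rewrite (aC pkm) (aC pjm) (aC pim) (aC plm) lm addr0 Ekm Ejm.
      by move=> /dep_mem/(_ u0); rewrite -addrA addrC.
    have := HV pmj; rewrite (aC pkm) (aC pjm) (aC pim) (aC plm) lm addr0 Ekm Ejm.
    by move=> /dep_mem/(_ v0); rewrite [a i k + _]addrC.
  move/eqP; rewrite -addrA addr_eq0 [a i k + _]addrC uv opprK => /eqP //.
split=> //.
have : a i j + a i k + a i l + a i m = 0.
  apply: (ndep_cap h); first by apply: dep_mem (HV ps) u0.
  have pik' : perm_eq [:: i; k; j; l; m] s by perm5 ps.
  by have := dep_mem (HV pik') v0; rewrite [a i k + _]addrC.
by rewrite sm uv addrAC addNr add0r.
Qed.

(* [a] models the scaled edge rows on five vertices, modulo a subspace. *)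
Lemma five_cases : uniq s -> size s = 5%N ->
  [\/ forall i j k l, i \in s -> j \in s -> k \in s -> l \in s -> i != j -> k != l ->
       dep (a i j) (a k l),
      exists2 i, i \in s & forall j k, j \in s -> k \in s -> uniq [:: i; j; k] -> a j k = 0 |
      exists i j k l m, [/\ perm_eq [:: i; j; k; l; m] s, ~~ dep (a i j) (a i k),
        [/\ a m i = 0, a m j = 0, a m k = 0 & a m l = 0],
        [/\ a k l = a i j, a j l = a i k & a j k = a i l] &
        a i j + a i k + a i l = 0]].
Proof.
move=> us ss.
have ext3 i j k : i \in s -> j \in s -> k \in s -> uniq [:: i; j; k] ->
    exists l m, perm_eq [:: i; j; k; l; m] s.
  move=> si sj sk u3; set r := rem k (rem j (rem i s)).
  have pr : perm_eq s [:: i, j, k & r].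
    move: u3; rewrite /= !inE !negb_or andbT => /andP[/andP[ij ik] jk].
    have := perm_to_rem si; move/perm_trans; apply; rewrite perm_cons.
    have sj' : j \in rem i s by rewrite mem_rem_uniq // !inE eq_sym ij.
    have := perm_to_rem sj'; move/perm_trans; apply; rewrite perm_cons.
    apply: perm_to_rem; rewrite mem_rem_uniq ?rem_uniq // inE eq_sym jk.
    by rewrite mem_rem_uniq // inE eq_sym ik.
  have : size r = 2%N by have := perm_size pr; rewrite ss /=; lia.
  move: pr; case: r => [|l [|m []]] // pr _.
  by exists l, m; rewrite perm_sym.
have mem_s i j k l m : perm_eq [:: i; j; k; l; m] s -> s =i [:: i; j; k; l; m].
  by move=> ps x; rewrite (perm_mem ps).
have [/allP h|] := boolP (all (fun i => all (fun j => all (fun k =>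
    uniq [:: i; j; k] ==> dep (a i j) (a i k)) s) s) s).
  have H3 i j k : i \in s -> j \in s -> k \in s -> uniq [:: i; j; k] -> dep (a i j) (a i k).
    by move=> /h/allP H1 /H1/allP H2 /H2/implyP.
  have aCs i j : i \in s -> j \in s -> i != j -> a j i = a i j.
    move=> si sj ij.
    have [k sk kij] : exists2 k, k \in s & k \notin [:: i; j].
      apply/hasP; rewrite has_predC; apply/negP => /allP sub.
      by have := uniq_leq_size us sub; rewrite ss.
    have [|l [m ps]] := ext3 i j k si sj sk; last exact: (aC ps).
    by move: kij; rewrite /= !inE !negb_or andbT ij /= eq_sym [k == j]eq_sym.
  constructor 1 => i j k l si sj sk sl ij kl.
  have [ik|ik] := eqVneq i k.
    rewrite -{}ik in sk kl *; have [->|jl] := eqVneq j l.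
      by rewrite /dep memv_line orbT.
    by apply: H3 => //=; rewrite !inE !negb_or ij kl jl.
  have [il|il] := eqVneq i l.
    rewrite -{}il in sl kl *; rewrite -(aCs k i) //.
    have [->|jk] := eqVneq j k; first by rewrite /dep memv_line orbT.
    by apply: H3 => //=; rewrite !inE !negb_or ij ik jk.
  rewrite -(aCs i j) //.
  have [jk|jk] := eqVneq j k.
    by rewrite -{}jk in sk kl *; apply: H3 => //=; rewrite !inE !negb_or kl il eq_sym ij.
  have [jl|jl] := eqVneq j l.
    rewrite -{}jl in sl kl *; rewrite -(aCs k j) //.
    by apply: H3 => //=; rewrite !inE !negb_or ik jk eq_sym ij.
  have [|m [o ps]] := ext3 i j k si sj sk.
    by rewrite /= !inE !negb_or ij ik jk.
  rewrite (aC ps); have := sl; rewrite (mem_s _ _ _ _ _ ps) !inE (eq_sym l i) (negbTE il) (eq_sym l j) (negbTE jl) (eq_sym l k) (negbTE kl) /=.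
  case/orP => /eqP ->; first exact: HX ps.
  by apply: (HX (m := m)); perm5 ps.
case/allPn => i si /allPn[j sj /allPn[k sk]]; rewrite negb_imply => /andP[u3 h].
have [l [m ps]] := ext3 i j k si sj sk u3.
have [u0 v0] := ndep_neq0 h.
have pijm : perm_eq [:: i; j; k; m; l] s by perm5 ps.
have pik : perm_eq [:: i; k; j; l; m] s by perm5 ps.
have pik' : perm_eq [:: i; k; j; m; l] s by perm5 ps.
have pijl : perm_eq [:: i; j; l; m; k] s by perm5 ps.
have pikl : perm_eq [:: i; k; l; m; j] s by perm5 ps.
have pjl' : perm_eq [:: j; l; k; m; i] s by perm5 ps.
have pjm' : perm_eq [:: j; m; k; l; i] s by perm5 ps.
have lm : a l m = 0 := dep_cap h (HX pijl) (HX pikl).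
have hC : ~~ dep (a i k) (a i j) by rewrite depC.
have jlv := dep_mem (HX pik) v0; have jmv := dep_mem (HX pik') v0.
have klu := dep_mem (HX ps) u0; have kmu := dep_mem (HX pijm) u0.
have star0 : [/\ a j k = 0, a j l = 0 & a j m = 0] -> [/\ a k l = 0 & a k m = 0] ->
    exists2 i, i \in s & forall j k, j \in s -> k \in s -> uniq [:: i; j; k] -> a j k = 0.
  move=> [jk jl jm] [kl km]; exists i => // x y.
  have pjk : perm_eq [:: j; k; i; l; m] s by perm5 ps.
  have pkl : perm_eq [:: k; l; i; j; m] s by perm5 ps.
  have pkm : perm_eq [:: k; m; i; j; l] s by perm5 ps.
  have plm : perm_eq [:: l; m; i; j; k] s by perm5 ps.
  have qjl : perm_eq [:: j; l; i; m; k] s by perm5 ps.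
  have qjm : perm_eq [:: j; m; i; l; k] s by perm5 ps.
  rewrite !(mem_s _ _ _ _ _ ps) ![_ \in [:: i, j, k, l & _]]inE /= andbT !inE negb_or.
  move=> sx sy /andP[/andP[ix iy] xy].
  move: sx sy; rewrite (eq_sym x i) (negbTE ix) (eq_sym y i) (negbTE iy) /=.
  by move=> /or4P[] /eqP E1 /or4P[] /eqP E2; move: xy; rewrite E1 E2 ?eqxx //
    ?(aC pjk) ?(aC pkl) ?(aC pkm) ?(aC plm) ?(aC qjl) ?(aC qjm).
have pkji : perm_eq [:: i; k; j; l; m] s by perm5 ps.
have pjk : perm_eq [:: j; k; i; l; m] s by perm5 ps.
have zj : a j l = 0 -> a j m = 0 -> exists2 i, i \in s & forall j k, j \in s -> k \in s -> uniq [:: i; j; k] -> a j k = 0.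
  by move=> jl jm; have [jk kl km] := five_caseA ps h jl jm; apply: star0.
have zk : a k l = 0 -> a k m = 0 -> exists2 i, i \in s & forall j k, j \in s -> k \in s -> uniq [:: i; j; k] -> a j k = 0.
  move=> kl km; have [] := five_caseA pkji hC kl km; rewrite (aC pjk) => jk jl jm; exact: star0.
have ml0 : a m l = 0.
  have plm : perm_eq [:: l; m; i; j; k] s by perm5 ps.
  by rewrite (aC plm).
(* These two disjoint edges are dependent, yet they lie on the independent lines of [a i k] and
   [a i j]; so one of them is zero. *)
have d1 : a j l = 0 \/ a k m = 0.
  case/orP: (HX pjl') => [/eqP|h1]; first by left.
  by right; apply: (ndep_cap h) => //; apply: line_sub h1.
have d2 : a j m = 0 \/ a k l = 0.
  case/orP: (HX pjm') => [/eqP|h1]; first by left.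
  by right; apply: (ndep_cap h) => //; apply: line_sub h1.
have B l' m' : perm_eq [:: i; j; k; l'; m'] s -> a l' m' = 0 -> a m' l' = 0 -> a j l' = 0 -> a k l' = 0 ->
    a j m' != 0 -> a k m' != 0 ->
    exists i j k l m, [/\ perm_eq [:: i; j; k; l; m] s, ~~ dep (a i j) (a i k),
        [/\ a m i = 0, a m j = 0, a m k = 0 & a m l = 0],
        [/\ a k l = a i j, a j l = a i k & a j k = a i l] &
        a i j + a i k + a i l = 0].
  move=> ps' lm' ml' jl kl jm km.
  have [il Ejm Ekm Eim Es] := five_caseB ps' h lm' jl kl jm km.
  exists i, j, k, m', l'; split=> //; first by perm5 ps'.
    have p1 : perm_eq [:: i; l'; j; k; m'] s by perm5 ps'.
    have p2 : perm_eq [:: j; l'; i; k; m'] s by perm5 ps'.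
    have p3 : perm_eq [:: k; l'; i; j; m'] s by perm5 ps'.
    by rewrite (aC p1) (aC p2) (aC p3).
  by rewrite Eim.
have [jl0|jl0] := eqVneq (a j l) 0; have [jm0|jm0] := eqVneq (a j m) 0.
- by constructor 2; apply: zj.
- case: d2 => [/eqP|kl0]; first by rewrite (negbTE jm0).
  have [km0|km0] := eqVneq (a k m) 0; first by constructor 2; apply: zk.
  by constructor 3; apply: (B l m).
- case: d1 => [/eqP|km0]; first by rewrite (negbTE jl0).
  have [kl0|kl0] := eqVneq (a k l) 0; first by constructor 2; apply: zk.
  by constructor 3; apply: (B m l).
- case: d1 => [/eqP|km0]; first by rewrite (negbTE jl0).
  case: d2 => [/eqP|kl0]; first by rewrite (negbTE jm0).
  by constructor 2; apply: zk.
Qed.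
End Five.

(** * Genericity and semicontinuity of the rank *)

Section Generic.
Variables (R : realType) (n : nat).
Local Notation V := 'M[R]_(n, 3).
Local Notation pts := ('I_n -> R * R).
Implicit Types (p : pts) (f g : pts -> R).

Definition ev (q : {mpoly rat[n + n]}) p : R :=
  (map_mpoly (S := R) ratr q).@[coords (fun i => (p i).1) (fun i => (p i).2)].
(** A predicate on functions of the configuration, closed under ring operations, so that no
    polynomial has to be exhibited. *)
Definition ratpoly f := exists q, f =1 ev q.

Lemma ratpoly_ext f g : f =1 g -> ratpoly f -> ratpoly g.
Proof. by move=> E [q h]; exists q => p; rewrite -E. Qed.

Lemma ratpolyD f g : ratpoly f -> ratpoly g -> ratpoly (fun p => f p + g p).
Proof. by move=> [q h] [r k]; exists (q + r) => p; rewrite h k /ev rmorphD mevalD. Qed.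

Lemma ratpolyM f g : ratpoly f -> ratpoly g -> ratpoly (fun p => f p * g p).
Proof. by move=> [q h] [r k]; exists (q * r) => p; rewrite h k /ev rmorphM mevalM. Qed.

Lemma ratpolyN f : ratpoly f -> ratpoly (fun p => - f p).
Proof. by move=> [q h]; exists (- q) => p; rewrite h /ev rmorphN mevalN. Qed.

Lemma ratpolyB f g : ratpoly f -> ratpoly g -> ratpoly (fun p => f p - g p).
Proof. by move=> hf hg; apply: ratpolyD => //; apply: ratpolyN. Qed.

Lemma ratpoly_nat k : ratpoly (fun => k%:R).
Proof. by exists k%:R => p; rewrite /ev !rmorph_nat. Qed.

Lemma ratpoly0 : ratpoly (fun => 0). Proof. exact: (ratpoly_nat 0). Qed.
Lemma ratpoly1 : ratpoly (fun => 1). Proof. exact: (ratpoly_nat 1). Qed.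

Lemma ratpolyX i : ratpoly (fun p => (p i).1).
Proof.
exists 'X_(lshift n i) => p; rewrite /ev map_mpolyX mevalXU /coords.
by rewrite -[lshift n i]/(unsplit (inl i)) unsplitK.
Qed.

Lemma ratpolyY i : ratpoly (fun p => (p i).2).
Proof.
exists 'X_(rshift n i) => p; rewrite /ev map_mpolyX mevalXU /coords.
by rewrite -[rshift n i]/(unsplit (inr i)) unsplitK.
Qed.

Lemma ratpoly_sum (I : Type) (r : seq I) (P : pred I) (F : I -> pts -> R) :
  (forall i, ratpoly (F i)) -> ratpoly (fun p => \sum_(i <- r | P i) F i p).
Proof.
move=> H; elim: r => [|i r IH].
  by apply: ratpoly_ext ratpoly0 => p; rewrite big_nil.
apply: (@ratpoly_ext (fun p => (if P i then F i p else 0) + \sum_(i <- r | P i) F i p)).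
  by move=> p; rewrite big_cons; case: (P i); rewrite ?add0r.
by apply: ratpolyD => //; case: (P i) => //; apply: ratpoly0.
Qed.

Lemma ratpoly_prod (I : Type) (r : seq I) (P : pred I) (F : I -> pts -> R) :
  (forall i, ratpoly (F i)) -> ratpoly (fun p => \prod_(i <- r | P i) F i p).
Proof.
move=> H; elim: r => [|i r IH].
  by apply: ratpoly_ext ratpoly1 => p; rewrite big_nil.
apply: (@ratpoly_ext (fun p => (if P i then F i p else 1) * \prod_(i <- r | P i) F i p)).
  by move=> p; rewrite big_cons; case: (P i); rewrite ?mul1r.
by apply: ratpolyM => //; case: (P i) => //; apply: ratpoly1.
Qed.

Lemma ratpoly_det k (M : pts -> 'M[R]_k) :
  (forall i j, ratpoly (fun p => M p i j)) -> ratpoly (fun p => \det (M p)).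
Proof.
move=> H; apply: ratpoly_sum => s; apply: ratpolyM; last by apply: ratpoly_prod => i; apply: H.
by case: (perm.odd_perm s); [apply: ratpolyN; apply: ratpoly1 | apply: ratpoly1].
Qed.

Variables (x y : 'I_n -> R).
Hypothesis gen : generic x y.
Let p0 : pts := fun i => (x i, y i).

Lemma generic_neq0 f p : ratpoly f -> f p != 0 -> f p0 != 0.
Proof.
move=> [q h] fp; have q0 : q != 0.
  by apply: contra fp => /eqP q0; rewrite h q0 /ev !rmorph0.
by rewrite h; apply: gen q0.
Qed.

Lemma ratpoly_br (a b c : pts -> R * R) :
  ratpoly (fun p => (a p).1) -> ratpoly (fun p => (a p).2) ->
  ratpoly (fun p => (b p).1) -> ratpoly (fun p => (b p).2) ->
  ratpoly (fun p => (c p).1) -> ratpoly (fun p => (c p).2) ->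
  ratpoly (fun p => br (a p) (b p) (c p)).
Proof.
by move=> a1 a2 b1 b2 c1 c2; apply: ratpolyB; apply: ratpolyM; apply: ratpolyB.
Qed.

(** By [generic_neq0] a single configuration witnesses each condition; points among (0,0), (1,0),
    (0,1) suffice. *)
Lemma generic_general : general p0.
Proof.
split=> [i j ij|i j k|i j k l|i j k l].
- apply: (@generic_neq0 (fun p => (p i - p j).1) (fun v => if v == i then (1, 0) else (0, 0))).
    by apply: ratpolyB; exact: ratpolyX.
  by rewrite eqxx (eq_sym j) (negbTE ij) /= subr0 oner_eq0.
- rewrite /= !inE !negb_or => /and3P[/andP[ij ik] jk _].
  apply: (@generic_neq0 (fun p => br (p i) (p j) (p k))
    (fun v => if v == j then (1, 0) else if v == k then (0, 1) else (0, 0))).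
    by apply: ratpoly_br; (exact: ratpolyX || exact: ratpolyY).
  rewrite (negbTE ij) (negbTE ik) eqxx (eq_sym k j) (negbTE jk) eqxx /br /det2 /=.
  by rewrite !subr0 mulr1 mulr0 subr0 oner_eq0.
- rewrite /= !inE !negb_or => /and4P[/and3P[ij ik il] /andP[jk jl] kl _].
  apply: (@generic_neq0 (fun p => det2 (p i - p j) (p k - p l))
    (fun v => if v == i then (1, 0) else if v == k then (0, 1) else (0, 0))).
    by apply: ratpolyB; apply: ratpolyM; apply: ratpolyB; (exact: ratpolyX || exact: ratpolyY).
  rewrite eqxx (eq_sym j) (negbTE ij) (negbTE jk) (eq_sym k) (negbTE ik) eqxx (eq_sym l) (negbTE il).
  by rewrite (eq_sym l) (negbTE kl) /det2 /= !subr0 mulr1 mulr0 subr0 oner_eq0.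
- rewrite /= !inE !negb_or => /and4P[/and3P[ij ik il] /andP[jk jl] kl _].
  apply: (@generic_neq0 (fun p => br (p i + p i - p j) (p k) (p l))
    (fun v => if v == k then (1, 0) else if v == l then (0, 1) else (0, 0))).
    apply: (ratpoly_br (a := fun p => p i + p i - p j)); (exact: ratpolyX || exact: ratpolyY || idtac).
      by apply: ratpolyB; [apply: ratpolyD|]; exact: ratpolyX.
    by apply: ratpolyB; [apply: ratpolyD|]; exact: ratpolyY.
  rewrite (negbTE ik) (negbTE il) (negbTE jk) (negbTE jl) eqxx (eq_sym l) (negbTE kl) eqxx.
  by rewrite /br /det2 /= !(subr0, addr0) mulr1 mulr0 subr0 oner_eq0.
Qed.

(** A maximal minor that is nonzero at [p] is a rational polynomial in the coordinates, hence
    nonzero at the generic configuration. *)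
Lemma generic_row_free k m (M : pts -> 'M[R]_(k, m)) p :
  (forall i j, ratpoly (fun p => M p i j)) -> row_free (M p) -> row_free (M p0).
Proof.
move=> H fM; have fM' : row_full (M p)^T by rewrite -[row_full _]/(\rank _ == k) mxrank_tr.
set g := fullrankfun fM'.
have u : rowsub g (M p)^T \in unitmx := fullrowsub_unit fM'.
have u0 : rowsub g (M p0)^T \in unitmx.
  rewrite unitmxE unitfE; apply: (@generic_neq0 (fun p => \det (rowsub g (M p)^T)) p).
    by apply: ratpoly_det => i j; apply: ratpoly_ext (H j (g i)) => z; rewrite !mxE.
  by rewrite -unitfE -unitmxE.
rewrite -[row_free _]/(\rank _ == k) -mxrank_tr eqn_leq rank_leq_col /=.
by rewrite -{1}(mxrank_unit u0) mxrankS // rowsub_sub.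
Qed.

Lemma lrank_row_free (I : finType) (v : I -> V) (B : {set I}) :
  row_free (\matrix_(i < #|B|) mxvec (v (enum_val i))) = (lrank v B == #|B|).
Proof.
set X := [tuple v (enum_val i) | i < #|B|].
have EX : <<X>>%VS = spn v B.
  apply/eqP; rewrite eqEsubv; apply/andP; split.
    by apply/span_subvP => z /mapP[i _ ->]; rewrite spn_mem // enum_valP.
  apply/spn_subP => i iB; apply: memv_span; apply/mapP.
  by exists (enum_rank_in iB i); rewrite ?mem_enum // enum_rankK_in.
have -> : (lrank v B == #|B|) = free X by rewrite /lrank -EX /free size_tuple.
apply/idP/freeP => [fM k E i|H].
  have : (\row_i k i) = 0.
    apply: (row_free_inj fM); rewrite mul0mx mulmx_sum_row -[RHS](linear0 mxvec) -E linear_sum.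
    apply: eq_bigr => j _; rewrite mxE rowK linearZ; congr (_ *: mxvec _).
    by rewrite -tnth_nth tnth_mktuple.
  by move/rowP/(_ i); rewrite !mxE.
apply: inj_row_free => w E; apply/rowP => i; rewrite mxE; apply: (H (fun i => w 0 i)).
apply: (can_inj mxvecK); rewrite linear0 -[RHS]E mulmx_sum_row linear_sum.
apply: eq_bigr => j _; rewrite rowK linearZ; congr (_ *: mxvec _).
by rewrite -tnth_nth tnth_mktuple.
Qed.

(** Lower semicontinuity of rank: a basis chosen at the special configuration stays independent at
    the generic one. *)
Lemma generic_dim (I : finType) (F : I -> pts -> V) p :
  (forall i a b, ratpoly (fun p => F i p a b)) ->
  (\dim (\sum_i <[F i p]>) <= \dim (\sum_i <[F i p0]>))%N.
Proof.
move=> H; have [B [_ Bi Br]] := rho_basis (lrank_rank (fun i => F i p)) setT.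
have -> : \dim (\sum_i <[F i p]>) = lrank (fun i => F i p) setT.
  by rewrite /lrank /spn; congr (\dim _); apply: eq_bigl => i; rewrite inE.
have -> : \dim (\sum_i <[F i p0]>) = lrank (fun i => F i p0) setT.
  by rewrite /lrank /spn; congr (\dim _); apply: eq_bigl => i; rewrite inE.
rewrite -Br Bi; apply: leq_trans (rho_mono (lrank_rank _) (subsetT B)).
suff /eqP -> : lrank (fun i => F i p0) B == #|B| by [].
rewrite -(lrank_row_free (fun i => F i p0)).
apply: (@generic_row_free _ _ (fun p => \matrix_(i < #|B|) mxvec (F (enum_val i) p)) p).
  move=> i j; case/mxvec_indexP: j => a b.
  by apply: ratpoly_ext (H (enum_val i) a b) => z; rewrite mxE mxvecE.
by rewrite (lrank_row_free (fun i => F i p)) Bi.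
Qed.

Lemma ratpoly_rw i j a b : ratpoly (fun p => rw p i j a b).
Proof.
have hv : ratpoly (fun p => ver (p i - p j) 0 b).
  have d1 : ratpoly (fun p => (p i - p j).1) by apply: ratpolyB; exact: ratpolyX.
  have d2 : ratpoly (fun p => (p i - p j).2) by apply: ratpolyB; exact: ratpolyY.
  apply: (@ratpoly_ext (fun p => if b == 0%N :> nat then (p i - p j).1 * (p i - p j).1
     else if b == 1%N :> nat then (p i - p j).1 * (p i - p j).2 else (p i - p j).2 * (p i - p j).2)).
    by move=> p; rewrite mxE !expr2.
  by case: (b == 0%N :> nat); [|case: (b == 1%N :> nat)]; apply: ratpolyM.
apply: (@ratpoly_ext (fun p => ((a == i)%:R - (a == j)%:R) * ver (p i - p j) 0 b)).
  by move=> p; apply/esym; rewrite /rw [LHS]mxE [X in _ + X]mxE ![at_ _ _ _ _]mxE mulrBl.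
by apply: ratpolyM => //; apply: ratpolyB; apply: ratpoly_nat.
Qed.

End Generic.

(** * Dimension of a star modulo a subspace, and the K_4 relations *)

Section StarBounds.
Variables (R : numFieldType) (n : nat).
Local Notation V := 'M[R]_(n, 3).
Local Notation offu := (@offu R n).
Implicit Types (p : 'I_n -> R * R) (i j k l m u w : 'I_n) (W : {vspace V}) (N : {set 'I_n}).

Lemma dim_star_add p u W N N' :
  (\dim (W + starV p u (N :|: N')) <= \dim (W + starV p u N) + #|N'|)%N.
Proof.
rewrite starVU addvA; apply: leq_trans (dimv_add_leqif _ _) _.
by rewrite leq_add2l dim_starV.
Qed.

Lemma star_low p u W N : general p -> (W <= offu u)%VS -> u \notin N ->
  (\dim W + minn #|N| 3 <= \dim (W + starV p u N))%N.
Proof.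
move=> gp sW uN; pose t := take 3 (enum N).
have st : size t = minn #|N| 3 by rewrite size_take -cardE /minn; case: ltnP => h; case: ltnP => //; lia.
have tN w : w \in t -> w \in N by move=> /mem_take; rewrite mem_enum.
have ut : uniq (u :: t).
  by rewrite /= take_uniq ?enum_uniq // andbT; apply: contra uN => /tN.
suff fr : free [seq row u (rw p u w) | w <- t].
  have := @dim_lowstar _ _ W u [seq rw p u w | w <- t] sW.
  rewrite -map_comp size_map st => <- //.
  apply/dimvS/addvS => //; apply/span_subvP => z /mapP[w wt ->].
  by rewrite starV_mem ?tN.
have -> : [seq row u (rw p u w) | w <- t] = [seq ver (p u - p w) | w <- t].
  apply/eq_in_map => w wt; rewrite rw_row eqxx scale1r.
  have /negbTE -> : u != w by apply: contra uN => /eqP ->; apply: tN.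
  by rewrite scale0r subr0.
have d2 i j : uniq [:: u; i; j] -> det2 (p u - p i) (p u - p j) != 0.
  move=> h; have -> : det2 (p u - p i) (p u - p j) = br (p u) (p i) (p j).
    by rewrite /br /det2 /=; ring.
  exact: gen3.
move: ut tN; rewrite {st}; have : (size t <= 3)%N by rewrite size_take; case: ltnP; lia.
case: t => [|i [|j [|k [|l t]]]] //= _; rewrite ?inE ?negb_or.
- by rewrite nil_free.
- rewrite andbT seq1_free => ui _; apply: contraNneq (gen2 gp ui) => h.
  have := congr1 (fun D : 'rV[R]_3 => D 0 (inord 0)) h; rewrite verE0 mxE => /eqP.
  by rewrite expf_eq0 => /eqP ->.
- move=> uij _; have d : det2 (p u - p i) (p u - p j) != 0.
    by apply: d2; rewrite /= !inE negb_or.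
   move: (p u - p i) (p u - p j) d => d e de.
  (* The sum of the two directions serves as a third one, which reduces this case to [ver_free]. *)
  have fX : free ([:: ver d; ver e] ++ [:: ver (d.1 + e.1, d.2 + e.2)]).
    apply: ver_free => //.
      by have -> : det2 d (d.1 + e.1, d.2 + e.2) = det2 d e by rewrite /det2 /=; ring.
    have -> : det2 e (d.1 + e.1, d.2 + e.2) = - det2 d e by rewrite /det2 /=; ring.
    by rewrite oppr_eq0.
  exact: catl_free fX.
- move=> /and3P[/and3P[ui uj uk] /andP[ij ik] /andP[jk _]] _.
  by apply: ver_free; apply: d2; rewrite /= !inE !negb_or ?ui ?uj ?uk ?ij ?ik ?jk.
Qed.

(** Three star edges suffice: each further one is the only edge not yet spanned in the K_5 on [u],
    its endpoint and the three chosen neighbours. *)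
Lemma star_high p u W N : general p -> u \notin N ->
  (forall i j, i \in N -> j \in N -> i != j -> rw p i j \in W) ->
  (\dim (W + starV p u N) <= \dim W + 3)%N.
Proof.
move=> gp uN H; have [le3|gt3] := leqP #|N| 3.
  apply: leq_trans (dimv_add_leqif _ _) _; rewrite leq_add2l.
  exact: leq_trans (dim_starV _ _ _) le3.
have [i [j [k [r E]]]] : exists i j k r, enum N = [:: i, j, k & r].
  move: gt3; rewrite cardE; case: (enum N) => [|i [|j [|k r]]] // _.
  by exists i, j, k, r.
have eN w : (w \in N) = (w \in [:: i, j, k & r]) by rewrite -E mem_enum.
have := enum_uniq N; rewrite E /= !inE !negb_or.
move=> /and4P[/and3P[ij ik _] /andP[jk _] _ _].
have iN : i \in N by rewrite eN !inE eqxx.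
have jN : j \in N by rewrite eN !inE eqxx orbT.
have kN : k \in N by rewrite eN !inE eqxx !orbT.
have neu w : w \in N -> u != w by move=> wN; apply: contra uN => /eqP ->.
have sub : (W + starV p u N <= W + starV p u [set i; j; k])%VS.
  rewrite subv_add addvSl; apply/subv_sumP => w wN; rewrite -memvE.
  have [w3|w3] := boolP (w \in [set i; j; k]); first by rewrite memv_addr ?starV_mem.
  move: w3; rewrite !inE !negb_or => /andP[/andP[wi wj] wk].
  have us : uniq [:: u; w; i; j; k].
    by rewrite /= !inE !negb_or !neu ?wi ?wj ?wk ?ij ?ik ?jk.
  apply: (@K5_cl R n p [:: u; w; i; j; k] u w i j k) => //; first exact: general_brne.
  move=> a b.
  have uE z : z \in [:: w; i; j; k] -> z \in N by rewrite !inE => /or4P[] /eqP ->.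
  have hh z : z \in [:: i; j; k] -> rw p u z \in (W + starV p u [set i; j; k])%VS.
    by rewrite !inE => h; rewrite memv_addr // starV_mem // !inE -orbA.
  rewrite inE => /orP[/eqP ->|sa]; rewrite inE => /orP[/eqP ->|sb].
  - by rewrite rwii mem0v.
  - rewrite eqxx (eq_sym u w) (negbTE (_ : w != u)) ?orbF //=; last by rewrite eq_sym neu.
    by move: sb; rewrite inE => /orP[/eqP ->|/hh //]; rewrite eqxx.
  - rewrite eqxx (eq_sym u w) (negbTE (_ : w != u)) ?andbF ?andbT ?orFb //=; last by rewrite eq_sym neu.
    move: sa; rewrite inE rwC memvN => /orP[/eqP ->|/hh //].
    by rewrite eqxx ?orbT.
  - move=> _; have [->|ab] := eqVneq a b; first by rewrite rwii mem0v.
    by rewrite memv_addl // H ?uE.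
apply: leq_trans (dimvS sub) _; apply: leq_trans (dimv_add_leqif _ _) _.
rewrite leq_add2l; apply: leq_trans (dim_starV _ _ _) _.
by rewrite -setUA !cardsU1 cards1; do 2!case: (_ \notin _).
Qed.

End StarBounds.

Section K4Relations.
Variables (R : numFieldType) (n : nat).
Local Notation V := 'M[R]_(n, 3).
Implicit Types (p : 'I_n -> R * R) (i j k l m a b c d e u w : 'I_n) (W : {vspace V}).

Definition pibr p i j k l m : R :=
  br (p i) (p j) (p k) * br (p i) (p j) (p l) * br (p i) (p j) (p m).
(** A nonzero multiple of [av p s a b - av p s c d] on five points without collinear triples.
    Clearing denominators makes the entries polynomial in the coordinates, as [adm_span]
    requires. *)
Definition tx p a b c d e : V :=
  pibr p c d a b e *: rw p a b - pibr p a b c d e *: rw p c d.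

(* The relations, cleared of denominators, that make the three pairs of opposite
   edges of K_4 on [a b c d] parallel and the star at [e] trivial. *)
Definition tv p a b c d e (t : 'I_7) : V := nth 0
  [:: rw p e a; rw p e b; rw p e c; rw p e d; tx p a b c d e; tx p a c b d e; tx p a d b c e] t.
Definition TT p a b c d e : {vspace V} := (\sum_t <[tv p a b c d e t]>)%VS.

Lemma TT_subP p a b c d e W : reflect
  ([/\ rw p e a \in W, rw p e b \in W, rw p e c \in W & rw p e d \in W] /\
   [/\ tx p a b c d e \in W, tx p a c b d e \in W & tx p a d b c e \in W])
  (TT p a b c d e <= W)%VS.
Proof.
apply: (iffP subv_sumP) => [H|[[ea eb ec ed] [t1 t2 t3]] t _].
  have h (k : nat) : (k < 7)%N -> nth 0 [:: rw p e a; rw p e b; rw p e c; rw p e d;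
    tx p a b c d e; tx p a c b d e; tx p a d b c e] k \in W.
    by move=> lk; have := H (Ordinal lk) isT; rewrite -memvE.
  split; split; [exact: (h 0) | exact: (h 1) | exact: (h 2) | exact: (h 3) |
    exact: (h 4) | exact: (h 5) | exact: (h 6)].
rewrite -memvE /tv; case: t => [[|[|[|[|[|[|[|t]]]]]]] Ht] /=;
  [exact: ea | exact: eb | exact: ec | exact: ed | exact: t1 | exact: t2 | exact: t3 | by []].
Qed.

Lemma pibr_kcoef p s i j k l m : uniq s -> perm_eq [:: i; j; k; l; m] s ->
  kcoef p s i j = (pibr p i j k l m)^-1.
Proof. exact: kcoefE. Qed.

Lemma tx_av p s a b c d e : uniq s -> brne p s -> perm_eq [:: a; b; c; d; e] s ->
  exists2 z : R, z != 0 & tx p a b c d e = z *: (av p s a b - av p s c d).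
Proof.
move=> us bs ps; have ps2 : perm_eq [:: c; d; a; b; e] s by perm5 ps.
have n1 := kcoef_neq0 us bs ps; have n2 := kcoef_neq0 us bs ps2.
move: (n1) (n2); rewrite (pibr_kcoef p us ps) (pibr_kcoef p us ps2) !invr_eq0 => m1 m2.
exists (pibr p a b c d e * pibr p c d a b e); first exact: mulf_neq0.
rewrite /tx /av (pibr_kcoef p us ps) (pibr_kcoef p us ps2) [RHS]scalerBr !scalerA.
by rewrite mulrAC divff // mul1r mulfK.
Qed.

Lemma sum10_split (M : zmodType) (ab ac ad ae bc bd be cd ce de : M) :
  ab + ac + ad + ae + bc + bd + be + cd + ce + de = 0 ->
  ad + bc = - (ab + ac + bd + cd + (ae + be + ce + de)) /\
  ab + ac + bd + cd = - (ad + bc + (ae + be + ce + de)).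
Proof.
move=> E; split; apply/eqP; rewrite -addr_eq0 -E; apply/eqP.
  by rewrite [RHS](ACl (3*5*(1*2*6*8*(4*7*9*10)))%AC).
by rewrite [RHS](ACl (1*2*6*8*(3*5*(4*7*9*10)))%AC).
Qed.

(** The relations give [cd] and [bd] from [ab] and [ac]. The stress then gives the sum of the scaled
    [ad] and [bc], while the last relation gives their difference. *)
Lemma TT_span p s a b c d e x y : uniq s -> brne p s -> perm_eq [:: a; b; c; d; e] s ->
  x \in s -> y \in s -> rw p x y \in (TT p a b c d e + <[rw p a b]> + <[rw p a c]>)%VS.
Proof.
move=> us bs ps; set U := (_ + _)%VS.
have sTU : (TT p a b c d e <= U)%VS by rewrite /U -addvA addvSl.
have [[ea eb ec ed] [t1 t2 t3]] := TT_subP _ _ _ _ _ _ _ sTU.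
have abU : rw p a b \in U by exact: (memv_addl _ (memv_addline _ _)).
have acU : rw p a c \in U by exact: memv_addline.
have pac : perm_eq [:: a; c; b; d; e] s by perm5 ps.
have pad : perm_eq [:: a; d; b; c; e] s by perm5 ps.
have pae : perm_eq [:: a; e; b; c; d] s by perm5 ps.
have pbc : perm_eq [:: b; c; a; d; e] s by perm5 ps.
have pbd : perm_eq [:: b; d; a; c; e] s by perm5 ps.
have pbe : perm_eq [:: b; e; a; c; d] s by perm5 ps.
have pcd : perm_eq [:: c; d; a; b; e] s by perm5 ps.
have pce : perm_eq [:: c; e; a; b; d] s by perm5 ps.
have pde : perm_eq [:: d; e; a; b; c] s by perm5 ps.
have txU i j k l m : perm_eq [:: i; j; k; l; m] s -> tx p i j k l m \in U -> av p s i j - av p s k l \in U.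
  by move=> h; have [z z0 ->] := tx_av us bs h; rewrite memvZE.
have avU i j k l m : perm_eq [:: i; j; k; l; m] s -> (av p s i j \in U) = (rw p i j \in U).
  by move=> h; rewrite /av memvZE // (kcoef_neq0 us bs h).
have rwN i j : rw p j i \in U -> rw p i j \in U by rewrite rwC memvN.
have AB : av p s a b \in U by rewrite (avU _ _ _ _ _ ps).
have AC : av p s a c \in U by rewrite (avU _ _ _ _ _ pac).
have CD : av p s c d \in U by have := memvB AB (txU _ _ _ _ _ ps t1); rewrite opprB addrC subrK.
have BD : av p s b d \in U by have := memvB AC (txU _ _ _ _ _ pac t2); rewrite opprB addrC subrK.
have ADBC := txU _ _ _ _ _ pad t3.
have AE : av p s a e \in U by rewrite (avU _ _ _ _ _ pae) rwN.
have BE : av p s b e \in U by rewrite (avU _ _ _ _ _ pbe) rwN.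
have CE : av p s c e \in U by rewrite (avU _ _ _ _ _ pce) rwN.
have DE : av p s d e \in U by rewrite (avU _ _ _ _ _ pde) rwN.
have E := stress5 us bs ps.
have S2 : av p s a d + av p s b c \in U.
  rewrite (sum10_split E).1 memvN.
  exact: memvD (memvD (memvD (memvD AB AC) BD) CD) (memvD (memvD (memvD AE BE) CE) DE).
have AD : av p s a d \in U.
  have := memvD S2 ADBC; rewrite addrACA subrr addr0 -mulr2n -scaler_nat memvZE //.
  by rewrite pnatr_eq0.
have BC : av p s b c \in U by move: S2; rewrite (rpredDl _ AD).
have key i j k l m : perm_eq [:: i; j; k; l; m] s -> av p s i j \in U -> rw p i j \in U /\ rw p j i \in U.
  by move=> h; rewrite (avU _ _ _ _ _ h) => hh; split=> //; apply: rwN; rewrite rwC memvN rwC memvN.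
have [k1 k1'] := key _ _ _ _ _ ps AB; have [k2 k2'] := key _ _ _ _ _ pac AC.
have [k3 k3'] := key _ _ _ _ _ pad AD; have [k4 k4'] := key _ _ _ _ _ pae AE.
have [k5 k5'] := key _ _ _ _ _ pbc BC; have [k6 k6'] := key _ _ _ _ _ pbd BD.
have [k7 k7'] := key _ _ _ _ _ pbe BE; have [k8 k8'] := key _ _ _ _ _ pcd CD.
have [k9 k9'] := key _ _ _ _ _ pce CE; have [k10 k10'] := key _ _ _ _ _ pde DE.
rewrite -!(perm_mem ps) !inE.
have k0 w : rw p w w \in U by rewrite rwii mem0v.
move=> /or4P[/eqP ->|/eqP ->|/eqP ->|/orP[] /eqP ->] /or4P[/eqP ->|/eqP ->|/eqP ->|/orP[] /eqP ->];
  [exact: k0 | exact: k1 | exact: k2 | exact: k3 | exact: k4 |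
   exact: k1' | exact: k0 | exact: k5 | exact: k6 | exact: k7 |
   exact: k2' | exact: k5' | exact: k0 | exact: k8 | exact: k9 |
   exact: k3' | exact: k6' | exact: k8' | exact: k0 | exact: k10 |
   exact: k4' | exact: k7' | exact: k9' | exact: k10' | exact: k0].
Qed.

Lemma dep_par W (f : 'End(V)) (u v : V) : (forall z, (f z == 0) = (z \in W)) ->
  dep (f u) (f v) = par W u v.
Proof.
move=> fW; apply/orP/parP => [[h|/vlineP[c E]]|[h|h]].
- by left; rewrite -fW.
- right; apply/memv_addlineP; exists c => //.
  by rewrite -fW linearB linearZ /= E subrr.
- by left; rewrite fW.
- right; have [c] := memv_addlineP _ _ _ h.
  rewrite -fW linearB linearZ /= subr_eq0 => /eqP -> _.
  by rewrite memvZ ?memv_line.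
Qed.

Lemma quot_end W : exists f : 'End(V), forall z, (f z == 0) = (z \in W).
Proof.
exists (\1 - projv W)%VF => z; rewrite add_lfunE opp_lfunE id_lfunE subr_eq0.
apply/eqP/idP => [->|h]; first exact: memv_proj.
by rewrite projv_id.
Qed.

End K4Relations.

Section Admissible.
Variables (R : realType) (n : nat) (x y : 'I_n -> R).
Hypothesis gen : generic x y.
Local Notation V := 'M[R]_(n, 3).
Local Notation offu := (@offu R n).
Let p : 'I_n -> R * R := fun i => (x i, y i).
Implicit Types (i j k l m a b c d e u w : 'I_n) (W : {vspace V}) (N Z : {set 'I_n}).

(** What genericity of [u] provides over a space that does not involve [u]: no other position gives
    the star a larger span. *)
Definition adm u W := (W <= offu u)%VS /\ forall N q, u \notin N ->
  (\dim (W + starV (upd p u q) u N) <= \dim (W + starV p u N))%N.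

(** Generators of the space and star rows form one polynomial family, and the generators do not
    change when [u] moves, so [generic_dim] compares the two spans. *)
Lemma adm_span (J : finType) (tJ : J -> ('I_n -> R * R) -> V) (H : {set edge n}) Z u :
  (forall (t : J) a (b : 'I_3), ratpoly (fun p => tJ t p a b)) ->
  (forall (t : J) q, tJ t (upd p u q) = tJ t p) -> (forall t : J, tJ t p \in offu u) ->
  H \subset KW Z -> u \notin Z -> adm u (S p H + \sum_(t : J) <[tJ t p]>)%VS.
Proof.
move=> tR tq tu sH uZ; split.
  rewrite subv_add (S_KW_offu p sH uZ) /=; apply/subv_sumP => j _.
  by rewrite -memvE.
move=> N q uN.
pose F (i : (edge n + J) + 'I_n) (p : 'I_n -> R * R) : V := match i with
  | inl (inl e) => if e \in H then rwe p e else 0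
  | inl (inr t) => tJ t p
  | inr w => if w \in N then rw p u w else 0 end.
have F0 q' : (\sum_(i : (edge n + J) + 'I_n) <[F i q']> =
    (S q' H + \sum_(t : J) <[tJ t q']>) + starV q' u N)%VS.
  have line0 : (<[0 : V]> = 0 :> {vspace V})%VS.
    by apply/eqP; rewrite -dimv_eq0 dim_vline eqxx.
  rewrite big_sumType /= big_sumType /=; congr (_ + _ + _)%VS.
    rewrite /S /spn [RHS]big_mkcond; apply: eq_bigr => e _ /=; by case: ifP.
  rewrite /starV [RHS]big_mkcond; apply: eq_bigr => w _ /=; by case: ifP.
have := @generic_dim R n x y gen _ F (upd p u q); rewrite -/p !F0.
rewrite (S_upd _ _ sH uZ) (eq_bigr (fun t : J => <[tJ t p]>%VS)); last by move=> j _; rewrite tq.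
apply => -[[e|j]|w] a b /=; last 1 first.
- by case: (w \in N); [exact: ratpoly_rw | apply: ratpoly_ext (ratpoly0 R n) => z; rewrite mxE].
- by case: (e \in H); [exact: ratpoly_rw | apply: ratpoly_ext (ratpoly0 R n) => z; rewrite mxE].
- exact: tR.
Qed.

End Admissible.

Section AdmissibleCases.
Variables (R : realType) (n : nat) (x y : 'I_n -> R).
Hypothesis gen : generic x y.
Local Notation V := 'M[R]_(n, 3).
Local Notation offu := (@offu R n).
Local Notation adm := (@adm R n x y).
Let p : 'I_n -> R * R := fun i => (x i, y i).
Implicit Types (i j k l m a b c d e u w : 'I_n) (W : {vspace V}) (N Z : {set 'I_n}).

Let gp : general p := generic_general gen.

Lemma adm_S (H : {set edge n}) Z u : H \subset KW Z -> u \notin Z -> adm u (S p H).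
Proof.
move=> sH uZ.
have := @adm_span R n x y gen void (fun _ _ => 0) H Z u.
by rewrite big1 ?addv0 => [|[]]; apply => // -[].
Qed.

Lemma adm_ST (H : {set edge n}) Z u a b c d e : H \subset KW Z -> u \notin Z ->
  {subset [:: a; b; c; d; e] <= Z} -> adm u (S p H + TT p a b c d e)%VS.
Proof.
move=> sH uZ sT.
have neu w : w \in [:: a; b; c; d; e] -> w != u.
  by move=> /sT; apply: contraTneq => ->.
have [na nb nc nd ne] : [/\ a != u, b != u, c != u, d != u & e != u].
  by split; apply: neu; rewrite !inE eqxx ?orbT.
apply: (adm_span gen (tJ := fun t p => tv p a b c d e t) (Z := Z)) => //.
- have rpi i j k l m : ratpoly (fun p : 'I_n -> R * R => pibr p i j k l m).
    by apply: ratpolyM; [apply: ratpolyM|]; apply: ratpoly_br; (exact: ratpolyX || exact: ratpolyY).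
  have rtx i j k l m a' (b' : 'I_3) : ratpoly (fun p : 'I_n -> R * R => tx p i j k l m a' b').
    apply: (@ratpoly_ext _ _ (fun p : 'I_n -> R * R => pibr p k l i j m * rw p i j a' b' - pibr p i j k l m * rw p k l a' b')).
      by move=> z; rewrite /tx [RHS]mxE [X in _ = _ + X]mxE ![(_ *: _ : 'M__) a' b']mxE.
    by apply: ratpolyB; apply: ratpolyM => //; apply: ratpoly_rw.
  move=> t a' b'; rewrite /tv.
  case: t => [[|[|[|[|[|[|[|t]]]]]]] Ht] //=; by [exact: ratpoly_rw | exact: rtx].
- have updE w q : w != u -> upd p u q w = p w by rewrite /upd => /negbTE ->.
  have pibrE i j k l m q : i != u -> j != u -> k != u -> l != u -> m != u ->
      pibr (upd p u q) i j k l m = pibr p i j k l m.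
    by move=> *; rewrite /pibr !updE.
  by move=> t q; rewrite /tv /tx !pibrE // !rw_upd.
- have rwo i j : i != u -> j != u -> rw p i j \in offu u by move=> hi hj; rewrite rw_offu // eq_sym.
  have txo i j k l m : i != u -> j != u -> k != u -> l != u -> tx p i j k l m \in offu u.
    by move=> *; apply: memvB; apply: memvZ; apply: rwo.
  move=> t; rewrite /tv.
  by case: t => [[|[|[|[|[|[|[|t]]]]]]] Ht] //=; [apply: rwo | apply: rwo | apply: rwo | apply: rwo
    | apply: txo | apply: txo | apply: txo].
Qed.

Lemma adm_L0 u W N : adm u W -> u \notin N -> (4 <= #|N|)%N ->
  (\dim (W + starV p u N) <= \dim W + 3)%N ->
  forall i j, i \in N -> j \in N -> i != j -> rw p i j \in W.
Proof.
move=> [sW H] uN N4 hd i j iN jN ij.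
have h2 : (2 <= #|N :\ i :\ j|)%N.
  by move: N4; rewrite (cardsD1 i) iN (cardsD1 j) !inE eq_sym ij jN /= !add1n !ltnS.
have [k [l [kN lN kl]]] : exists k l, [/\ k \in N :\ i :\ j, l \in N :\ i :\ j & k != l].
  by case/card_gt1P: h2 => k [l [? ? ?]]; exists k, l.
move: kN lN; rewrite !inE => /and3P[kj ki kN] /and3P[lj li lN].
apply: (@L0_spec R n p u N W gp uN sW i j k l) => //.
- by move=> q; apply: leq_trans (H N q uN) hd.
- by rewrite /= !inE !negb_or ij (eq_sym i k) ki (eq_sym i l) li (eq_sym j k) kj (eq_sym j l) lj kl.
- by move=> w; rewrite !inE => /or4P[] /eqP ->.
Qed.

(** [LX_spec] and [LV_spec] supply the hypotheses of [five_cases] for the scaled rows modulo [W];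
    the map [f] with kernel [W] turns [par] into [dep]. *)
Lemma adm_five u W N : adm u W -> u \notin N -> #|N| = 5%N ->
  (\dim (W + starV p u N) <= \dim W + 4)%N ->
  [\/ forall i j k l, i \in N -> j \in N -> k \in N -> l \in N -> i != j -> k != l ->
        par W (rw p i j) (rw p k l),
      exists2 i, i \in N & forall j k, j \in N -> k \in N -> uniq [:: i; j; k] -> rw p j k \in W |
      exists i j k l m, [/\ perm_eq [:: i; j; k; l; m] (enum N),
        (TT p i j k l m <= W)%VS & ~~ par W (rw p i j) (rw p i k)]].
Proof.
move=> [sW H] uN N5 hd.
set s := enum N; have us : uniq s := enum_uniq N.
have bs : brne p s := general_brne gp.
have H4 q : (\dim (W + starV (upd p u q) u N) <= \dim W + 4)%N by apply: leq_trans (H N q uN) hd.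
have sN : {subset s <= N} by move=> w; rewrite mem_enum.
have [f fW] := quot_end W.
have mem2 i j k l m : perm_eq [:: i; j; k; l; m] s -> i != j.
  by move=> ps; have := us; rewrite -(perm_uniq ps) /= !inE !negb_or -!andbA => /andP[].
have memN i j k l m : perm_eq [:: i; j; k; l; m] s -> i \in N /\ j \in N.
  by move=> ps; rewrite -!(mem_enum N) -!(perm_mem ps) !inE !eqxx orbT.
have cne i j k l m : perm_eq [:: i; j; k; l; m] s -> kcoef p s i j != 0 by apply: kcoef_neq0.
have ext2 i j : i \in N -> j \in N -> i != j -> exists k l m, perm_eq [:: i; j; k; l; m] s.
  move=> iN jN ij; have h3 : #|N :\ i :\ j| = 3%N.
    by move: N5; rewrite (cardsD1 i) iN (cardsD1 j) !inE eq_sym ij jN /= !add1n => -[].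
  move: (h3); rewrite cardE; case E : (enum (N :\ i :\ j)) => [|k [|l [|m []]]] //= _.
  exists k, l, m; apply: uniq_perm => //.
    rewrite -E -[[:: i, j & _]]/([:: i; j] ++ enum (N :\ i :\ j)) cat_uniq enum_uniq andbT.
    by rewrite /= !inE ij /= -all_predC; apply/allP => w; rewrite mem_enum !inE negb_or => /and3P[-> -> _].
  move=> w; rewrite -E mem_enum !inE mem_enum !inE.
  have [->|_] := eqVneq w i; first by rewrite iN.
  by have [->|_] := eqVneq w j; first by rewrite jN.
have dav i j k l m i' j' k' l' m' : perm_eq [:: i; j; k; l; m] s -> perm_eq [:: i'; j'; k'; l'; m'] s ->
    dep (f (av p s i j)) (f (av p s i' j')) = par W (rw p i j) (rw p i' j').
  by move=> h h'; rewrite (dep_par _ _ fW) /av parZ ?(cne _ _ _ _ _ h) ?(cne _ _ _ _ _ h').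
have f0 i j k l m : perm_eq [:: i; j; k; l; m] s -> f (av p s i j) = 0 -> rw p i j \in W.
  by move=> h /eqP; rewrite fW memvZE ?(cne _ _ _ _ _ h).
have [||||||] := @five_cases _ _ _ s (fun i j => f (av p s i j)) _ _ _ us _.
- by move=> i j k l m ps; rewrite (avC _ us ps).
- move=> i j k l m ps; have ps' : perm_eq [:: k; l; i; j; m] s by perm5 ps.
  rewrite (dav _ _ _ _ _ _ _ _ _ _ ps ps'); apply: (@LX_spec R n p u N W gp uN sW i j k l m) => //.
    by rewrite (perm_uniq ps).
  by move=> w; rewrite (perm_mem ps); apply: sN.
- move=> i j k l m ps; rewrite -!linearD /= (dep_par _ _ fW).
  exact: (LV_spec gp uN sW H4 us ps sN).
- by rewrite -cardE.
- move=> h; constructor 1 => i j k l iN jN kN lN ij kl.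
  have [a1 [a2 [a3 ps]]] := ext2 i j iN jN ij; have [b1 [b2 [b3 ps']]] := ext2 k l kN lN kl.
  by rewrite -(dav _ _ _ _ _ _ _ _ _ _ ps ps') h ?mem_enum.
- move=> [i iN h]; constructor 2; exists i; first exact: sN.
  move=> j k jN kN u3; have jk : j != k by move: u3; rewrite /= !inE => /and3P[].
  have [a1 [a2 [a3 ps]]] := ext2 j k jN kN jk.
  by apply: (f0 _ _ _ _ _ ps); rewrite h ?mem_enum.
move=> [i [j [k [l [m [ps nd [mi mj mk ml] [kl jl jk] _]]]]]]; constructor 3.
exists i, j, k, l, m.
have pik : perm_eq [:: i; k; j; l; m] s by perm5 ps.
have pil : perm_eq [:: i; l; j; k; m] s by perm5 ps.
have pmi : perm_eq [:: m; i; j; k; l] s by perm5 ps.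
have pmj : perm_eq [:: m; j; i; k; l] s by perm5 ps.
have pmk : perm_eq [:: m; k; i; j; l] s by perm5 ps.
have pml : perm_eq [:: m; l; i; j; k] s by perm5 ps.
split=> //; last by rewrite -(dav _ _ _ _ _ _ _ _ _ _ ps pik).
apply/TT_subP; split.
  by split; [apply: f0 pmi mi | apply: f0 pmj mj | apply: f0 pmk mk | apply: f0 pml ml].
have txW a b c d e : perm_eq [:: a; b; c; d; e] s -> f (av p s c d) = f (av p s a b) -> tx p a b c d e \in W.
  by move=> h E; have [z z0 ->] := tx_av us bs h; rewrite memvZE // -fW linearB /= E subrr.
by split; [apply: txW kl | apply: txW jl | apply: txW jk].
Qed.

End AdmissibleCases.

(** * Matroids in which each edge of a K_5 is spanned by the other nine *)

Section K5Rank.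
Variable n : nat.
Implicit Types (A B : {set edge n}) (Z O : {set 'I_n}) (i j k l m u w a b : 'I_n).

Definition is_pair i j a b := ((a == i) && (b == j)) || ((a == j) && (b == i)).

Definition K5closed (rho : {set edge n} -> nat) := forall i j k l m,
  uniq [:: i; j; k; l; m] -> forall A,
  (forall a b, a \in [:: i; j; k; l; m] -> b \in [:: i; j; k; l; m] ->
     ~~ is_pair i j a b -> Ed a b \subset A) ->
  rho (Ed i j :|: A) = rho A.

Section Abstract.
Variable rho : {set edge n} -> nat.
Hypotheses (rhoR : rank_function rho) (rho5 : K5closed rho).

Definition clo A := [set e | rho (e |: A) == rho A].

Lemma rho_clo A : rho (clo A) = rho A.
Proof.
have sA : A \subset clo A.
  by apply/subsetP => e eA; rewrite inE (setUidPr _) // sub1set.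
rewrite -(setUidPr sA); apply: rho_spanU => // e.
by rewrite inE => /eqP.
Qed.

Lemma sub_clo A : A \subset clo A.
Proof. by apply/subsetP => e eA; rewrite inE (setUidPr _) // sub1set. Qed.

Lemma cloP A B : (B \subset clo A) = (rho (B :|: A) == rho A).
Proof.
apply/idP/eqP => [sB|h].
  rewrite setUC; apply: rho_spanU => // e /(subsetP sB).
  by rewrite inE => /eqP.
apply/subsetP => e eB; rewrite inE eqn_leq.
have /andP[-> _] := rhoS rhoR A e; rewrite andbT -h.
by apply: rho_mono => //; apply: setSU; rewrite sub1set.
Qed.

Lemma clo_trans A B : B \subset clo A -> clo (B :|: A) \subset clo A.
Proof.
move=> sB; have E := sB; rewrite cloP in E; move/eqP: E => E.
apply/subsetP => e; rewrite !inE E => /eqP h.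
rewrite eqn_leq; have /andP[-> _] := rhoS rhoR A e; rewrite andbT -h.
by apply: rho_mono => //; apply: setUS; apply: subsetUr.
Qed.

Lemma cloS A B : A \subset B -> clo A \subset clo B.
Proof.
move=> sAB; apply/subsetP => e; rewrite !inE => /eqP h.
by rewrite (rho_span_mono rhoR sAB h).
Qed.

Lemma K5_clo i j k l m A : uniq [:: i; j; k; l; m] ->
  (forall a b, a \in [:: i; j; k; l; m] -> b \in [:: i; j; k; l; m] ->
     ~~ is_pair i j a b -> Ed a b \subset clo A) ->
  Ed i j \subset clo A.
Proof.
move=> u5 H; have /eqP := rho5 u5 H; rewrite -cloP => h.
apply: subset_trans h _; have := @clo_trans A (clo A) (subxx _).
by rewrite (setUidPl (sub_clo A)).
Qed.

Lemma card_KW3 Z : #|Z| = 3%N -> (#|KW Z| <= 3)%N.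
Proof.
move=> Z3; have := sum_nb (subxx (KW Z)).
have : (\sum_(u in Z) #|nb (KW Z) u| <= \sum_(u in Z) 2)%N.
  apply: leq_sum => u uZ; have := subset_leq_card (nb_KW u (subxx (KW Z))).
  by move: Z3; rewrite (cardsD1 u Z) uZ add1n => -[->].
rewrite sum_nat_const Z3 => h E; move: h; rewrite E; lia.
Qed.

Lemma card_Ed i j : (#|Ed i j : {set edge n}| <= 1)%N.
Proof.
have [->|ij] := eqVneq i j; first by rewrite Edii cards0.
by have [e -> _] := Ed_neq ij; rewrite cards1.
Qed.

(** A new vertex costs at most three: once joined to [a], [b], [c], each further edge [vw] is closed
    off by the K_5 on [v], [w], [a], [b], [c]. *)
Lemma rho_KW Z : (3 <= #|Z|)%N -> (rho (KW Z) + 6 <= 3 * #|Z|)%N.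
Proof.
have [m] := ubnP #|Z|; elim: m Z => // m IH Z ltZm Z3.
have [Z3'|Z4] := eqVneq #|Z| 3%N.
  by rewrite Z3'; have := rho_card rhoR (KW Z); have := card_KW3 Z3'; lia.
have [v vZ] : exists v, v \in Z by apply/card_gt0P; lia.
have cZ := cardsD1 v Z; rewrite vZ add1n in cZ.
have ltm : (#|Z :\ v| < m)%N by rewrite -ltnS -cZ.
have Z3' : (2 < #|Z :\ v|)%N by rewrite -ltnS -cZ ltn_neqAle eq_sym Z4.
have {}IH := IH _ ltm Z3'.
have /card_gt2P[a [b [c [[aZ bZ cZ'] [ab bc ca]]]]] := Z3'.
set A := KW (Z :\ v); set B := Ed v a :|: Ed v b :|: Ed v c.
suff : KW Z \subset clo (B :|: A).
  move=> /subsetP sub; have : (rho (KW Z) <= rho (clo (B :|: A)))%N.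
    by apply: rho_mono => //; apply/subsetP.
  rewrite rho_clo setUC => h; have h1 := rho_leU rhoR A B.
  have h2 : (#|B| <= 3)%N.
    apply: leq_trans (leq_card_setU _ _) _; rewrite -[3%N]/(2 + 1)%N leq_add ?card_Ed //.
    by apply: leq_trans (leq_card_setU _ _) _; rewrite -[2%N]/(1 + 1)%N leq_add ?card_Ed.
  move: IH h h1 h2; rewrite -/A cZ; move: (rho A) (rho (A :|: B)) #|B| (rho (KW Z)) #|Z :\ v|.
  clear; lia.
have sv w : w \in [:: a; b; c] -> Ed v w \subset clo (B :|: A).
  rewrite !inE => hw; apply: subset_trans (sub_clo _); apply: subset_trans (subsetUl _ _).
  case/or3P: hw => /eqP ->; rewrite /B.
  - by rewrite -setUA subsetUl.
  - by rewrite setUAC subsetUr.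
  - by rewrite subsetUr.
have sA i j : i \in Z :\ v -> j \in Z :\ v -> Ed i j \subset clo (B :|: A).
  by move=> hi hj; apply: subset_trans (sub_clo _); apply: subset_trans (subsetUr _ _); apply: Ed_KW.
have svw w : w \in Z -> Ed v w \subset clo (B :|: A).
  move=> wZ; have [wabc|wabc] := boolP (w \in [:: a; b; c]); first exact: sv.
  have [->|wv] := eqVneq w v; first by rewrite Edii sub0set.
  have wZ' : w \in Z :\ v by rewrite !inE wv.
  move: (aZ) (bZ) (cZ'); rewrite !inE => /andP[av _] /andP[bv _] /andP[cv _].
  have u5 : uniq [:: v; w; a; b; c].
    move: wabc; rewrite /= !inE !negb_or => /and3P[wa wb wc].
    by rewrite ![v == _]eq_sym wv av bv cv wa wb wc ab bc eq_sym ca.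
  apply: (K5_clo u5) => a' b'.
  have subZ z : z \in [:: w; a; b; c] -> z \in Z :\ v by rewrite in_cons => /orP[/eqP -> //|]; rewrite !in_cons in_nil orbF => /or3P[] /eqP ->.
  rewrite [a' \in _]in_cons [b' \in _]in_cons => /orP[/eqP ->|ha] /orP[/eqP ->|hb].
  - by rewrite Edii sub0set.
  - rewrite /is_pair eqxx /=; move: hb; rewrite in_cons => /orP[/eqP ->|hb _]; first by rewrite eqxx.
    exact: sv.
  - rewrite /is_pair eqxx andbT orbC /=; move: ha; rewrite in_cons => /orP[/eqP ->|ha _]; first by rewrite eqxx.
    by rewrite EdC; apply: sv.
  - by move=> _; apply: sA; apply: subZ.
apply/subsetP => e; rewrite in_KW => /andP[e1 e2].
suff : Ed (val e).1 (val e).2 \subset clo (B :|: A) by rewrite Ed_val sub1set.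
have [->|n1] := eqVneq (val e).1 v; first exact: svw.
have [->|n2] := eqVneq (val e).2 v; first by rewrite EdC; exact: svw.
by apply: sA; rewrite !inE ?n1 ?n2.
Qed.

End Abstract.

Lemma card_nb A u : #|nb A u| = #|A :\: KW (~: [set u])|.
Proof. by apply/eqP; rewrite -(eqn_add2l #|del A u|) -card_del /del cardsID. Qed.

Lemma sum_nb_in A O : (\sum_(u in O) #|nb A u|)%N =
  (\sum_(e in A) (((val e).1 \in O) + ((val e).2 \in O)))%N.
Proof.
have E u : #|nb A u| = (\sum_(e in A) (((val e).1 == u) + ((val e).2 == u)))%N.
  rewrite card_nb -sum1_card (eq_bigl (fun e => (e \in A) && (e \notin KW (~: [set u])))); last first.
    by move=> e; rewrite in_setD andbC.
  rewrite big_mkcondr; apply: eq_bigr => e _; rewrite in_KW !inE.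
  case h1: ((val e).1 == u); case h2: ((val e).2 == u) => //=.
  by have := edge_neq e; rewrite (eqP h1) (eqP h2) eqxx.
rewrite (eq_bigr _ (fun u _ => E u)) exchange_big /=; apply: eq_bigr => e _.
have cnt z : (\sum_(u in O) (z == u) = (z \in O))%N.
  have [zO|zO] := boolP (z \in O).
    rewrite (big_setD1 z) //= eqxx big1 ?addn0 // => u; rewrite !inE eq_sym.
    by case/andP => /negbTE ->.
  by rewrite big1 // => u uO; case: eqVneq => // E1; rewrite E1 uO in zO.
by rewrite big_split /= !cnt.
Qed.

(** Each edge meeting [O] is counted once by the first term, and the edges inside [O] once more by
    the second. *)
Lemma sum_nb_split A Z O : A \subset KW Z ->
  (\sum_(u in O) #|nb A u| = #|A :\: KW (Z :\: O)| + #|A :&: KW O|)%N.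
Proof.
move=> sA; rewrite sum_nb_in.
have -> : #|A :\: KW (Z :\: O)| = (\sum_(e in A | e \notin KW (Z :\: O)) 1)%N.
  by rewrite -sum1_card; apply: eq_bigl => e; rewrite in_setD andbC.
have -> : #|A :&: KW O| = (\sum_(e in A | e \in KW O) 1)%N.
  by rewrite -sum1_card; apply: eq_bigl => e; rewrite in_setI.
rewrite !big_mkcondr -big_split /=; apply: eq_bigr => e /(subsetP sA).
rewrite !in_KW !inE => /andP[-> ->]; rewrite !andbT.
by case: ((val e).1 \in O); case: ((val e).2 \in O).
Qed.

End K5Rank.

Section LinearK5.
Variables (R : numFieldType) (n : nat).
Implicit Types (p : 'I_n -> R * R) (A B : {set edge n}) (Z : {set 'I_n}) (i j k l m u w : 'I_n).

Lemma lrank_K5closed p : general p -> K5closed (lrank (rwe p)).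
Proof.
move=> gp i j k l m u5 A H; rewrite /lrank spnU -/(S p (Ed i j)) S_Ed addvC.
apply/eqP; rewrite dim_addv1 -[X in _ == X]addn0 eqn_add2l eqb0 negbK.
apply: (K5_cl u5 (general_brne gp) (perm_refl _)) => a b ha hb nab.
by rewrite memvE -S_Ed spnS // H.
Qed.

Lemma lrank_pend p A Z u w : general p -> A \subset KW Z -> u \notin Z -> u != w ->
  lrank (rwe p) (Ed u w :|: A) = (lrank (rwe p) A).+1.
Proof.
move=> gp sA uZ uw; rewrite /lrank spnU -/(S p (Ed u w)) S_Ed addvC dim_addv1 -/(S p A).
suff -> : rw p u w \notin S p A by rewrite addn1.
apply/negP => /(subvP (S_KW_offu p sA uZ)); rewrite offuP rw_row eqxx scale1r.
rewrite (negbTE uw) scale0r subr0 => /eqP h.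
have := congr1 (fun D : 'rV[R]_3 => D 0 (inord 0)) h; rewrite verE0 mxE => /eqP.
by rewrite expf_eq0 (negbTE (gen2 gp uw)) andbF.
Qed.

Lemma lrank_KW_low p Z : general p -> (3 <= #|Z|)%N ->
  (3 * #|Z| <= lrank (rwe p) (KW Z) + 6)%N.
Proof.
(* A vertex joined to [i] earlier ones adds at least [minn i 3] by [star_low]; for r >= 3 vertices
   these add up to 3r - 6. *)
move=> gp Z3; suff h : (\sum_(i < #|Z|) minn i 3 <= lrank (rwe p) (KW Z))%N.
  have E (r : nat) : (\sum_(i < r.+3) minn i 3 + 6 = 3 * r.+3)%N.
    elim: r => [|r IH]; first by rewrite !big_ord_recr big_ord0.
    by rewrite big_ord_recr /= addnAC IH [minn _ _](minn_idPr _) //; lia.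
  by apply: leq_trans (leq_add h (leqnn 6)); case: #|Z| Z3 => [|[|[|r]]] // _; rewrite E.
have [m] := ubnP #|Z|; elim: m Z {Z3} => // m IH Z ltZm.
have [->|[v vZ]] := set_0Vmem Z; first by rewrite cards0 big_ord0.
have cZ := cardsD1 v Z; rewrite vZ add1n in cZ.
have dE : del (KW Z) v = KW (Z :\ v) by rewrite /del -KWI setDE.
have nE : nb (KW Z) v = Z :\ v.
  by apply/setP=> w; rewrite in_nb adjF_KW vZ !inE eq_sym.
have low := star_low gp (S_del_offu p (KW Z) v) (nbii (KW Z) v).
rewrite -S_del dE nE in low.
rewrite cZ big_ord_recr /=; apply: leq_trans low; rewrite leq_add2r.
by apply: IH; rewrite -ltnS -cZ.
Qed.

End LinearK5.

Lemma parS (K : fieldType) (vT : vectType K) (W W' : {vspace vT}) u v :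
  (W <= W')%VS -> par W u v -> par W' u v.
Proof.
move=> sW /parP[h|h]; apply/parP; first by left; exact: (subvP sW).
by right; apply: subvP h; apply: addvS.
Qed.

Lemma par_dim (K : fieldType) (vT : vectType K) (W : {vspace vT}) u v :
  ~~ par W u v -> \dim (W + <[u]> + <[v]>) = (\dim W + 2)%N.
Proof.
rewrite /par -ltnNge !dim_addv1.
by case: (u \notin W); case: (v \notin _); rewrite ?addn0 ?addn1 ?addn2 ?ltnn //= => /leqW; rewrite ltnn.
Qed.

(** * Excluding the K_4 pattern *)

Section BadPattern.
Variables (R : realType) (n : nat) (x y : 'I_n -> R).
Hypothesis gen : generic x y.
Local Notation V := 'M[R]_(n, 3).
Let p : 'I_n -> R * R := fun i => (x i, y i).
Implicit Types (i j k l m a b c d e u w : 'I_n) (W : {vspace V}) (N Z : {set 'I_n}) (G H D : {set edge n}).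

Let gp : general p := generic_general gen.
Let lr := lrank (rwe p).
Let lrR : rank_function lr := lrank_rank (rwe p).

Lemma SU A B : S p (A :|: B) = (S p A + S p B)%VS.
Proof. exact: spnU. Qed.

(** If all o vertices outside [U] had degree at least six, then 6o would be at most [#|G| - 4] plus
    the number of edges inside [O]. With [#|G|] at most 3o + 7 and at most 3o - 6 inner edges this
    fails for o >= 3; the cases o = 1 and o = 2 are separate because that inner bound needs three
    vertices. *)
Lemma small_vertex Z G (U : {set 'I_n}) : G \subset KW Z -> U \subset Z -> #|U| = 5%N ->
  lr G = #|G| -> (4 <= #|G :&: KW U|)%N -> (#|G| + 8 <= 3 * #|Z|)%N -> U != Z ->
  exists2 u, u \in Z :\: U & (#|nb G u| <= 5)%N.
Proof.
move=> sG sU U5 iG GU cG neU.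
have [/exists_inP //|] := boolP [exists u in Z :\: U, (#|nb G u| <= 5)%N].
move=> /exists_inPn h; exfalso.
set O := Z :\: U; have cO : (#|Z| = #|O| + 5)%N.
  by rewrite -(cardsID U Z) (setIidPr sU) U5 addnC.
have ZO : Z :\: O = U by rewrite setDDr setDv set0U (setIidPr sU).
have s1 : (6 * #|O| <= \sum_(u in O) #|nb G u|)%N.
  by rewrite mulnC -sum_nat_const; apply: leq_sum => u /h; rewrite -ltnNge.
rewrite (sum_nb_split O sG) ZO in s1.
have s2 := cardsID (KW U) G.
have O0 : (0 < #|O|)%N.
  rewrite card_gt0; apply: contra neU => /eqP O0; rewrite eqEsubset sU /=.
  by rewrite -setD_eq0 -/O O0.
have sGO : lr (G :&: KW O) = #|G :&: KW O| by apply: (rho_indep_sub lrR (subsetIl _ _) iG).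
have s3 : (lr (G :&: KW O) <= lr (KW O))%N by apply: rho_mono lrR _ _ (subsetIr _ _).
have [O1|O1] := eqVneq #|O| 1%N.
  have [u uO] : exists u, u \in O by apply/card_gt0P.
  have := h u uO; rewrite -ltnNge => d6.
  have uZ : u \in Z by move: uO; rewrite inE => /andP[].
  have e1 : #|Z :\ u| = 5%N by have := cardsD1 u Z; rewrite uZ cO O1 !add1n => -[].
  have := subset_leq_card (nb_KW u sG); rewrite e1 => /(leq_trans d6).
  by rewrite ltnn.
have [O2|O2] := eqVneq #|O| 2%N.
  have : (#|G :&: KW O| <= 1)%N.
    have := sum_nb (subsetIr G (KW O)).
    have : (\sum_(u in O) #|nb (G :&: KW O) u| <= \sum_(u in O) 1)%N.
      apply: leq_sum => u uO; have := subset_leq_card (nb_KW u (subsetIr G (KW O))).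
      by move: O2; rewrite (cardsD1 u O) uO add1n => -[->].
    rewrite sum_nat_const O2; move=> q1 q2; move: q1; rewrite q2; clear; lia.
  move: s1 s2 GU cG; rewrite cO O2; clear; lia.
have := rho_KW lrR (lrank_K5closed gp) (Z := O); rewrite -/lr => /(_ _)/wrap[].
  by move: O0 O1 O2; clear; lia.
move: s1 s2 s3 GU cG sGO; rewrite cO; clear; lia.
Qed.

(** Opposite edges lie in [W] together. If [ad] and [bc] did, the stress of K_5 would put the sum of
    the scaled [ab] and [ac] in [W], making these two parallel. *)
Lemma bad_inner W a b c d e i j : uniq [:: a; b; c; d; e] ->
  (TT p a b c d e <= W)%VS -> ~~ par W (rw p a b) (rw p a c) ->
  i \in [:: a; b; c; d] -> j \in [:: a; b; c; d] -> i != j -> rw p i j \notin W.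
Proof.
move=> us sT np hi hj ij; have ps := perm_refl [:: a; b; c; d; e].
have bs : brne p [:: a; b; c; d; e] := general_brne gp.
set s := [:: a; b; c; d; e] in us ps bs.
have [[ea eb ec ed] [t1 t2 t3]] := TT_subP _ _ _ _ _ _ _ sT.
have pac : perm_eq [:: a; c; b; d; e] s by perm5 ps.
have pad : perm_eq [:: a; d; b; c; e] s by perm5 ps.
have pae : perm_eq [:: a; e; b; c; d] s by perm5 ps.
have pbc : perm_eq [:: b; c; a; d; e] s by perm5 ps.
have pbd : perm_eq [:: b; d; a; c; e] s by perm5 ps.
have pbe : perm_eq [:: b; e; a; c; d] s by perm5 ps.
have pcd : perm_eq [:: c; d; a; b; e] s by perm5 ps.
have pce : perm_eq [:: c; e; a; b; d] s by perm5 ps.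
have pde : perm_eq [:: d; e; a; b; c] s by perm5 ps.
have txW i' j' k l m : perm_eq [:: i'; j'; k; l; m] s -> tx p i' j' k l m \in W ->
    av p s i' j' - av p s k l \in W.
  by move=> h; have [z z0 ->] := tx_av us bs h; rewrite memvZE.
have avW i' j' k l m : perm_eq [:: i'; j'; k; l; m] s -> (av p s i' j' \in W) = (rw p i' j' \in W).
  by move=> h; rewrite /av memvZE // (kcoef_neq0 us bs h).
have rwN i' j' : (rw p j' i' \in W) = (rw p i' j' \in W) by rewrite rwC memvN.
have abN : rw p a b \notin W by apply: contra np => h; apply/parP; left.
have acN : rw p a c \notin W by apply: contra np => h; rewrite parC; apply/parP; left.
have cdN : rw p c d \notin W.
  apply: contra abN; rewrite -(avW _ _ _ _ _ ps) -(avW _ _ _ _ _ pcd) => h.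
  have := memvD (txW _ _ _ _ _ ps t1) h; rewrite subrK => hh; exact: hh.
have bdN : rw p b d \notin W.
  apply: contra acN; rewrite -(avW _ _ _ _ _ pac) -(avW _ _ _ _ _ pbd) => h.
  have := memvD (txW _ _ _ _ _ pac t2) h; rewrite subrK => hh; exact: hh.
have adbc : (rw p a d \in W) = (rw p b c \in W).
  rewrite -(avW _ _ _ _ _ pad) -(avW _ _ _ _ _ pbc).
  by rewrite -[in LHS](subrK (av p s b c) (av p s a d)) (rpredDl _ (txW _ _ _ _ _ pad t3)).
have adN : rw p a d \notin W.
  apply: contra np => ad; have bc := ad; rewrite adbc in bc.
  rewrite -(avW _ _ _ _ _ pad) in ad; rewrite -(avW _ _ _ _ _ pbc) in bc.
  have AE : av p s a e \in W by rewrite (avW _ _ _ _ _ pae) rwN.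
  have BE : av p s b e \in W by rewrite (avW _ _ _ _ _ pbe) rwN.
  have CE : av p s c e \in W by rewrite (avW _ _ _ _ _ pce) rwN.
  have DE : av p s d e \in W by rewrite (avW _ _ _ _ _ pde) rwN.
  have S4 : av p s a b + av p s a c + av p s b d + av p s c d \in W.
    rewrite (sum10_split (stress5 us bs ps)).2 memvN.
    exact: memvD (memvD ad bc) (memvD (memvD (memvD AE BE) CE) DE).
  have : av p s a b + av p s a c \in W.
    have h := memvD S4 (memvD (txW _ _ _ _ _ ps t1) (txW _ _ _ _ _ pac t2)).
    have two0 : (2 : R) != 0 by rewrite pnatr_eq0.
    rewrite -(memvZE _ _ two0).
    suff -> : 2 *: (av p s a b + av p s a c) = av p s a b + av p s a c + av p s b d + av p s c d +
       (av p s a b - av p s c d + (av p s a c - av p s b d)) by [].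
    rewrite scaler_nat mulr2n.
    move: (av p s a b) (av p s a c) (av p s b d) (av p s c d) => A B C D'.
    rewrite -(addrA (A + B)) -(addrA (A + B)); congr (_ + _).
    by rewrite [C + D']addrC addrACA [D' + _]addrC subrK [C + _]addrC subrK.
  have k1 := kcoef_neq0 us bs ps; have k2 := kcoef_neq0 us bs pac.
  rewrite -(parZ _ _ _ k1 k2) -/(av p s a b) -/(av p s a c) => h; apply/parP; right.
  have -> : av p s a c = av p s a b + av p s a c - av p s a b by rewrite [_ + av p s a c]addrC addrK.
  by apply: memvB; [exact: memv_addl | exact: memv_addline].
have bcN : rw p b c \notin W by rewrite -adbc.
have sym i' j' : rw p i' j' \notin W -> rw p j' i' \notin W by rewrite rwN.
move: hi hj ij; rewrite !inE => /or4P[] /eqP -> /or4P[] /eqP -> ij;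
  [by case/eqP: ij | exact: abN | exact: acN | exact: adN |
   exact: sym abN | by case/eqP: ij | exact: bcN | exact: bdN |
   exact: sym acN | exact: sym bcN | by case/eqP: ij | exact: cdN |
   exact: sym adN | exact: sym bdN | exact: sym cdN | by case/eqP: ij].
Qed.

End BadPattern.

Section ClaimC.
Variables (R : realType) (n : nat) (x y : 'I_n -> R).
Hypothesis gen : generic x y.
Local Notation V := 'M[R]_(n, 3).
Local Notation adm := (@adm R n x y).
Let p : 'I_n -> R * R := fun i => (x i, y i).
Implicit Types (i j k l m a b c d e u w : 'I_n) (W : {vspace V}) (N Z : {set 'I_n}) (G H D : {set edge n}).

Let gp : general p := generic_general gen.
Let lr := lrank (rwe p).
Let lrR : rank_function lr := lrank_rank (rwe p).

Lemma addvAC W W' W'' : (W + W' + W'' = W + W'' + W')%VS.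
Proof. by rewrite -addvA (addvC W') addvA. Qed.

Lemma dim_addv3 (K : fieldType) (vT : vectType K) (U : {vspace vT}) (u v w : vT) :
  (\dim U + 3 <= \dim (U + <[u]> + <[v]> + <[w]>))%N -> u \notin U /\ v \notin U.
Proof.
rewrite !dim_addv1 -!addnA leq_add2l => h; split; apply: contraTN h => h.
  by rewrite h; case: (_ \in _); case: (_ \in _).
by rewrite (memv_addl _ h); case: (_ \in _); case: (_ \in _).
Qed.

Lemma S_EdU A i j : S p (Ed i j :|: A) = (S p A + <[rw p i j]>)%VS.
Proof. by rewrite SU S_Ed addvC. Qed.

(** These four edges lie in the span of the K_4 relations, so adding them to a graph does not change
    its span together with [TT]. *)
Definition estar a b c d e : {set edge n} :=
  Ed a e :|: (Ed b e :|: (Ed c e :|: (Ed d e :|: set0))).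

Lemma estar_indep a b c d e : uniq [:: a; b; c; d; e] ->
  lr (estar a b c d e) = 4%N /\ #|estar a b c d e| = 4%N.
Proof.
rewrite /= !inE !negb_or.
move=> /and5P[/and4P[ab ac ad ae] /and3P[bc bd be] /andP[cd ce] de _].
have pend := @lrank_pend R n p _ _ _ _ gp.
have r : lr (estar a b c d e) = 4%N.
  have r1 : lr (Ed d e :|: set0) = 1%N.
    by rewrite /lr (pend _ [set e]) ?sub0set ?inE // (rho0 (lrank_rank (rwe p))).
  have r2 : lr (Ed c e :|: (Ed d e :|: set0)) = 2%N.
    rewrite /lr (pend _ [set d; e]) ?inE ?negb_or ?cd ?ce //; first by rewrite -/lr r1.
    by rewrite subUset sub0set andbT Ed_KW // !inE eqxx ?orbT.
  have r3 : lr (Ed b e :|: (Ed c e :|: (Ed d e :|: set0))) = 3%N.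
    rewrite /lr (pend _ [set c; d; e]) ?inE ?negb_or ?bc ?bd ?be //; first by rewrite -/lr r2.
    by rewrite !subUset sub0set andbT !Ed_KW // !inE eqxx ?orbT.
  rewrite /lr /estar (pend _ [set b; c; d; e]) ?inE ?negb_or ?ab ?ac ?ad ?ae //.
    by rewrite -/lr r3.
  by rewrite !subUset sub0set andbT !Ed_KW // !inE eqxx ?orbT.
split=> //; apply/eqP; rewrite eqn_leq -{2}r (rho_card lrR) andbT /estar.
apply: leq_trans (leq_card_setU _ _) _; rewrite -[4%N]/(1 + 3)%N leq_add ?card_Ed //.
apply: leq_trans (leq_card_setU _ _) _; rewrite -[3%N]/(1 + 2)%N leq_add ?card_Ed //.
apply: leq_trans (leq_card_setU _ _) _; rewrite -[2%N]/(1 + 1)%N leq_add ?card_Ed //.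
by rewrite setU0 card_Ed.
Qed.

Lemma estar_TT a b c d e : (S p (estar a b c d e) <= TT p a b c d e)%VS.
Proof.
have [[ea eb ec ed] _] := TT_subP _ _ _ _ _ _ _ (subvv (TT p a b c d e)).
have h w : rw p e w \in TT p a b c d e -> (<[rw p w e]> <= TT p a b c d e)%VS.
  by rewrite -memvE rwC memvN.
by rewrite /estar !S_EdU /S spn0 !subv_add sub0v (h _ ea) (h _ eb) (h _ ec) (h _ ed).
Qed.

(** This rules out the third alternative of [adm_five] when [W] is spanned by edges: there the
    relations would cost no dimension at all. The induction removes a vertex outside the five, of
    degree at most five, and feeds the graph without it, with up to two edges between its neighbours
    added, back to the hypothesis. *)
Lemma claimC Z G a b c d e : G \subset KW Z -> uniq [:: a; b; c; d; e] ->
  {subset [:: a; b; c; d; e] <= Z} ->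
  ~~ par (S p G + TT p a b c d e) (rw p a b) (rw p a c) ->
  (\dim (S p G) + 3 <= \dim (S p G + TT p a b c d e))%N.
Proof.
have [m] := ubnP #|Z|; elim: m Z G a b c d e => // m IH Z G0 a b c d e ltZm sG0 us sZ np0.
rewrite leqNgt; apply/negP => bad0.
set TTp := TT p a b c d e in np0 bad0.
set U : {set 'I_n} := [set w in [:: a; b; c; d; e]].
have sUZ : U \subset Z by apply/subsetP => w; rewrite inE; apply: sZ.
have U5 : #|U| = 5%N by rewrite cardsE; have /card_uniqP -> := us.
have [aU bU cU dU eU] : [/\ a \in U, b \in U, c \in U, d \in U & e \in U].
  by split; rewrite !inE eqxx ?orbT.
have sE : estar a b c d e \subset KW U by rewrite /estar !subUset sub0set andbT !Ed_KW.
have [rE cE] := estar_indep us.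
(* The graph is replaced by an independent one containing the star at [e]; this gives four edges on
   [U], as [small_vertex] requires. *)
have [G [sEG sGG iG rG]] := rho_basis_ext lrR (subsetUl (estar a b c d e) G0) (etrans rE (esym cE)).
have sG : G \subset KW Z.
  by apply: subset_trans sGG _; rewrite subUset sG0 andbT (subset_trans sE) ?KWS.
have SG : S p G = (S p G0 + S p (estar a b c d e))%VS.
  apply/eqP; rewrite addvC -SU eqEdim spnS //=; rewrite -/(S p _).
  by move: rG; rewrite /lr /lrank -/(S p G) -/(S p (_ :|: _)) => ->.
have EW : (S p G + TTp = S p G0 + TTp)%VS.
  by rewrite SG -addvA (addv_idPr (estar_TT a b c d e)).
have np : ~~ par (S p G + TTp) (rw p a b) (rw p a c) by rewrite EW.
have dG : \dim (S p G) = #|G| by rewrite -iG.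
have bad : (\dim (S p G + TTp) <= #|G| + 2)%N.
  rewrite EW -ltnS -addnS -dG; apply: leq_trans bad0 _; rewrite leq_add2r.
  by apply: dimvS; rewrite SG addvSl.
clear bad0 np0 EW SG rG sGG sG0 G0.
set W1 := (S p G + TTp)%VS in np bad.
have sT1 : (TTp <= W1)%VS by rewrite /W1 addvSr.
have sKW1 : (S p (KW U) <= W1 + <[rw p a b]> + <[rw p a c]>)%VS.
  apply/spn_subP => g; rewrite in_KW => /andP[g1 g2]; rewrite !inE in g1 g2.
  have := @TT_span R n p _ a b c d e (val g).1 (val g).2 us (general_brne gp) (perm_refl _).
  rewrite !inE => /(_ g1 g2); apply: subvP.
  by rewrite /W1 -!addvA addvSr.
have Z5 : (5 <= #|Z|)%N by rewrite -U5 subset_leq_card.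
(* The independent pair [ab], [ac] over [W1] supplies two dimensions below the bound 3|Z| - 6. *)
have GZ : (#|G| + 8 <= 3 * #|Z|)%N.
  have h1 : (\dim (W1 + <[rw p a b]> + <[rw p a c]>) <= lr (KW Z))%N.
    have hr i j : i \in U -> j \in U -> rw p i j \in spn (rwe p) (KW Z).
      by move=> hi hj; rewrite memvE -S_Ed spnS // Ed_KW //; exact: (subsetP sUZ).
    apply: dimvS; rewrite subv_add -memvE hr // andbT subv_add -memvE hr // andbT.
    rewrite /W1 subv_add /S spnS //=.
    apply/TT_subP; split; split; rewrite ?hr // /tx; apply: memvB; apply: memvZ; exact: hr.
  rewrite par_dim // in h1.
  have h2 := rho_KW lrR (lrank_K5closed gp) (leq_trans (isT : 3 <= 5)%N Z5).
  have h3 : (#|G| <= \dim W1)%N by rewrite -dG; apply: dimvS; rewrite addvSl.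
  move: h1 h2 h3; rewrite -/lr; clear; lia.
(* On five vertices no edge among [a], [b], [c], [d] can occur, so [G] is the star at [e]. Then [W1]
   has dimension at most 6, and two more rows cannot span the rank 9 of K_5. *)
have [UZ|UZ] := eqVneq U Z.
  have : G \subset estar a b c d e.
    apply: sub_adjF => i j hij.
    have [ij iU jU] : [/\ i != j, i \in U & j \in U].
      by have := adjFS sG hij; rewrite adjF_KW -UZ => /and3P.
    have rij : rw p i j \in W1 by rewrite memv_addl // S_adj.
    have hE k : k \in U -> k != e -> adjF (estar a b c d e) k e.
      rewrite /estar !adjFU !adjF_Ed eqxx !andbT inE => kU ke.
      move: kU; rewrite !inE (negbTE ke) orbF => /or4P[] /eqP -> ; move: us => /=; rewrite !inE !negb_or eqxx;
        by move=> /and5P[/and4P[? ? ? ->] /and3P[? ? ->] /andP[? ->] -> _]; rewrite ?orbT.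
    have [je|je] := eqVneq j e; first by rewrite je; apply: hE => //; rewrite -je.
    have [ie|ie] := eqVneq i e; first by rewrite ie adjFC; apply: hE.
    have hi : i \in [:: a; b; c; d] by move: iU; rewrite !inE (negbTE ie) orbF.
    have hj : j \in [:: a; b; c; d] by move: jU; rewrite !inE (negbTE je) orbF.
    by have := bad_inner gen us sT1 np hi hj ij; rewrite rij.
  move/subset_leq_card; rewrite cE => G4.
  have := dimvS sKW1; rewrite par_dim //.
  have := lrank_KW_low gp (_ : 3 <= #|U|)%N; rewrite U5 => /(_ isT); rewrite /lrank -/(S p _).
  move: bad G4; move: (\dim W1) #|G| (\dim (S p (KW U))); clear; lia.
have cGU : (4 <= #|G :&: KW U|)%N.
  by rewrite -cE subset_leq_card // subsetI sEG sE.
have [u uZU du] := small_vertex gen sG sUZ U5 iG cGU GZ UZ.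
move: uZU; rewrite inE => /andP[uU uZ].
have SdG := S_del p G u; have cdG := card_del G u.
have NZ := nb_KW u sG; have uN := nbii G u; have sH := del_KW u sG.
have iH : lr (del G u) = #|del G u| by apply: (rho_indep_sub lrR (del_sub G u) iG).
have oH := S_del_offu p G u.
set H := del G u in SdG cdG sH iH oH; set N := nb G u in SdG cdG NZ uN du.
have dH : \dim (S p H) = #|H| by rewrite -iH.
have uZ' : u \notin Z :\ u by rewrite !inE eqxx.
have sTZ : {subset [:: a; b; c; d; e] <= Z :\ u}.
  move=> w hw; rewrite !inE sZ // andbT; apply: contraNneq uU => <-.
  by rewrite inE.
set W0 := (S p H + TTp)%VS.
have admW : adm u W0 by apply: adm_ST sH uZ' sTZ.
have ltZ : (#|Z :\ u| < m)%N by move: ltZm; rewrite (cardsD1 u Z) uZ add1n ltnS.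
have W01 : (W0 <= W1)%VS by rewrite /W1 SdG addvS // addvSl.
have W1E : W1 = (W0 + starV p u N)%VS by rewrite /W1 /W0 SdG addvAC.
have npW : ~~ par W0 (rw p a b) (rw p a c) by apply: contra np; apply: parS.
have ih D : D \subset KW (Z :\ u) -> ~~ par (S p D + TTp) (rw p a b) (rw p a c) ->
    (\dim (S p D) + 3 <= \dim (S p D + TTp))%N by move=> hD; apply: IH hD us sTZ.
have tau3 := ih H sH npW; rewrite -/W0 dH in tau3.
have low := star_low gp admW.1 uN; rewrite -W1E in low.
have NN i j : i \in N -> j \in N -> Ed i j \subset KW (Z :\ u).
  by move=> hi hj; apply: Ed_KW; apply: (subsetP NZ).
have d4 : (4 <= #|N|)%N.
  move: bad low tau3 cdG; rewrite /minn; case: ltnP; move: (\dim W1) (\dim W0) #|G| #|H| #|N|; clear; lia.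
have dimG : \dim (S p H + starV p u N) = (#|H| + #|N|)%N by rewrite -SdG -cdG -dG.
(* Adding [ij] to [H] leaves [W0] unchanged but raises the rank of the graph, so the induction
   hypothesis asks for one dimension more than [W0] has. *)
have fin1 i j : i \in N -> j \in N -> rw p i j \in W0 -> rw p i j \notin S p H ->
    (\dim W0 <= #|H| + 3)%N -> False.
  move=> iN jN hW hH tau.
  have EW : (S p (Ed i j :|: H) + TTp = W0)%VS.
    by rewrite S_EdU addvAC -/W0; apply/addv_idPl; rewrite -memvE.
  have := ih (Ed i j :|: H); rewrite subUset NN // sH EW => /(_ isT npW).
  rewrite S_EdU dim_addv1 hH dH addn1; move: tau; move: (\dim W0) #|H|; clear; lia.
have dV0 := par_dim npW; set V0 := (W0 + <[rw p a b]> + <[rw p a c]>)%VS in dV0.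
have W0V : (W0 <= V0)%VS by rewrite /V0 -addvA addvSl.
have HW0 : (S p H <= W0)%VS by rewrite /W0 addvSl.
(* The same with two added edges of which only one is new modulo [W0]. That edge lies outside [V0],
   so [ab] and [ac] stay independent. *)
have fin2 i j k l : i \in N -> j \in N -> k \in N -> l \in N -> rw p i j \notin V0 ->
    rw p k l \in (W0 + <[rw p i j]>)%VS -> rw p k l \notin (S p H + <[rw p i j]>)%VS ->
    (\dim W0 <= #|H| + 3)%N -> False.
  move=> iN jN kN lN ijV klW klH tau.
  have ijH : rw p i j \notin S p H by apply: contra ijV; apply: (subvP (subv_trans HW0 W0V)).
  have EW : (S p (Ed k l :|: (Ed i j :|: H)) + TTp = W0 + <[rw p i j]>)%VS.
    rewrite !S_EdU addvAC (addvAC (S p H)) -/W0; apply/addv_idPl; rewrite -memvE //.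
  have npE : ~~ par (W0 + <[rw p i j]>) (rw p a b) (rw p a c).
    rewrite /par (addvAC W0) (addvAC _ <[rw p i j]>%VS) -/V0 (dim_addv1 V0) ijV dV0 -ltnNge (dim_addv1 W0).
    by case: (_ \in W0) => /=; rewrite ?addn0 ?addn1 ?addn2 ltnS ?leqnSn.
  have := ih (Ed k l :|: (Ed i j :|: H)); rewrite !subUset !NN // sH EW => /(_ isT npE).
  have dW : (\dim (W0 + <[rw p i j]>) <= \dim W0 + 1)%N by rewrite dim_addv1 leq_add2l leq_b1.
  rewrite !S_EdU !dim_addv1 ijH klH dH addn1 addn1 -dim_addv1 /=; move: dW tau.
  move: (\dim (W0 + _)) (\dim W0) #|H|; clear; lia.
(* Otherwise [star_high] would bound the span of the independent star of [u] over [H] below its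
   dimension [#|H| + #|N|]. *)
have Rg W : (S p H <= W)%VS -> (\dim W + 3 < #|H| + #|N|)%N ->
    exists i j, [/\ i \in N, j \in N, i != j & rw p i j \notin W].
  move=> sW hW.
  have [h|] := boolP [forall i in N, forall j in N, (i != j) ==> (rw p i j \in W)].
    have h' i j : i \in N -> j \in N -> i != j -> rw p i j \in W.
      by move=> iN jN; move/forall_inP: h => /(_ i iN)/forall_inP/(_ j jN)/implyP.
    have h1 := star_high gp uN h'.
    have h2 : (\dim (S p H + starV p u N) <= \dim (W + starV p u N))%N by apply/dimvS/addvS.
    by move: (leq_trans hW (leq_trans (eq_leq (esym dimG)) (leq_trans h2 h1))); rewrite ltnn.
  case/forall_inPn => i iN /forall_inPn[j jN]; rewrite negb_imply => /andP[ij hh].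
  by exists i, j.
have dimH1 i j : (\dim (S p H + <[rw p i j]>) <= #|H| + 1)%N.
  by rewrite dim_addv1 dH leq_add2l leq_b1.
have lt1 : (\dim (S p H) + 3 < #|H| + #|N|)%N by rewrite dH -addnS leq_add2l.
have [i1 [j1 [i1N j1N ij1 rH1]]] := Rg (S p H) (subvv _) lt1.
have R2 i j : #|N| = 5%N -> exists k l, [/\ k \in N, l \in N & rw p k l \notin (S p H + <[rw p i j]>)%VS].
  move=> N5; have [|k [l [? ? _ ?]]] := Rg _ (addvSl (S p H) <[rw p i j]>%VS); last by exists k, l.
  by rewrite N5; move: (dimH1 i j); move: (\dim _) #|H|; clear; lia.
have dW0N : (\dim W0 + 1 <= #|H| + #|N|)%N.
  by move: low bad; rewrite (minn_idPr _) ?(ltnW d4) // cdG; move: (\dim W1) (\dim W0) #|H| #|N|; clear; lia.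
have N45 : #|N| = 4%N \/ #|N| = 5%N by move: d4 du; move: #|N|; clear; lia.
have caseA : (forall i j, i \in N -> j \in N -> i != j -> rw p i j \in W0) -> False.
  move=> allW; case: N45 => N45.
    apply: (fin1 i1 j1) => //; first exact: allW.
    by move: dW0N; rewrite N45; move: (\dim W0) #|H|; clear; lia.
  have [k [l [kN lN klH]]] := R2 i1 j1 N45.
  have kl : k != l by apply: contraNneq klH => ->; rewrite rwii mem0v.
  have EW : (S p (Ed k l :|: (Ed i1 j1 :|: H)) + TTp = W0)%VS.
    rewrite !S_EdU addvAC (addvAC (S p H)) -/W0 (addv_idPl (_ : <[rw p i1 j1]> <= W0)%VS).
      by apply/addv_idPl; rewrite -memvE allW.
    by rewrite -memvE allW.
  have := ih (Ed k l :|: (Ed i1 j1 :|: H)); rewrite !subUset !NN // sH EW => /(_ isT npW).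
  rewrite !S_EdU !dim_addv1 rH1 klH dH /=; move: dW0N; rewrite N45.
  move: (\dim W0) #|H|; clear; lia.
case: (N45) => N5.
  apply: caseA; apply: (adm_L0 gen admW uN) => //; rewrite -W1E.
  by move: bad tau3; rewrite cdG N5; move: (\dim W0) (\dim W1) #|H|; clear; lia.
have notall W : (forall i j, i \in N -> j \in N -> i != j -> rw p i j \in W) \/
    exists i j, [/\ i \in N, j \in N & rw p i j \notin W].
  have [h|] := boolP [forall i in N, forall j in N, (i != j) ==> (rw p i j \in W)].
    left=> i j iN jN; move/forall_inP: h => /(_ i iN)/forall_inP/(_ j jN)/implyP; exact.
  case/forall_inPn => i iN /forall_inPn[j jN]; rewrite negb_imply => /andP[ij hh].
  by right; exists i, j.
have dW1 : (\dim W0 + 4 <= \dim W1)%N.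
  rewrite leqNgt addnS ltnS; apply/negP => h; apply: caseA.
  by apply: (adm_L0 gen admW uN) => //; rewrite -W1E.
have tau : (\dim W0 <= #|H| + 3)%N.
  by move: bad dW1; rewrite cdG N5; move: (\dim W0) (\dim W1) #|H|; clear; lia.
have dW1' : (\dim W1 <= \dim W0 + 4)%N.
  by move: bad tau3; rewrite cdG N5; move: (\dim W0) (\dim W1) #|H|; clear; lia.
(* If all pairs were in [V0], the star would add at most three to it, whereas [W1] with [ab] and
   [ac] has dimension at least [\dim W0 + 6]. *)
have [g1 [g2 [g1N g2N gV]]] : exists i j, [/\ i \in N, j \in N & rw p i j \notin V0].
  have [h|//] := notall V0; exfalso.
  have := star_high gp uN h; rewrite /V0 addvAC (addvAC W0) -W1E par_dim // -/V0 dV0.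
  by move: dW1; move: (\dim W0) (\dim W1); clear; lia.
rewrite W1E in dW1'; have [h1|[i iN h2]|[i [j [k [l [o [ps sT' np']]]]]]] := adm_five gen admW uN N5 dW1'.
- have [k [l [kN lN klH]]] := R2 g1 g2 N5.
  have kl : k != l by apply: contraNneq klH => ->; rewrite rwii mem0v.
  have g12 : g1 != g2 by apply: contraNneq gV => ->; rewrite rwii mem0v.
  apply: (fin2 g1 g2 k l) => //; have /parP[h|//] := h1 g1 g2 k l g1N g2N kN lN g12 kl.
  by move: gV; rewrite (subvP W0V).
- have [h|[j [k [jN kN jkH]]]] : (forall j k, j \in N :\ i -> k \in N :\ i -> j != k -> rw p j k \in S p H)
      \/ exists j k, [/\ j \in N :\ i, k \in N :\ i & rw p j k \notin S p H].
    have [h|] := boolP [forall j in N :\ i, forall k in N :\ i, (j != k) ==> (rw p j k \in S p H)].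
      left=> j k jN kN; move/forall_inP: h => /(_ j jN)/forall_inP/(_ k kN)/implyP; exact.
    case/forall_inPn => j jN /forall_inPn[k kN]; rewrite negb_imply => /andP[jk hh].
    by right; exists j, k.
  + have uN' : u \notin N :\ i by rewrite in_setD1 (negbTE uN) andbF.
    have a1 := star_high gp uN' h; have a2 := dim_star_add p u (S p H) (N :\ i) [set i].
    rewrite setUC setD1K // dimG N5 cards1 in a2.
    by move: a1 a2; rewrite dH; move: (\dim (_ + _)) #|H|; clear; lia.
  + have jk : j != k by apply: contraNneq jkH => ->; rewrite rwii mem0v.
    move: jN kN; rewrite !in_setD1 => /andP[ji jN] /andP[ki kN].
    apply: (fin1 j k) => //; apply: h2 => //; rewrite /= !inE !negb_or (eq_sym i j) ji (eq_sym i k) ki jk //.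
- have us' : uniq [:: i; j; k; l; o] by rewrite (perm_uniq ps) enum_uniq.
  have mN w : w \in [:: i; j; k; l; o] -> w \in N by rewrite (perm_mem ps) mem_enum.
  have [iN jN kN lN oN] : [/\ i \in N, j \in N, k \in N, l \in N & o \in N].
    by split; apply: mN; rewrite !inE eqxx ?orbT.
  have [[oi oj ok ol] [t1 t2 t3]] := TT_subP _ _ _ _ _ _ _ sT'.
  (* The pattern reappears on the neighbours of [u]. Its trivial star at [o] already lies in the
     span of [H], so by induction the three relations [tx] are independent modulo [H]. *)
  have inH w : w \in N -> rw p o w \in W0 -> rw p o w \in S p H.
    by move=> wN hw; apply/negPn/negP => hn; apply: (fin1 o w).
  have sH' : (S p H + TT p i j k l o <= W0)%VS by rewrite subv_add HW0.
  have npH : ~~ par (S p H + TT p i j k l o) (rw p i j) (rw p i k) by apply: contra np'; apply: parS.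
  have sZ' : {subset [:: i; j; k; l; o] <= Z :\ u} by move=> w /mN; apply: (subsetP NZ).
  have tauH := IH _ H _ _ _ _ _ ltZ sH us' sZ' npH; rewrite dH in tauH.
  have txs : (TT p i j k l o <= S p H + <[tx p i j k l o]> + <[tx p i k j l o]> + <[tx p i l j k o]>)%VS.
    apply/TT_subP; split; split; [ | | | | | |exact: memv_addline].
    - by do 3! apply: memv_addl; apply: inH.
    - by do 3! apply: memv_addl; apply: inH.
    - by do 3! apply: memv_addl; apply: inH.
    - by do 3! apply: memv_addl; apply: inH.
    - by do 2! apply: memv_addl; apply: memv_addline.
    - by apply: memv_addl; apply: memv_addline.
  have notH : tx p i j k l o \notin S p H /\ tx p i k j l o \notin S p H.
    have := dimvS (_ : S p H + TT p i j k l o <= S p H + <[tx p i j k l o]> + <[tx p i k j l o]> + <[tx p i l j k o]>)%VS.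
    rewrite subv_add txs andbT -!addvA addvSl => /(_ isT)/(leq_trans tauH).
    by rewrite !addvA -dH => hh; exact: dim_addv3 hh.
  (* By [TT_span] these two rows generate all pairs of neighbours modulo [W0], and one pair is
     outside [V0]. *)
  have oneV : rw p i j \notin V0 \/ rw p i k \notin V0.
    apply/orP; rewrite -negb_and; apply/negP => /andP[ijV ikV].
    have hg := @TT_span R n p _ i j k l o g1 g2 us' (general_brne gp) (perm_refl _).
    move: gV; rewrite (subvP _ _ (hg _ _)) ?(perm_mem ps) ?mem_enum //.
    by rewrite !subv_add -!memvE ijV ikV !andbT (subv_trans sT').
  (* A relation in [W0] that is not in the span of [H] expresses the opposite edge through the first
     modulo [W0] but not modulo [H], which is the situation of [fin2]. *)
  have tail a' b' c' d' : a' \in N -> b' \in N -> c' \in N -> d' \in N -> rw p a' b' \notin V0 ->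
      uniq [:: a'; b'; c'; d'; o] -> tx p a' b' c' d' o \in W0 -> tx p a' b' c' d' o \notin S p H -> False.
    move=> aN bN cN dN abV u5 tW tH.
    have ne : pibr p a' b' c' d' o != 0.
      have := kcoef_neq0 u5 (general_brne gp) (perm_refl _).
      by rewrite (pibr_kcoef p u5 (perm_refl _)) invr_eq0.
    set P := pibr p a' b' c' d' o in ne; set Q := pibr p c' d' a' b' o.
    have E : tx p a' b' c' d' o = Q *: rw p a' b' - P *: rw p c' d' by [].
    have cdE : rw p c' d' = P^-1 *: (Q *: rw p a' b' - tx p a' b' c' d' o).
      by rewrite E opprB addrC subrK scalerK.
    apply: (fin2 a' b' c' d') => //.
      by rewrite cdE memvZ // memvB ?memvZ ?memv_addline // memv_addl.
    apply/negP => /memv_addlineP[c0 hc _].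
    have h3 : (Q - P * c0) *: rw p a' b' - tx p a' b' c' d' o \in S p H.
      have -> : (Q - P * c0) *: rw p a' b' - tx p a' b' c' d' o = P *: (rw p c' d' - c0 *: rw p a' b').
        rewrite E; move: (rw p a' b') (rw p c' d') => X Y.
        by rewrite [RHS]scalerBr scalerA scalerBl opprB addrC addrA subrK.
      by rewrite memvZ.
    have [z0|z0] := eqVneq (Q - P * c0) 0.
      by move: h3; rewrite z0 scale0r sub0r memvN (negbTE tH).
    case/negP: abV; apply: (subvP W0V); rewrite -(memvZE _ _ z0).
    by rewrite -(subrK (tx p a' b' c' d' o) (_ *: _)) memvD // (subvP HW0).
  case: oneV => hV.
    exact: (tail i j k l iN jN kN lN hV us' t1 notH.1).
  have u5 : uniq [:: i; k; j; l; o].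
    by rewrite (perm_uniq (_ : perm_eq _ [:: i; j; k; l; o])) //; perm5 (perm_refl [:: i; j; k; l; o]).
  exact: (tail i k j l iN kN jN lN hV u5 t2 notH.2).
Qed.
End ClaimC.

(** * The cofactor matroid dominates *)

Section Maximality.
Variables (R : realType) (n : nat) (x y : 'I_n -> R).
Hypothesis gen : generic x y.
Let p : 'I_n -> R * R := fun i => (x i, y i).
Implicit Types (i j k l m a b c d e u v w : 'I_n) (N Z : {set 'I_n}) (A B : {set edge n}).

Let gp : general p := generic_general gen.
Let lr := lrank (rwe p).
Let lrR : rank_function lr := lrank_rank (rwe p).

Lemma vertex_deg5 rho Z A : rank_function rho -> K5closed rho -> A \subset KW Z ->
  rho A = #|A| -> Z != set0 -> exists2 v, v \in Z & (#|nb A v| <= 5)%N.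
Proof.
move=> rR r5 sA iA Z0.
have [/exists_inP //|/exists_inPn h] := boolP [exists v in Z, (#|nb A v| <= 5)%N].
exfalso; have h6 v : v \in Z -> (6 <= #|nb A v|)%N by move=> /h; rewrite -ltnNge.
have /set0Pn[v vZ] := Z0.
have Zb : (3 <= #|Z|)%N.
  rewrite (cardsD1 v) vZ add1n ltnS; apply: leq_trans (subset_leq_card (nb_KW v sA)).
  by apply: leq_trans (h6 _ vZ).
have h1 : (#|Z| * 6 <= 2 * #|A|)%N.
  by rewrite -(sum_nb sA) -sum_nat_const; apply: leq_sum.
have h2 := rho_KW rR r5 Zb.
have h3 : (#|A| <= rho (KW Z))%N by rewrite -iA; apply: rho_mono.
by move: h1 h2 h3; move: #|Z| #|A| (rho _); clear; lia.
Qed.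

(* Whiteley's maximality property of the cofactor matroid. *)
Theorem K5_maximal rho Z A : rank_function rho -> K5closed rho -> A \subset KW Z ->
  rho A = #|A| -> lr A = #|A|.
Proof.
move=> rR r5; have [m] := ubnP #|Z|; elim: m Z A => // m IH Z A ltZm sA iA.
have [Z0|Z0] := eqVneq Z set0.
  have -> : A = set0; last by rewrite (rho0 lrR) cards0.
  apply/eqP; rewrite -subset0; apply: subset_trans sA _.
  by apply/subsetP => e; rewrite in_KW Z0 inE.
have [v vZ d5] := vertex_deg5 rR r5 sA iA Z0.
have ltZ : (#|Z :\ v| < m)%N by move: ltZm; rewrite (cardsD1 v Z) vZ add1n ltnS.
have {}IH B : B \subset KW (Z :\ v) -> rho B = #|B| -> lr B = #|B| by apply: IH.
have NZ := nb_KW v sA; have vN := nbii A v; have sH := del_KW v sA.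
have iH : rho (del A v) = #|del A v| by apply: (rho_indep_sub rR (del_sub A v) iA).
have cA := card_del A v; have SA := S_del p A v; have oH := S_del_offu p A v.
have EA := del_nb A v.
set H := del A v in sH iH cA SA oH EA; set N := nb A v in NZ vN d5 cA SA EA.
have dH : \dim (S p H) = #|H| by rewrite -[LHS]/(lr H) IH.
apply/eqP; rewrite eqn_leq (rho_card lrR) /= leqNgt; apply/negP => bad.
have {}bad : (\dim (S p H + starV p v N) < #|H| + #|N|)%N by rewrite -SA -cA.
have vZ' : v \notin Z :\ v by rewrite !inE eqxx.
have low := star_low gp oH vN; rewrite dH in low.
have d4 : (4 <= #|N|)%N.
  move: (leq_ltn_trans low bad); rewrite ltn_add2l.
  by move: #|N|; clear; lia.
(* Cofactor spanning passes to [rho] away from [v]: otherwise adding the edge would keep the set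
   [rho]-independent, hence cofactor-independent by induction. *)
have spt B i j : B \subset KW (Z :\ v) -> rho B = #|B| -> i \in N -> j \in N ->
    rw p i j \in S p B -> Ed i j \subset clo rho B.
  move=> sB iB iN jN hij; have [->|ij] := eqVneq i j; first by rewrite Edii sub0set.
  have [e eE _] := Ed_neq ij; rewrite (cloP rR) eE; apply/negPn/negP => hne.
  have iE := rho_indep_add rR iB hne.
  have sE : e |: B \subset KW (Z :\ v).
    by rewrite subUset sB andbT -eE; apply: Ed_KW; apply: (subsetP NZ).
  have := IH _ sE iE; rewrite /lr /lrank -eE -/(S p _) S_EdU (addv_idPl _) -?memvE //.
  rewrite -[LHS]/(lr B) (IH _ sB iB) eE cardsU1.
  case: (boolP (e \in B)) => [eB _|_ /eqP]; last by rewrite -[X in X == _]add0n eqn_add2r.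
  by move: hne; rewrite (setUidPr _) ?sub1set ?eqxx.
have HclA B : H \subset B -> clo rho H \subset clo rho B by apply: cloS.
have nbA w : w \in N -> Ed v w \subset A by rewrite in_nb adjF_sub => /andP[].
(* With the six edges among four neighbours in the closure of [H], the K_5 on them and [v] makes the
   edge [vw] of the [rho]-independent set [A] redundant. *)
have k4 a b c w : uniq [:: a; b; c; w] -> {subset [:: a; b; c; w] <= N} ->
    (forall i j, i \in [:: a; b; c; w] -> j \in [:: a; b; c; w] -> Ed i j \subset clo rho H) -> False.
  move=> u4 sN hcl; have wN : w \in N by rewrite sN // !inE eqxx !orbT.
  have vw : v != w by apply: contraNneq vN => ->.
  have [e eE _] := Ed_neq vw.
  have eA : e \in A by rewrite -sub1set -eE nbA.
  have HA : H \subset A :\ e.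
    rewrite subsetD1 del_sub /= /H /del in_setI eA in_KW /=.
    have : e \in Ed v w by rewrite eE inE.
    by rewrite inE => /orP[] /eqP -> /=; rewrite !inE eqxx ?andbF.
  have u5 : uniq [:: v; w; a; b; c].
    rewrite cons_uniq; apply/andP; split.
      by apply: contra vN => h; apply: sN; move: h; rewrite !inE => /or4P[] ->; rewrite ?orbT.
    by rewrite -(rot_uniq 1).
  have HcA : clo rho H \subset clo rho (A :\ e) by apply: cloS.
  have hv j : j \in [:: v; w; a; b; c] -> j != w -> Ed v j \subset clo rho (A :\ e).
    rewrite in_cons => /orP[/eqP -> _|hj jw]; first by rewrite Edii sub0set.
    apply: subset_trans (sub_clo _ _); rewrite subsetD1 nbA; last first.
      by apply: sN; move: hj; rewrite !inE => /or4P[] ->; rewrite ?orbT.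
    apply/negP => h; have [|vj] := eqVneq v j; first by move=> E; move: h; rewrite E Edii inE.
    have [f fE _] := Ed_neq vj; have : adjF (Ed v w) v j.
      by rewrite adjF_sub vj fE eE sub1set; move: h; rewrite fE !inE eq_sym.
    by rewrite adjF_Ed (negPf jw) (negPf vw) !andbF.
  have : Ed v w \subset clo rho (A :\ e).
    apply: (K5_clo rR r5 u5) => i j hi hj; rewrite /is_pair negb_or !negb_and.
    have [->|iv] := eqVneq i v; first by rewrite orFb => /andP[h _]; apply: hv.
    have [->|jv] := eqVneq j v; first by rewrite orbF andTb EdC; apply: hv.
    move=> _; apply: subset_trans HcA; apply: hcl.
      by move: hi; rewrite !inE (negPf iv) /= => /or4P[] ->; rewrite ?orbT.
    by move: hj; rewrite !inE (negPf jv) /= => /or4P[] ->; rewrite ?orbT.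
  rewrite (cloP rR) eE setD1K // iA => /eqP h.
  by have := rho_card rR (A :\ e); rewrite -h (cardsD1 e A) eA add1n ltnn.
have spH i j : i \in N -> j \in N -> rw p i j \in S p H -> Ed i j \subset clo rho H by apply: spt.
have aH : adm x y v (S p H) by apply: adm_S sH vZ'.
have [N4|N5] : #|N| = 4%N \/ #|N| = 5%N by move: d4 d5; clear; case: #|N| => [|[|[|[|[|[|r]]]]]] // _ _; [left|right].
  have hd : (\dim (S p H + starV p v N) <= \dim (S p H) + 3)%N.
    by rewrite dH -ltnS -addnS -[4%N]N4.
  have hW := adm_L0 gen aH vN d4 hd.
  have [a [b [c [w [u4 sN]]]]] := exists_uniq4 d4; apply: (k4 _ _ _ _ u4 sN) => i j hi hj.
  have [->|ij] := eqVneq i j; first by rewrite Edii sub0set.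
  by apply: spH; rewrite ?sN ?hW ?sN.
have hd : (\dim (S p H + starV p v N) <= \dim (S p H) + 4)%N.
  by rewrite dH -ltnS -addnS -[5%N]N5.
case: (adm_five gen aH vN N5 hd) => [hpar|[i iN hi]|[a [b [c [d [e [ps sT nd]]]]]]].
- have [|/forall_inPn[i iN /forall_inPn[j jN nij]]] := boolP [forall i in N, forall j in N, Ed i j \subset clo rho H].
    move/forall_inP => h; have [a [b [c [w [u4 sN]]]]] := exists_uniq4 d4.
    by apply: (k4 _ _ _ _ u4 sN) => i j hi hj; apply: (forall_inP (h _ (sN _ hi))); apply: sN.
  have ij : i != j by apply: contraNneq nij => ->; rewrite Edii sub0set.
  (* All pairs of neighbours are parallel, so one extra edge spans them all. Three edges at [v] then
     span its star, giving [A] rank at most [#|H| + 4] although it has [#|H| + 5] edges. *)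
  have [e eE _] := Ed_neq ij; set B := e |: H.
  have iB : rho B = #|B| by apply: (rho_indep_add rR iH); move: nij; rewrite (cloP rR) eE.
  have sB : B \subset KW (Z :\ v) by rewrite subUset sH andbT -eE Ed_KW ?(subsetP NZ).
  have hB k l : k \in N -> l \in N -> Ed k l \subset clo rho B.
    move=> kN lN; have [->|kl] := eqVneq k l; first by rewrite Edii sub0set.
    apply: spt => //; have /parP[h|] := hpar i j k l iN jN kN lN ij kl; last by rewrite -S_EdU eE.
    by case/negP: nij; apply: spH.
  have [a [b [c [w0 [u4 sN]]]]] := exists_uniq4 d4.
  have u3 : uniq [:: a; b; c] by move: u4; rewrite -[_ :: _]/([:: a; b; c] ++ [:: w0]) cat_uniq => /andP[].
  have {}sN : {subset [:: a; b; c] <= N} by move=> z h; apply: sN; move: h; rewrite !inE => /or3P[] ->; rewrite ?orbT.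
  set C := B :|: (Ed v a :|: (Ed v b :|: Ed v c)).
  have CC : C \subset clo rho C := sub_clo _ _.
  have BC : clo rho B \subset clo rho C by apply/cloS/subsetUl.
  have hv w : w \in [:: a; b; c] -> Ed v w \subset clo rho C.
    move=> hw; apply: subset_trans CC; rewrite /C; apply: subset_trans (subsetUr _ _).
    move: hw; rewrite !inE => /or3P[] /eqP ->; first exact: subsetUl.
      by apply: subset_trans (subsetUr _ _); apply: subsetUl.
    by apply: subset_trans (subsetUr _ _); apply: subsetUr.
  have hw w : w \in N -> Ed v w \subset clo rho C.
    move=> wN; have [|wabc] := boolP (w \in [:: a; b; c]); first exact: hv.
    have vw : v != w by apply: contraNneq vN => ->.
    apply: (@K5_clo _ _ rR r5 v w a b c) => [|k l].
      rewrite (cons_uniq v) (cons_uniq w) wabc u3 andbT.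
      by rewrite andbT in_cons negb_or vw /=; apply: contra vN => /sN.
    have nin z : z \in [:: v; w; a; b; c] -> z != v -> z \in N.
      by rewrite (in_cons v) (in_cons w) => /orP[-> //|/orP[/eqP -> //|/sN]].
    have ev z : z \in [:: v; w; a; b; c] -> z != w -> Ed v z \subset clo rho C.
      rewrite (in_cons v) (in_cons w) => /orP[/eqP ->|/orP[-> //|/hv //]].
      by rewrite Edii sub0set.
    move=> hk hl; rewrite /is_pair negb_or !negb_and.
    have [->|kv] := eqVneq k v; first by rewrite orFb => /andP[h _]; apply: ev.
    have [->|lv] := eqVneq l v; first by rewrite orbF andTb EdC; apply: ev.
    by move=> _; apply: subset_trans BC; apply: hB; apply: nin.
  have sAC : A \subset clo rho C.
    rewrite EA subUset; apply/andP; split; last by apply/bigcupsP => w /hw.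
    by apply: subset_trans CC; apply: subset_trans (subsetUl _ _); apply: subsetUr.
  have h1 : (#|A| <= rho C)%N by rewrite -iA -(rho_clo rR C); apply: rho_mono.
  have h2 := rho_leU rR B (Ed v a :|: (Ed v b :|: Ed v c)).
  have h3 : (#|Ed v a :|: (Ed v b :|: Ed v c) : {set edge n}| <= 1 + (1 + 1))%N.
    apply: leq_trans (leq_card_setU _ _) _; apply: leq_add (card_Ed _ _) _.
    by apply: leq_trans (leq_card_setU _ _) _; apply: leq_add; apply: card_Ed.
  have h4 : (#|B| <= #|H|.+1)%N by rewrite /B cardsU1; case: (_ \notin _).
  move: h1 h2 h3 h4; rewrite -/C iB cA N5; move: #|H| #|B| (rho C) #|_ :|: _|; clear; lia.
- have N4 : #|N :\ i| = 4%N by move: N5; rewrite (cardsD1 i) iN add1n => -[].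
  have [|a [b [c [w [u4 sN]]]]] := @exists_uniq4 _ (N :\ i); first by rewrite N4.
  have sN' z : z \in [:: a; b; c; w] -> (z \in N) /\ (i != z).
    by move/sN; rewrite !inE eq_sym => /andP[].
  apply: (k4 _ _ _ _ u4) => [z /sN'[] //|k l /sN'[kN ik] /sN'[lN il]].
  have [->|kl] := eqVneq k l; first by rewrite Edii sub0set.
  by apply: spH => //; apply: hi => //; rewrite /= !inE negb_or ik il kl.
(* The K_4 pattern would hold at no cost, against the three dimensions demanded by [claimC]. *)
have E : (S p H + TT p a b c d e)%VS = S p H by apply/addv_idPl.
have := @claimC R n x y gen (Z :\ v) H a b c d e sH.
rewrite E -[X in (_ <= X)%N]addn0 leq_add2l ltn0 => h; suff : false by []; apply: h => //.
  by rewrite (perm_uniq ps) enum_uniq.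
by move=> z; rewrite (perm_mem ps) mem_enum; apply: (subsetP NZ).
Qed.
End Maximality.

(** * Stresses, quotients by stresses, and generation by copies of K_5 *)

Section StressSpace.
Variables (K : fieldType) (vT : vectType K) (E : finType) (g : E -> vT).
Local Notation VS := {ffun E -> K^o}.
Implicit Types (A B : {set E}) (e : E) (s : VS).

Definition dl e : VS := [ffun f => (f == e)%:R].

Lemma dl_sum s : s = \sum_e s e *: dl e.
Proof.
apply/ffunP => f; rewrite sum_ffunE (bigD1 f) //= big1 => [|e ef]; rewrite !ffunE.
  by rewrite addr0 eqxx /GRing.scale /= mulr1.
by rewrite (negPf (_ : f != e)) 1?eq_sym // scaler0.
Qed.

Lemma spn_dlP A s : reflect (forall e, e \notin A -> s e = 0) (s \in spn dl A).
Proof.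
apply: (iffP idP) => [/memv_sumP[t tA ->] e eA|h].
  rewrite sum_ffunE big1 // => f fA; have /vlineP[k ->] := tA f fA.
  rewrite !ffunE (negPf (_ : e != f)) ?scaler0 //.
  by apply: contraNneq eA => ->.
rewrite [s]dl_sum memv_suml // => e _.
have [eA|eA] := boolP (e \in A); first by rewrite memvZ // spn_mem.
by rewrite h // scale0r mem0v.
Qed.

Lemma dim_spn_dl A : \dim (spn dl A) = #|A|.
Proof.
have h : \dim (spn dl setT) = #|E|.
  have -> : spn dl setT = fullv.
    by apply/vspaceP => s; rewrite memvf; apply/spn_dlP => e; rewrite inE.
  by rewrite dimvf /dim /= muln1.
apply: (rho_indep_sub (lrank_rank dl) (subsetT A)).
by rewrite /lrank h cardsT.
Qed.

Lemma lrank_ker (W : vectType K) (f : 'Hom(VS, W)) A :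
  (\dim (spn dl A :&: lker f) + lrank (fun e => f (dl e)) A = #|A|)%N.
Proof.
rewrite -(dim_spn_dl A) -(limg_ker_dim f (spn dl A)); congr (_ + _)%N.
by rewrite /lrank /spn limg_sum; congr (\dim _); apply: eq_bigr => e _; rewrite limg_line.
Qed.

Definition evs (s : VS) : vT := \sum_e s e *: g e.

Fact evs_linear : linear evs.
Proof.
move=> k s t; rewrite /evs scaler_sumr -big_split; apply: eq_bigr => e _ /=.
by rewrite !ffunE scalerDl scalerA.
Qed.
HB.instance Definition _ := GRing.isLinear.Build K VS vT *:%R evs evs_linear.

Definition evh : 'Hom(VS, vT) := linfun evs.

Lemma evh_dl e : evh (dl e) = g e.
Proof.
rewrite lfunE /= /evs (bigD1 e) //= big1 => [|f fe]; first by rewrite !ffunE eqxx scale1r addr0.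
by rewrite ffunE (negPf fe) scale0r.
Qed.

Definition stress A : {vspace VS} := (spn dl A :&: lker evh)%VS.

Lemma dim_stress A : (\dim (stress A) + lrank g A = #|A|)%N.
Proof.
rewrite -(lrank_ker evh A); congr (_ + _)%N; rewrite /lrank /spn; congr (\dim _).
by apply: eq_bigr => e _; rewrite evh_dl.
Qed.

Lemma stressS A B : A \subset B -> (stress A <= stress B)%VS.
Proof. by move=> h; apply: capvS => //; apply: spnS. Qed.

Section Kernel.
Variable KK : {vspace VS}.

(* The quotient by [KK], as a projection along [KK]. *)
Definition quo e : VS := (\1 - projv KK)%VF (dl e).

Lemma lker_quo : lker (\1 - projv KK)%VF = KK.
Proof.
apply/vspaceP => s; rewrite memv_ker add_lfunE opp_lfunE id_lfunE subr_eq0.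
by apply/eqP/idP => [->|h]; [apply: memv_proj | rewrite projv_id].
Qed.

Lemma dim_quo A : (\dim (spn dl A :&: KK) + lrank quo A = #|A|)%N.
Proof. by rewrite -{1}lker_quo lrank_ker. Qed.

Hypothesis KKev : (KK <= lker evh)%VS.

(** Imposing only the relations in [KK] rather than all relations can only enlarge ranks. *)
Lemma quo_ge A : (lrank g A <= lrank quo A)%N.
Proof.
have := dim_quo A; rewrite -[RHS](dim_stress A) => hE.
have : (\dim (spn dl A :&: KK) <= \dim (stress A))%N by apply: dimvS; apply: capvS.
by move: hE; clear; lia.
Qed.

Lemma quo_eq A : (stress A <= KK)%VS -> lrank quo A = lrank g A.
Proof.
move=> h; have := dim_quo A; rewrite -[RHS](dim_stress A).
suff -> : (spn dl A :&: KK)%VS = stress A by move/addnI.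
by apply/eqP; rewrite eqEsubv subv_cap capvSl h /= capvS.
Qed.

Lemma quo_neq A : (KK <= stress A)%VS -> ~~ (stress A <= KK)%VS -> (lrank g A < lrank quo A)%N.
Proof.
move=> h1 h2; rewrite ltn_neqAle quo_ge andbT; apply: contra h2 => /eqP h.
have := dim_quo A; rewrite -h -[RHS](dim_stress A) => /addIn hd.
have hE : (spn dl A :&: KK)%VS = KK by apply/capv_idPr; apply: subv_trans h1 (capvSl _ _).
by move: hd; rewrite hE => hd; rewrite -(eqP (_ : KK == stress A)) // eqEdim h1 hd leqnn.
Qed.
End Kernel.
End StressSpace.

Section StressK5.
Variables (R : realType) (n : nat) (x y : 'I_n -> R).
Hypothesis gen : generic x y.
Let p : 'I_n -> R * R := fun i => (x i, y i).
Implicit Types (i j k l m a b : 'I_n) (Z U : {set 'I_n}) (A B F : {set edge n}).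

Let gp : general p := generic_general gen.
Let lr := lrank (rwe p).
Let lrR : rank_function lr := lrank_rank (rwe p).
Let lr5 : K5closed lr := lrank_K5closed gp.
Local Notation St := (stress (rwe p)).

Definition K5sum F := (\sum_(U : {set 'I_n} | (#|U| == 5%N) && (KW U \subset F)) St (KW U))%VS.

Lemma K5sumS A F : A \subset F -> (K5sum A <= K5sum F)%VS.
Proof.
move=> sA; apply/subv_sumP => U /andP[U5 sU].
by apply: (sumv_sup U); rewrite ?U5 ?(subset_trans sU).
Qed.

Lemma K5sum_St F : (K5sum F <= St F)%VS.
Proof. by apply/subv_sumP => U /andP[_ sU]; apply: stressS. Qed.

Lemma K5sum_ker F : (K5sum F <= lker (evh (rwe p)))%VS.
Proof. exact: subv_trans (K5sum_St F) (capvSr _ _). Qed.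

(* A stress of [F] outside the span of the K_5-stresses would lift the matroid of
   [F] to a matroid of larger rank in which the copies of K_5 stay dependent. *)
Theorem flat_stress F : clo lr F \subset F -> (St F <= K5sum F)%VS.
Proof.
have [m] := ubnP (lr F); elim: m F => // m IH F ltF cF; apply/negPn/negP => nF.
set q := quo (K5sum F); pose rg := lrank q.
have rgR : rank_function rg := lrank_rank q.
have rg_ge A : (lr A <= rg A)%N by apply: quo_ge (K5sum_ker F) A.
have rgF : (lr F < rg F)%N by apply: quo_neq (K5sum_ker F) _ _ nF; apply: K5sum_St.
have inF A : A \subset F -> clo lr A \subset F.
  by move=> sA; apply: subset_trans cF; apply: cloS.
(* The closure of [A] is a flat of smaller rank inside [F], so by induction its stresses are already
   factored out. The two ranks can differ only on sets spanning [F]. *)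
have rg_low A : A \subset F -> (lr A < lr F)%N -> rg A = lr A.
  move=> sA rA; apply: quo_eq (K5sum_ker F) _ _.
  apply: subv_trans (_ : St (clo lr A) <= _)%VS; first by apply/stressS/sub_clo.
  apply: subv_trans (IH _ _ _) (K5sumS (inF _ sA)).
    by rewrite rho_clo // -ltnS; apply: leq_trans ltF; rewrite ltnS.
  by have := @clo_trans _ lr lrR A (clo lr A) (subxx _); rewrite (setUidPl (sub_clo lr A)).
pose t A := if A \subset F then rg A else lr A.
(* Without truncation a set spanning [F] could have a lifted rank above its cofactor rank after
   adding an edge outside [F]; the cap at [lr F + 1] makes the two definitions fit together. *)
pose rho A := minn (t A) (lr F).+1.
have t_ge A : (lr A <= t A)%N by rewrite /t; case: ifP.
have out A e : A \subset F -> e \notin F -> lr (e |: A) = (lr A).+1.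
  move=> sA eF; have /andP[h1 h2] := rhoS lrR A e.
  apply/eqP; rewrite eqn_leq h2 ltn_neqAle h1 andbT eq_sym; apply: contra eF => h.
  by apply: (subsetP (inF _ sA)); rewrite inE.
have tout A e : e \notin F -> t (e |: A) = lr (e |: A).
  by move=> eF; rewrite /t subUset sub1set (negPf eF).
have lrle A : A \subset F -> (lr A <= lr F)%N by apply: rho_mono.
have hS A e : (rho A <= rho (e |: A) <= (rho A).+1)%N.
  have [sA|sA] := boolP (A \subset F); last first.
    have E (C : {set edge n}) : A \subset C -> t C = lr C.
      by move=> sC; rewrite /t ifN //; apply: contra sA; apply: subset_trans.
    rewrite /rho !E ?subsetUr //; have := rhoS lrR A e.
    by move: (lr _) (lr _) (lr F); clear; lia.
  have [eF|eF] := boolP (e \in F).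
    rewrite /rho /t sA subUset sub1set eF sA /=; have := rhoS rgR A e.
    by move: (rg _) (rg _) (lr F); clear; lia.
  rewrite /rho tout // out // /t sA; have := rg_ge A; have := rg_low A sA; have := lrle _ sA.
  by move: (rg A) (lr A) (lr F); clear; lia.
have rhoR : rank_function rho.
  split=> //; first by rewrite /rho /t sub0set (rho0 rgR) min0n.
  move=> A e f he hf; have [top|ntop] := eqVneq (rho A) (lr F).+1.
    have /andP[h1 _] := hS A f; have /andP[h2 _] := hS (f |: A) e.
    apply/eqP; rewrite eqn_leq (leq_trans h1 h2) andbT top; exact: geq_minr.
  have rt (C : {set edge n}) : rho C = rho A -> rho C = t C.
    move=> hC; move: ntop; rewrite -hC /rho /minn.
    by case: ltnP => // h; rewrite eqxx.
  have lows (C : {set edge n}) : rho C = rho A -> (t C < (lr F).+1)%N.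
    by move=> hC; move: ntop (rt C hC); rewrite -hC /rho /minn; case: ltnP => //; rewrite eqxx.
  have tA := rt _ (erefl _); have te := rt _ he; have tf := rt _ hf.
  have E0 : t (e |: (f |: A)) = t A -> rho (e |: (f |: A)) = rho A by rewrite /rho => ->.
  apply: E0; have [sA|sA] := boolP (A \subset F); last first.
    have E (C : {set edge n}) : A \subset C -> t C = lr C.
      by move=> sC; rewrite /t ifN //; apply: contra sA; apply: subset_trans.
    have E' : A \subset e |: (f |: A) by apply: subset_trans (subsetUr _ _) (subsetUr _ _).
    rewrite !E //; apply: (rhoP lrR).
      by rewrite -(E A) // -(E (e |: A)) ?subsetUr // -te he.
    by rewrite -(E A) // -(E (f |: A)) ?subsetUr // -tf hf.
  have eqF u : rho (u |: A) = rho A -> u \in F.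
    move=> hu; apply/negPn/negP => uF; have := rt _ hu; rewrite hu tA tout // out // => hl.
    have l1 := lows A (erefl _); have := lrle _ sA; rewrite leq_eqVlt => /orP[/eqP h|h].
      by move: l1; rewrite hl h ltnn.
    by move: hl; rewrite /t sA rg_low // => /eqP; rewrite -[X in X == _]addn0 -addn1 eqn_add2l.
  have eF := eqF _ he; have fF := eqF _ hf.
  have tin (C : {set edge n}) : C \subset F -> t C = rg C by move=> h; rewrite /t h.
  have seA : e |: A \subset F by rewrite subUset sub1set eF.
  have sfA : f |: A \subset F by rewrite subUset sub1set fF.
  rewrite !tin //; last by rewrite subUset sub1set eF.
  apply: (rhoP rgR).
    by rewrite -(tin A) // -(tin (e |: A)) // -te he.
  by rewrite -(tin A) // -(tin (f |: A)) // -tf hf.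
have rho5 : K5closed rho.
  move=> i j k l m' u5 A HA; have h5 := lr5 u5 HA.
  have [sA|sA] := boolP (A \subset F); last first.
    have E (C : {set edge n}) : A \subset C -> t C = lr C.
      by move=> sC; rewrite /t ifN //; apply: contra sA; apply: subset_trans.
    by rewrite /rho !E ?subsetUr // h5.
  have ijF : Ed i j \subset F by apply: subset_trans (inF _ sA); rewrite cloP //; apply/eqP.
  rewrite /rho /t sA subUset ijF sA /=; congr minn.
  pose U : {set 'I_n} := [set w in [:: i; j; k; l; m']].
  have U5 : #|U| = 5%N by rewrite cardsE; have /card_uniqP -> := u5.
  pose B := KW U :&: A.
  have HB a b : a \in [:: i; j; k; l; m'] -> b \in [:: i; j; k; l; m'] ->
      ~~ is_pair i j a b -> Ed a b \subset B.
    by move=> ha hb hab; rewrite subsetI HA // Ed_KW // inE.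
  have hU : KW U \subset Ed i j :|: B.
    apply: sub_adjF => a b; rewrite adjF_KW adjFU !in_set !adjF_sub => /and3P[ab ha hb].
    rewrite ab /=; have [/orP[]|h] := boolP (is_pair i j a b); last by rewrite HB ?orbT.
      by move=> /andP[/eqP -> /eqP ->]; rewrite subxx.
    by move=> /andP[/eqP -> /eqP ->]; rewrite EdC subxx.
  have sU : KW U \subset F.
    by apply: subset_trans hU _; rewrite subUset ijF /= (subset_trans (subsetIr _ _)).
  have eU : Ed i j :|: B = KW U.
    by apply/eqP; rewrite eqEsubset hU subUset subsetIl Ed_KW // !inE eqxx ?orbT.
  (* The stresses of this K_5 belong to the space factored out, so the lift agrees with the cofactor
     rank there and its edge [ij] stays spanned by the other nine. *)
  have rU : rg (KW U) = lr (KW U).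
    apply: quo_eq (K5sum_ker F) _ _.
    by rewrite /K5sum; apply: (sumv_sup U); rewrite ?U5.
  have rB : rg (Ed i j :|: B) = rg B.
    apply/eqP; rewrite eqn_leq [(rg B <= _)%N]rho_mono ?subsetUr // andbT eU rU.
    by apply: leq_trans (rg_ge B); rewrite -eU (lr5 u5 HB).
  have : Ed i j \subset clo rg B by rewrite cloP // rB.
  move=> h; have : Ed i j \subset clo rg A.
    by apply: subset_trans h _; apply: cloS rgR _ _ _; apply: subsetIr.
  by rewrite cloP // => /eqP.
have [B [sB iB rB]] := rho_basis rhoR F.
have EF : rho F = (lr F).+1 by rewrite /rho /t subxx; apply/minn_idPr.
have sT : B \subset KW [set: 'I_n] by apply/subsetP => e _; rewrite in_KW !inE.
(* A basis of [F] for the lift has [lr F + 1] edges and must be cofactor-independent, which is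
   impossible inside [F]. *)
have := K5_maximal gen rhoR rho5 sT iB; rewrite -iB rB EF => h.
by have := lrle _ sB; rewrite /lr h ltnn.
Qed.
End StressK5.

(** * Large cliques of a flat and nullity *)

Section Cliques.
Variable n : nat.
Implicit Types (i j k l m a b u v w : 'I_n) (X Y Z U W : {set 'I_n}) (A B F : {set edge n}).

Lemma KW_subP X F : reflect (forall u v, u \in X -> v \in X -> u != v -> adjF F u v) (KW X \subset F).
Proof.
apply: (iffP idP) => [h u v uX vX uv|h].
  by apply: (adjFS h); rewrite adjF_KW uv uX.
by apply: sub_adjF => u v; rewrite adjF_KW => /and3P[uv uX vX]; apply: h.
Qed.

Lemma in_VF F u : (u \in VF F) = [exists w, adjF F u w].
Proof.
rewrite inE; apply/idP/existsP => [/exists_inP[e eF h]|[w /adjFP[e eF]]].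
  case/orP: h => /eqP h; [exists (val e).2 | exists (val e).1; rewrite adjFC];
  by rewrite -h adjF_val.
by rewrite inE => h; apply/exists_inP; exists e => //; case/orP: h => /eqP ->; rewrite eqxx ?orbT.
Qed.

Lemma KW_VF X F : (2 <= #|X|)%N -> KW X \subset F -> X \subset VF F.
Proof.
move=> X2 /KW_subP h; apply/subsetP => u uX; rewrite in_VF.
have /card_gt0P[w] : (0 < #|X :\ u|)%N by move: X2; rewrite (cardsD1 u X) uX.
by rewrite !inE => /andP[wu wX]; apply/existsP; exists w; apply: h; rewrite // eq_sym.
Qed.

Lemma is_cliqueE F X : (2 <= #|X|)%N -> is_clique F X = (KW X \subset F).
Proof.
move=> X2; apply/andP/idP => [[_ /forall_inP h]|h].
  by apply/KW_subP => u v uX vX uv; apply: (implyP (forall_inP (h u uX) v vX)).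
split; first exact: KW_VF.
apply/forall_inP => u uX; apply/forall_inP => v vX; apply/implyP => uv.
exact: (KW_subP _ _ h).
Qed.

(** For sets with at least two vertices the condition on [VF F] follows from adjacency, so being a
    clique reduces to an inclusion of edge sets. *)
Lemma XstarP F X : reflect
  [/\ (5 <= #|X|)%N, KW X \subset F & forall Y, KW Y \subset F -> X \subset Y -> Y = X]
  (X \in Xstar F).
Proof.
rewrite inE; apply: (iffP andP) => [[/andP[cX /forallP mX] X5]|[X5 sX mX]].
  have X2 : (2 <= #|X|)%N by apply: leq_trans X5.
  split=> //; first by rewrite -is_cliqueE.
  move=> Y sY XY; have Y2 : (2 <= #|Y|)%N by apply: leq_trans X2 (subset_leq_card XY).
  by have /implyP/(_ _)/eqP -> := mX Y; rewrite // is_cliqueE // sY.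
have X2 : (2 <= #|X|)%N by apply: leq_trans X5.
split=> //; rewrite /is_maxclique is_cliqueE // sX /=; apply/forallP => Y.
apply/implyP => /andP[cY XY]; have Y2 := leq_trans X2 (subset_leq_card XY).
by rewrite is_cliqueE // in cY; rewrite (mX Y).
Qed.

Lemma Xstar_ext F Y : (5 <= #|Y|)%N -> KW Y \subset F -> exists2 X, X \in Xstar F & Y \subset X.
Proof.
move=> Y5 sY; pose P := fun X : {set 'I_n} => (KW X \subset F).
have [X mX YX] := @maxset_exists _ P Y sY; exists X => //.
have [pX mX'] := maxsetP mX.
by apply/XstarP; split=> //; apply: leq_trans Y5 (subset_leq_card YX).
Qed.

Lemma card_KW X : #|KW X : {set edge n}| = 'C(#|X|, 2).
Proof.
apply/eqP; rewrite -(eqn_pmul2l (_ : 0 < 2)%N) // -(sum_nb (subxx (KW X))).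
rewrite -[2%N]/(2`!) mulnC bin_ffact ffactnS ffactn1 -sum_nat_const.
apply/eqP/eq_bigr => u uX; have -> : nb (KW X) u = X :\ u.
  by apply/setP => w; rewrite in_nb adjF_KW uX !inE eq_sym.
by rewrite (cardsD1 u X) uX.
Qed.

Lemma KW_sub2 X W : (2 <= #|X|)%N -> KW X \subset KW W -> X \subset W.
Proof.
move=> X2 h; apply: subset_trans (KW_VF X2 h) _; apply/subsetP => u; rewrite in_VF.
by case/existsP => w; rewrite adjF_KW => /and3P[].
Qed.
End Cliques.

Section Flats.
Variables (R : realType) (n : nat) (x y : 'I_n -> R).
Hypothesis gen : generic x y.
Let p : 'I_n -> R * R := fun i => (x i, y i).
Implicit Types (i j k l m a b u v w : 'I_n) (X Y Z U W : {set 'I_n}) (A B F : {set edge n}).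

Let gp : general p := generic_general gen.
Let lr := lrank (rwe p).
Let lrR : rank_function lr := lrank_rank (rwe p).
Let lr5 : K5closed lr := lrank_K5closed gp.
Local Notation St := (stress (rwe p)).
Local Notation flat F := (clo lr F \subset F).

(** For [u] in [X] only and [v] in [Y] only, the K_5 on [u], [v] and three common vertices has all
    its edges except [uv] in the two cliques. *)
Lemma flat_merge F X Y : flat F -> KW X \subset F -> KW Y \subset F ->
  (3 <= #|X :&: Y|)%N -> KW (X :|: Y) \subset F.
Proof.
move=> fF sX sY c3.
have [a [b [c [u3 sI]]]] := exists_uniq3 c3.
have cross u v : u \in X -> u \notin Y -> v \in Y -> v \notin X -> adjF F u v.
  move=> uX uY vY vX; have uv : u != v by apply: contraNneq vX => <-.
  rewrite adjF_sub uv /=; apply: subset_trans fF.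
  have u5 : uniq [:: u; v; a; b; c].
    rewrite (cons_uniq u) (cons_uniq v) u3 andbT in_cons negb_or uv /=; apply/andP; split.
      by apply: contra uY => /sI; rewrite inE => /andP[].
    by apply: contra vX => /sI; rewrite inE => /andP[].
  have sIX z : z \in [:: a; b; c] -> z \in X by move/sI; rewrite inE => /andP[].
  have sIY z : z \in [:: a; b; c] -> z \in Y by move/sI; rewrite inE => /andP[].
  apply: (K5_clo lrR lr5 u5) => k l hk hl nkl; apply: subset_trans (sub_clo lr F).
  have inX z : z \in [:: u; v; a; b; c] -> z != v -> z \in X.
    by rewrite (in_cons u) (in_cons v) => /orP[/eqP -> //|/orP[-> //|/sIX]].
  have inY z : z \in [:: u; v; a; b; c] -> z != u -> z \in Y.
    by rewrite (in_cons u) (in_cons v) => /orP[-> //|/orP[/eqP -> //|/sIY]].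
  have [kv|kv] := eqVneq k v.
    have [lu|lu] := eqVneq l u; first by move: nkl; rewrite /is_pair kv lu !eqxx orbT.
    by apply: subset_trans (Ed_KW (inY _ hk _) (inY _ hl lu)) sY; rewrite kv eq_sym.
  have [lv|lv] := eqVneq l v.
    have [ku|ku] := eqVneq k u; first by move: nkl; rewrite /is_pair ku lv !eqxx.
    by apply: subset_trans (Ed_KW (inY _ hk ku) (inY _ hl _)) sY; rewrite lv eq_sym.
  exact: subset_trans (Ed_KW (inX _ hk kv) (inX _ hl lv)) sX.
have hX := KW_subP _ _ sX; have hY := KW_subP _ _ sY.
apply/KW_subP => u v; rewrite !inE.
have [uX|uX] := boolP (u \in X); have [vX|vX] := boolP (v \in X) => //=.
- by move=> _ _; apply: hX.
- by have [uY|uY] := boolP (u \in Y) => _ vY uv; [apply: hY | apply: cross].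
- have [vY|vY] := boolP (v \in Y) => uY _ uv; first exact: hY.
  by rewrite adjFC; apply: cross.
- by move=> uY vY; apply: hY.
Qed.

Lemma Xstar_thin F X Y : flat F -> X \in Xstar F -> Y \in Xstar F -> (3 <= #|X :&: Y|)%N -> X = Y.
Proof.
move=> fF /XstarP[X5 sX mX] /XstarP[Y5 sY mY] c3.
have h := flat_merge fF sX sY c3.
by rewrite -(mX _ h (subsetUl _ _)) -{2}(mY _ h (subsetUr _ _)).
Qed.

(** With three neighbours in [X], the vertex and these neighbours form a clique that merges with
    [X], against maximality. *)
Lemma Xstar_nb F X u : flat F -> X \in Xstar F -> u \notin X -> (#|nb F u :&: X| <= 2)%N.
Proof.
move=> fF /XstarP[X5 sX mX] uX; rewrite leqNgt; apply/negP => c3.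
have sY : KW (u |: (nb F u :&: X)) \subset F.
  apply/KW_subP => a b; rewrite !inE => /orP[/eqP ->|/andP[ua aX]] /orP[/eqP ->|/andP[ub bX]].
  - by rewrite eqxx.
  - by move=> _; exact: ub.
  - by move=> _; rewrite adjFC; exact: ua.
  - exact: (KW_subP _ _ sX).
have c3' : (3 <= #|X :&: (u |: (nb F u :&: X))|)%N.
  apply: leq_trans c3 (subset_leq_card _); rewrite subsetI subsetIr /=; exact: subsetUr.
have h := flat_merge fF sX sY c3'.
by move: uX; rewrite -(mX _ h (subsetUl _ _)) !inE eqxx /= orbT.
Qed.

Lemma flat_KW W : flat (KW W).
Proof.
apply/subsetP => e; rewrite inE in_KW => /eqP h; apply/negPn/negP; rewrite negb_and.
have en := edge_neq e; rewrite -(Ed_val e) in h.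
case/orP => hW.
  by have := lrank_pend gp (subxx (KW W)) hW en; rewrite -/lr h => /eqP; rewrite -[X in X == _]addn0 -addn1 eqn_add2l.
rewrite EdC in h; rewrite eq_sym in en.
by have := lrank_pend gp (subxx (KW W)) hW en; rewrite -/lr h => /eqP; rewrite -[X in X == _]addn0 -addn1 eqn_add2l.
Qed.

Lemma flatI A B : flat A -> flat B -> flat (A :&: B).
Proof.
move=> fA fB; rewrite subsetI; apply/andP; split.
  by apply: subset_trans fA; apply: cloS lrR _ _ (subsetIl _ _).
by apply: subset_trans fB; apply: cloS lrR _ _ (subsetIr _ _).
Qed.

Lemma flat_restr F W : flat F -> flat (F :&: KW W).
Proof. by move=> fF; apply: flatI => //; apply: flat_KW. Qed.

(** A trace with five vertices determines its clique, because distinct members of [Xstar F] share at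
    most two vertices. *)
Lemma Xstar_restrP F W Y : flat F -> reflect
  (exists2 X, X \in Xstar F & (5 <= #|X :&: W|)%N /\ Y = X :&: W) (Y \in Xstar (F :&: KW W)).
Proof.
move=> fF.
have key Y' : Y' \in Xstar (F :&: KW W) -> exists2 X, X \in Xstar F & Y' = X :&: W.
  case/XstarP => Y5; rewrite subsetI => /andP[YF YW] mY.
  have [X XF YX] := Xstar_ext Y5 YF; exists X => //; apply/esym/mY.
    by rewrite subsetI KWI subsetIr andbT; have /XstarP[_ sX _] := XF; apply: subset_trans (subsetIl _ _) sX.
  by rewrite subsetI YX /=; apply: KW_sub2 YW; apply: leq_trans Y5.
apply: (iffP idP) => [hY|[X XF [X5 ->]]].
  by have [X XF E] := key _ hY; exists X => //; rewrite -E; split=> //; have /XstarP[] := hY.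
have [|Y' hY' sXY] := @Xstar_ext _ (F :&: KW W) _ X5.
  by rewrite subsetI KWI subsetIr andbT; have /XstarP[_ sX _] := XF; apply: subset_trans (subsetIl _ _) sX.
have [X' XF' E] := key _ hY'; suff -> : X = X' by rewrite -E.
apply: (Xstar_thin fF XF XF'); apply: leq_trans (leq_trans _ X5) (subset_leq_card _) => //.
by rewrite subsetI subsetIl /=; apply: subset_trans sXY _; rewrite E subsetIl.
Qed.

Lemma Xstar_restr_inj F W X X' : flat F -> X \in Xstar F -> X' \in Xstar F ->
  (5 <= #|X :&: W|)%N -> X :&: W = X' :&: W -> X = X'.
Proof.
move=> fF XF XF' X5 E; apply: (Xstar_thin fF XF XF').
apply: leq_trans (leq_trans _ X5) (subset_leq_card _) => //.
by rewrite subsetI subsetIl /= E subsetIl.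
Qed.

(** The nullity of K_r for r >= 3, since C(r,2) - (3r - 6) = C(r-3,2); truncated subtraction makes
    it zero for all smaller r as well. *)
Definition s2 (r : nat) : nat := 'C(r - 3, 2).

Lemma s2_bin (r : nat) : (3 <= r)%N -> ('C(r, 2) + 6 = s2 r + 3 * r)%N.
Proof.
case: r => [|[|[|r]]] // _; rewrite /s2 !subSS subn0 !binS !bin0 !bin1.
by move: 'C(r, 2); clear; lia.
Qed.

Lemma s2_low (r : nat) : (r < 5)%N -> s2 r = 0%N.
Proof. by case: r => [|[|[|[|[|]]]]]. Qed.

Lemma s2S (r : nat) : (4 <= r)%N -> s2 r = (s2 r.-1 + (r - 4))%N.
Proof. by case: r => [|[|[|[|r]]]] // _; rewrite /s2 !subSS !subn0 binS bin1 addnC. Qed.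

Lemma s2_double (r : nat) : (4 <= r)%N -> (2 * s2 r = (r - 3) * (r - 4))%N.
Proof.
case: r => [|[|[|[|r]]]] // _; rewrite /s2 !subSS !subn0.
by rewrite -[2%N]/(2`!) mulnC bin_ffact ffactnS ffactn1.
Qed.

Definition nul A := \dim (St A).

Lemma nulE A : (nul A + lr A = #|A|)%N.
Proof. exact: dim_stress. Qed.

Lemma nulS A B : A \subset B -> (nul A <= nul B)%N.
Proof. by move=> h; apply/dimvS/stressS. Qed.

Lemma nul_supmod A B : (nul A + nul B <= nul (A :|: B) + nul (A :&: B))%N.
Proof.
have := lrank_submod (rwe p) A B; rewrite -/lr.
have := cardsUI A B; rewrite -(nulE A) -(nulE B) -(nulE (A :|: B)) -(nulE (A :&: B)).
by move: (lr _) (lr _) (lr _) (lr _) (nul _) (nul _) (nul _) (nul _); clear; lia.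
Qed.

Lemma nul_KW X : (3 <= #|X|)%N -> nul (KW X) = s2 #|X|.
Proof.
move=> X3; have := nulE (KW X); have := lrank_KW_low gp X3; have := rho_KW lrR lr5 X3.
rewrite -/lr card_KW; have := s2_bin X3.
by move: (lr _) (nul _) #|X| 'C(_, _) (s2 _); clear; lia.
Qed.

Lemma nul_small X : (#|X| <= 4)%N -> nul (KW X) = 0%N.
Proof.
have [m] := ubnP #|X|; elim: m X => // m IH X ltXm X4.
have [X0|/set0Pn[v vX]] := eqVneq X set0.
  have := nulE (KW X); rewrite card_KW X0 cards0 bin0n /=.
  by move=> /eqP; rewrite addn_eq0 => /andP[/eqP].
have cX : #|X| = #|X :\ v|.+1 by rewrite (cardsD1 v X) vX add1n.
have E : del (KW X) v = KW (X :\ v).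
  by rewrite /del -KWI; congr KW; apply/setP => u; rewrite !inE andbC.
have Nv : nb (KW X) v = X :\ v.
  by apply/setP => w; rewrite in_nb adjF_KW vX !inE eq_sym.
have {}IH : nul (KW (X :\ v)) = 0%N by apply: IH; [move: ltXm; rewrite cX | move: X4; rewrite cX => /ltnW].
have low := star_low gp (S_del_offu p (KW X) v) (nbii (KW X) v).
have e1 : \dim (S p (KW X)) = lr (KW X) by [].
have e2 : \dim (S p (del (KW X) v)) = lr (KW (X :\ v)) by rewrite E.
rewrite -S_del e1 e2 Nv in low.
have c1 := nulE (KW X); have c2 := nulE (KW (X :\ v)).
rewrite (card_del _ v) E -c2 IH Nv in c1; rewrite cX in X4.
by move: X4 low c1; move: #|X :\ v| (lr _) (lr _) (nul _); clear; lia.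
Qed.

(** Each K_5 in [F] lies in a member of [Xstar F], so by [flat_stress] the stress spaces of these
    cliques together contain all stresses of [F]. *)
Lemma nul_upper F : flat F -> (nul F <= \sum_(X in Xstar F) s2 #|X|)%N.
Proof.
move=> fF; apply: leq_trans (_ : \dim (\sum_(X in Xstar F) St (KW X))%VS <= _)%N.
  apply: dimvS; apply: subv_trans (flat_stress gen fF) _; apply/subv_sumP => U /andP[/eqP U5 sU].
  have [|X XF sUX] := Xstar_ext _ sU; first by rewrite U5.
  by apply: (sumv_sup X) => //; apply: stressS; apply: KWS.
apply: leq_trans (dimv_leq_sum _ _ _) _; apply: leq_sum => X /XstarP[X5 _ _].
by rewrite -nul_KW // (leq_trans _ X5).
Qed.

(** Traces with fewer than five vertices are not members of the restricted family, but they
    contribute zero on the right. *)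
Lemma sum_restr F W : flat F ->
  (\sum_(Y in Xstar (F :&: KW W)) s2 #|Y| = \sum_(X in Xstar F) s2 #|X :&: W|)%N.
Proof.
move=> fF; rewrite [RHS](bigID (fun X : {set 'I_n} => (5 <= #|X :&: W|)%N)) /= [X in (_ + X)%N]big1; last first.
  by move=> X /andP[_]; rewrite -ltnNge; apply: s2_low.
rewrite addn0 -(big_imset (fun Y => s2 #|Y|) (h := fun X => X :&: W)
  (A := [pred X | (X \in Xstar F) && (5 <= #|X :&: W|)%N])) /=.
  apply: eq_bigl => Y; apply/Xstar_restrP/imsetP => // [[X XF [X5 E]]|[X /andP[XF X5] E]].
    by exists X; rewrite // inE XF X5.
  by exists X.
by move=> X X'; rewrite -!topredE /= => /andP[XF X5] /andP[XF' _]; apply: (Xstar_restr_inj fF).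
Qed.
End Flats.

Lemma par_trans (K : fieldType) (vT : vectType K) (W : {vspace vT}) u v w :
  v \notin W -> par W u v -> par W v w -> par W u w.
Proof.
move=> vW; rewrite parC => /parP[h|/memv_addlineP[c h _]]; first by rewrite h in vW.
move=> /parP[h'|/memv_addlineP[c' h' _]]; first by rewrite h' in vW.
have [c0|c0] := eqVneq c 0.
  by apply/parP; left; rewrite c0 scale0r subr0 in h.
apply/parP; right; apply/memv_addlineP; exists (c' / c) => //.
have -> : w - (c' / c) *: u = (w - c' *: v) - (c' / c) *: (u - c *: v).
  by rewrite scalerBr scalerA mulfVK // opprB addrA addrNK.
by rewrite memvB // memvZ.
Qed.

(** * Rank drop at a vertex in two large cliques *)

Section TwoCliques.
Variables (R : realType) (n : nat) (x y : 'I_n -> R).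
Hypothesis gen : generic x y.
Let p : 'I_n -> R * R := fun i => (x i, y i).
Implicit Types (i j k l m a b u v w : 'I_n) (X Y Z U W : {set 'I_n}) (A B F : {set edge n}).

Let gp : general p := generic_general gen.
Let lr := lrank (rwe p).
Let lrR : rank_function lr := lrank_rank (rwe p).
Local Notation flat F := (clo lr F \subset F).

Lemma flat_mem F i j : flat F -> i != j -> rw p i j \in S p F -> adjF F i j.
Proof.
move=> fF ij h; rewrite adjF_sub ij /=; apply: subset_trans fF; rewrite cloP //.
by rewrite /lr /lrank -/(S p _) S_EdU (addv_idPl _) // -memvE.
Qed.

(** If the star of [v] added at most four dimensions, the special positions would make the rows
    between [X] and [Y] parallel modulo [W]. One such row, of a nonedge, would then enter the span
    of the flat [F]. *)
Lemma two_cliques_deg F X Y v : flat F -> X \in Xstar F -> Y \in Xstar F -> X != Y ->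
  v \in X -> v \in Y -> (lr (del F v) + 5 <= lr F)%N.
Proof.
move=> fF XF YF XY vX vY; rewrite leqNgt addnS ltnS; apply/negP => bad.
have fF' : flat (del F v) by apply: flat_restr.
have XYI : (#|X :&: Y| <= 2)%N.
  by rewrite leqNgt; apply: contra XY => h; apply/eqP; apply: (Xstar_thin gen fF XF YF h).
have /XstarP[X5 sX mX] := XF; have /XstarP[Y5 sY mY] := YF.
have adX a b : a \in X -> b \in X -> a != b -> adjF F a b by apply: KW_subP.
have adY a b : a \in Y -> b \in Y -> a != b -> adjF F a b by apply: KW_subP.
have [i1 [i2 [i3 [ui sI]]]] : exists a b c, uniq [:: a; b; c] /\ {subset [:: a; b; c] <= X :\: Y}.
  by apply: exists_uniq3; move: (cardsID Y X) X5 XYI; move: #|_| #|_| #|_|; clear; lia.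
have [j1 [j2 [j3 [uj sJ]]]] : exists a b c, uniq [:: a; b; c] /\ {subset [:: a; b; c] <= Y :\: X}.
  by apply: exists_uniq3; move: (cardsID X Y) Y5 XYI; rewrite setIC; move: #|_| #|_| #|_|; clear; lia.
set I := [:: i1; i2; i3] in ui sI; set J := [:: j1; j2; j3] in uj sJ.
have inI a : a \in I -> [/\ a \in X, a \notin Y & v != a].
  move/sI; rewrite inE => /andP[aY aX]; split=> //.
  by apply: contraNneq aY => <-.
have inJ a : a \in J -> [/\ a \in Y, a \notin X & v != a].
  move/sJ; rewrite inE => /andP[aX aY]; split=> //.
  by apply: contraNneq aX => <-.
have IJ a b : a \in I -> b \in J -> a != b.
  by move=> /inI[_ aY _] /inJ[bY _ _]; apply: contraNneq aY => ->.
have adI a b b' : a \in I -> b \in J -> b' \in J -> b != b' -> adjF F a b -> adjF F a b' -> False.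
  move=> /inI[aX aY va] /inJ[bY bX vb] /inJ[b'Y b'X vb'] bb' h h'.
  have := Xstar_nb gen fF YF aY; apply/negP; rewrite -ltnNge.
  have u3 : uniq [:: v; b; b'] by rewrite /= !inE negb_or vb vb' bb'.
  apply: leq_trans (_ : #|[set z in [:: v; b; b']]| <= _)%N.
    by rewrite cardsE; have /card_uniqP -> := u3.
  apply/subset_leq_card/subsetP => z; rewrite !inE => /or3P[] /eqP ->.
  - by rewrite vY andbT adX // eq_sym.
  - by rewrite bY h.
  - by rewrite b'Y h'.
have adJ a a' b : a \in I -> a' \in I -> b \in J -> a != a' -> adjF F a b -> adjF F a' b -> False.
  move=> /inI[aX aY va] /inI[a'X a'Y va'] /inJ[bY bX vb] aa' h h'.
  have := Xstar_nb gen fF XF bX; apply/negP; rewrite -ltnNge.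
  have u3 : uniq [:: v; a; a'] by rewrite /= !inE negb_or va va' aa'.
  apply: leq_trans (_ : #|[set z in [:: v; a; a']]| <= _)%N.
    by rewrite cardsE; have /card_uniqP -> := u3.
  apply/subset_leq_card/subsetP => z; rewrite !inE => /or3P[] /eqP ->.
  - by rewrite vX andbT adY // eq_sym.
  - by rewrite aX adjFC h.
  - by rewrite a'X adjFC h'.
set W := S p (del F v).
have sF : F \subset KW setT by apply/subsetP => e _; rewrite in_KW !inE.
have aW : adm x y v W.
  by apply: (adm_S gen (del_KW v sF)); rewrite !inE eqxx.
have vN := nbii F v; set N := nb F v in vN.
have hd : (\dim (W + starV p v N) <= \dim W + 4)%N.
  by move: bad; rewrite -/lr /lr /lrank -!/(S p _) (S_del p F v) addn4.
have sW' := aW.1.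
have H4 q : (\dim (W + starV (upd p v q) v N) <= \dim W + 4)%N.
  by apply: leq_trans (aW.2 N q vN) hd.
have IN a : a \in I -> a \in N by move=> /inI[aX aY va]; rewrite in_nb adX.
have JN a : a \in J -> a \in N by move=> /inJ[aX aY va]; rewrite in_nb adY.
have memW a b : a != b -> a != v -> b != v -> (rw p a b \in W) -> adjF F a b.
  by move=> ab av bv h; apply: adjFS (del_sub F v) _; apply: flat_mem.
have Wmem a b : adjF F a b -> a != v -> b != v -> rw p a b \in W.
  by move=> h av bv; apply: S_adj; rewrite adjF_del h av bv.
have LX a a' b b' : a \in I -> a' \in I -> b \in J -> b' \in J -> a != a' -> b != b' ->
    par W (rw p a b) (rw p a' b').
  move=> aI a'I bJ b'J aa' bb'.
  have [m [mN um]] : exists m, m \in N /\ m \notin [:: a; b; a'; b'].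
    have /subsetPn[m mI hm] : ~~ ([set z in I] \subset [set a; a']).
      apply/negP => /subset_leq_card; rewrite cardsE; have /card_uniqP -> := ui.
      by rewrite cards2 aa'.
    rewrite inE in mI; exists m; split; first exact: IN.
    move: hm; rewrite !inE !negb_or => /andP[-> ->].
    by rewrite (IJ _ _ mI bJ) (IJ _ _ mI b'J).
  apply: (LX_spec gp vN sW' H4 (m := m)).
    move: um; rewrite /= !inE !negb_or aa' bb' (IJ _ _ aI bJ) (IJ _ _ aI b'J) (IJ _ _ a'I b'J).
    by rewrite [b == a']eq_sym (IJ _ _ a'I bJ) => /and4P[h1 h2 h3 h4]; rewrite ![_ == m]eq_sym h1 h2 h3 h4.
  by move=> z; rewrite 4!in_cons mem_seq1 => /or4P[/eqP ->|/eqP ->|/eqP ->|/orP[] /eqP ->]; auto.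
have i1I : i1 \in I by rewrite inE eqxx.
have [i2I i3I] : i2 \in I /\ i3 \in I by rewrite !inE !eqxx !orbT.
(* Both rows are compared with a disjoint pair [i'], [c], chosen nonadjacent so that its row is
   nonzero modulo [W] and [par] becomes transitive through it. *)
have parJ b b' : b \in J -> b' \in J -> b != b' -> par W (rw p i1 b) (rw p i1 b').
  move=> bJ b'J bb'.
  have [c cJ [cb cb']] : exists2 c, c \in J & c != b /\ c != b'.
    have /subsetPn[m mI hm] : ~~ ([set z in J] \subset [set b; b']).
      apply/negP => /subset_leq_card; rewrite cardsE; have /card_uniqP -> := uj.
      by rewrite cards2 bb'.
    rewrite inE in mI; exists m => //; move: hm; rewrite !inE !negb_or => /andP[-> ->] //.
  have [i' i'I [i1i' nad]] : exists2 i', i' \in I & i1 != i' /\ ~~ adjF F i' c.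
    move: ui; rewrite /= !inE !negb_or => /andP[/andP[i12 i13] /andP[i23 _]].
    have [h|h] := boolP (adjF F i2 c); last by exists i2.
    exists i3 => //; split=> //; apply/negP => h'; exact: adJ i2I i3I cJ i23 h h'.
  have [_ _ vi'] := inI _ i'I; have [_ _ vc] := inJ _ cJ.
  apply: par_trans (LX _ _ _ _ i1I i'I bJ cJ i1i' _) (LX _ _ _ _ i'I i1I cJ b'J _ _) => //.
  - by apply: contra nad; apply: memW; [apply: IJ | rewrite eq_sym | rewrite eq_sym].
  - by rewrite eq_sym.
  - by rewrite eq_sym.
have [X1 Y1 v1] := inI _ i1I.
have [b [bJ nb1]] : exists b, b \in J /\ ~~ adjF F i1 b.
  have [h|h] := boolP (adjF F i1 j1); last by exists j1; rewrite inE eqxx.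
  exists j2; rewrite !inE eqxx orbT; split=> //; apply/negP => h'.
  apply: (adI i1 j1 j2) => //; rewrite ?inE ?eqxx ?orbT //.
  by move: uj; rewrite /= !inE negb_or => /andP[/andP[]].
have [_ bX vb] := inJ _ bJ.
have i1b := IJ _ _ i1I bJ.
have zW : rw p i1 b \notin W by apply: contra nb1; apply: memW => //; rewrite eq_sym.
set z := rw p i1 b in zW.
have i1J c : c \in J -> rw p i1 c \in (W + <[z]>)%VS.
  move=> cJ; have [->|cb] := eqVneq c b; first exact: memv_addline.
  have bc : b != c by rewrite eq_sym.
  have /parP[h|//] := parJ _ _ bJ cJ bc.
  by rewrite h in zW.
pose N4 := [set w in [:: i1; j1; j2; j3]].
have u4 : uniq (i1 :: J) by rewrite cons_uniq uj andbT; apply/negP => /(IJ _ _ i1I); rewrite eqxx.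
have N44 : #|N4| = 4%N by rewrite cardsE; have /card_uniqP -> := u4.
have N4N : N4 \subset N.
  by apply/subsetP => w; rewrite inE in_cons => /orP[/eqP ->|]; [apply: IN | apply: JN].
have vN4 : v \notin N4 by apply: contra vN; apply: (subsetP N4N).
have iN4 : i1 \in N4 by rewrite !inE eqxx.
have JN4 c : c \in J -> c \in N4 by move=> cJ; rewrite inE in_cons cJ orbT.
have sst : (starV p v N4 <= starV p v N)%VS by apply: starV_sub.
have SF : S p F = (W + starV p v N)%VS := S_del p F v.
(* Otherwise [adm_L0] would put the row [z] of a nonedge in [W]. *)
have lo : (\dim W + 4 <= \dim (W + starV p v N4))%N.
  rewrite leqNgt addnS ltnS; apply/negP => h; case/negP: zW.
  by apply: (adm_L0 gen aW vN4 _ h) => //; [rewrite N44 | apply: JN4].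
(* Modulo [W] and [z] all edges among [i1], [j1], [j2], [j3] are spanned, so the K_5 with [v] makes
   the fourth star edge redundant. Together with [lo] this puts [z] in the span of [W] and the
   star. *)
have hi : (\dim (W + <[z]> + starV p v N4) <= \dim W + 4)%N.
  set U := (W + <[z]> + <[rw p v j1]> + <[rw p v j2]> + <[rw p v j3]>)%VS.
  have dU : (\dim U <= \dim W + 4)%N.
    rewrite /U !dim_addv1 -!addnA leq_add2l.
    by case: (_ \notin _); case: (_ \notin _); case: (_ \notin _); case: (_ \notin _).
  have vJU c : c \in J -> rw p v c \in U.
    rewrite !inE => /or3P[] /eqP ->; rewrite /U ?memv_addline // memv_addl ?memv_addline //.
    by rewrite memv_addl ?memv_addline.
  have WU : (W + <[z]> <= U)%VS by rewrite /U -!addvA addvA addvSl.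
  have i1U c : c \in J -> rw p i1 c \in U by move=> cJ; apply: (subvP WU); apply: i1J.
  have JJU c c' : c \in J -> c' \in J -> rw p c c' \in U.
    move=> cJ c'J; have [->|cc'] := eqVneq c c'; first by rewrite rwii mem0v.
    have [cY _ vc] := inJ _ cJ; have [c'Y _ vc'] := inJ _ c'J.
    by apply: (subvP WU); rewrite memv_addl // Wmem ?adY // eq_sym.
  have u5 : uniq (v :: i1 :: J).
    rewrite cons_uniq u4 andbT in_cons negb_or v1; apply/negP => /inJ[_ _]; by rewrite eqxx.
  have vi1 : rw p v i1 \in U.
    apply: (K5_cl u5 (general_brne gp) (perm_refl _)) => k l.
    rewrite (in_cons v) (in_cons i1) => hk; rewrite (in_cons v) (in_cons i1) => hl hn.
    case/or3P: hk => [/eqP Ek|/eqP Ek|hk]; case/or3P: hl => [/eqP El|/eqP El|hl]; move: hn; subst.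
    - by rewrite rwii mem0v.
    - by rewrite !eqxx.
    - by move=> _; apply: vJU.
    - by rewrite !eqxx orbT.
    - by rewrite rwii mem0v.
    - by move=> _; apply: i1U.
    - by move=> _; rewrite rwC memvN vJU.
    - by move=> _; rewrite rwC memvN i1U.
    - by move=> _; apply: JJU.
  apply: leq_trans dU; apply: dimvS; rewrite subv_add WU /=; apply/subv_sumP => w.
  by rewrite inE in_cons -memvE => /orP[/eqP -> //|]; apply: vJU.
have zS : z \in S p F.
  have E : (W + starV p v N4 == W + <[z]> + starV p v N4)%VS.
    rewrite eqEdim (leq_trans hi lo) andbT; apply: addvS => //; exact: addvSl.
  rewrite SF; apply: (subvP (addvS (subvv W) sst)); rewrite (eqP E).
  by rewrite memv_addl ?memv_addline.
by case/negP: nb1; apply: flat_mem.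
Qed.
End TwoCliques.

(** * Shellability and the nullity formula *)

Section Degenerate.
Variable n : nat.
Implicit Types (X Y : {set 'I_n}) (Xs Ys : {set {set 'I_n}}).

(* Hereditary form of 4-shellability. *)
Definition degen Xs := forall Ys, Ys \subset Xs -> Ys != set0 ->
  exists2 X, X \in Ys & (#|X :&: \bigcup_(Y in Ys :\ X) Y| <= 4)%N.

Lemma degenS Xs Ys : Ys \subset Xs -> degen Xs -> degen Ys.
Proof. by move=> sY h Zs sZ; apply: h; apply: subset_trans sZ sY. Qed.

Lemma degen_ind (P : {set {set 'I_n}} -> Prop) : P set0 ->
  (forall Xs X, X \in Xs -> (#|X :&: \bigcup_(Y in Xs :\ X) Y| <= 4)%N -> P (Xs :\ X) -> P Xs) ->
  forall Xs, degen Xs -> P Xs.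
Proof.
move=> P0 PS Xs; have [m] := ubnP #|Xs|; elim: m Xs => // m IH Xs ltX dX.
have [->|X0] := eqVneq Xs set0; first exact: P0.
have [X XX X4] := dX _ (subxx _) X0; apply: (PS _ X) => //; apply: IH.
  by move: ltX; rewrite (cardsD1 X Xs) XX.
by apply: degenS dX; apply: subsetDl.
Qed.

(** A member meeting the union of the others in at most four vertices is placed last. *)
Lemma degen_shellable Xs : degen Xs -> four_shellable Xs.
Proof.
elim/degen_ind: Xs /; first by exists [::]; split=> //; split=> [X|i]; rewrite ?inE //= andbF.
move=> Xs X XX X4 [s [us [sE sS]]]; exists (rcons s X); split.
  by rewrite rcons_uniq us andbT sE !inE eqxx.
split=> [Y|i]; first by rewrite mem_rcons inE sE !inE; case: eqP => [->|].
rewrite size_rcons ltnS => /andP[i0 il].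
have E j : (j < size s)%N -> nth set0 (rcons s X) j = nth set0 s j by move=> h; rewrite nth_rcons h.
move: il; rewrite leq_eqVlt => /orP[/eqP il|il]; last first.
  have := sS i; rewrite i0 il E // => /(_ isT); apply: leq_trans; apply/subset_leq_card/setIS.
  by apply/bigcupsP => j _; rewrite E ?(ltn_trans (ltn_ord j)) // (bigcup_sup j).
rewrite il nth_rcons ltnn eqxx; apply: leq_trans X4; apply/subset_leq_card/setIS.
apply/bigcupsP => j _; rewrite E //; apply: bigcup_sup; rewrite -sE; exact: mem_nth.
Qed.
End Degenerate.

Section Shellability.
Variables (R : realType) (n : nat) (x y : 'I_n -> R).
Hypothesis gen : generic x y.
Let p : 'I_n -> R * R := fun i => (x i, y i).
Implicit Types (i j k l m a b u v w : 'I_n) (X Y Z U W : {set 'I_n}) (A B F : {set edge n}).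

Let gp : general p := generic_general gen.
Let lr := lrank (rwe p).
Let lrR : rank_function lr := lrank_rank (rwe p).
Let lr5 : K5closed lr := lrank_K5closed gp.
Local Notation flat F := (clo lr F \subset F).
Local Notation nul := (nul x y).

(** Removing a clique that meets the rest in at most four vertices, supermodularity adds the
    nullities: the shared edges lie in a complete graph on at most four vertices, which has no
    stress. *)
Lemma degen_nul Xs : degen Xs -> (forall X, X \in Xs -> (3 <= #|X|)%N) ->
  (\sum_(X in Xs) s2 #|X| <= nul (\bigcup_(X in Xs) KW X))%N.
Proof.
elim/degen_ind: Xs / => [_|Xs X XX X4 IH X3]; first by rewrite !big_set0.
have {}IH : (\sum_(Y in Xs :\ X) s2 #|Y| <= nul (\bigcup_(Y in Xs :\ X) KW Y))%N.
  by apply: IH => Y /setD1P[_ /X3].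
rewrite (big_setD1 X XX) /= (big_setD1 X XX (F := fun X => KW X)) /=.
have h := nul_supmod x y (KW X) (\bigcup_(Y in Xs :\ X) KW Y).
have I0 : nul (KW X :&: \bigcup_(Y in Xs :\ X) KW Y) = 0%N.
  apply/eqP; rewrite -leqn0 -(nul_small gen X4) KWI; apply: nulS; apply: setIS.
  by apply/bigcupsP => Y hY; apply: KWS; apply: bigcup_sup hY.
by rewrite I0 addn0 in h; apply: leq_trans h; rewrite nul_KW ?X3 // leq_add2l.
Qed.

Lemma degen_nulE F : flat F -> degen (Xstar F) -> nul F = (\sum_(X in Xstar F) s2 #|X|)%N.
Proof.
move=> fF dF; apply/eqP; rewrite eqn_leq nul_upper //=.
apply: leq_trans (degen_nul dF _) (nulS _ _ _).
  by move=> X /XstarP[X5 _ _]; apply: leq_trans X5.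
by apply/bigcupsP => X /XstarP[].
Qed.

Lemma restr_proper F W u w : adjF F u w -> u \notin W -> (#|F :&: KW W| < #|F|)%N.
Proof.
move=> h uW; apply: proper_card; rewrite properE subsetIl /=; apply/negP => hs.
by have := adjFS hs h; rewrite adjFI adjF_KW (negPf uW) /= !andbF.
Qed.

Lemma sum_cliques F W : (forall X, X \in Xstar F -> X \subset W) -> forall f : nat -> nat,
  (\sum_(v in W) \sum_(X in Xstar F | v \in X) f #|X| = \sum_(X in Xstar F) #|X| * f #|X|)%N.
Proof.
move=> sW f; rewrite (exchange_big_dep (mem (Xstar F))) /=; last by move=> v X _ /andP[].
apply: eq_bigr => X XF; rewrite -sum_nat_const; apply: eq_bigl => v; rewrite XF /=.
by case: (boolP (v \in X)) => [/(subsetP (sW _ XF)) ->|]; rewrite ?andbF.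
Qed.

(* Summing the degree bounds over [W] gives 31 |W| <= 10 r(F), while r(F) <= 3 |W| - 6. *)
Lemma count_contra F W : F \subset KW W -> W != set0 ->
  (forall X, X \in Xstar F -> X \subset W) ->
  (forall v, v \in W -> (2 <= #|[set X in Xstar F | v \in X]|)%N) ->
  nul F = (\sum_(X in Xstar F) s2 #|X|)%N ->
  (forall v, v \in W -> (5 + \sum_(X in Xstar F | v \in X) (#|X| - 4) <= #|nb F v|)%N) -> False.
Proof.
move=> sF W0 sW two nE deg.
have h1 : (5 * #|W| + \sum_(X in Xstar F) #|X| * (#|X| - 4) <= 2 * #|F|)%N.
  rewrite -(sum_nb sF) -(sum_cliques sW (fun r => (r - 4)%N)) mulnC -sum_nat_const -big_split.
  by apply: leq_sum.
have h2 : (2 * #|W| <= \sum_(X in Xstar F) #|X|)%N.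
  have -> : (\sum_(X in Xstar F) #|X| = \sum_(X in Xstar F) #|X| * 1)%N by apply: eq_bigr => X _; rewrite muln1.
  rewrite -(sum_cliques sW (fun=> 1%N)) mulnC -sum_nat_const; apply: leq_sum => v /two h.
  by rewrite sum1dep_card.
have h3 : (\sum_(X in Xstar F) #|X| <= 5 * \sum_(X in Xstar F) (#|X| - 4))%N.
  by rewrite big_distrr /=; apply: leq_sum => X /XstarP[]; move: #|X|; clear; lia.
(* Termwise, r(r-4) = (r-3)(r-4) + 3(r-4), whose first part is twice [s2 r]. *)
have h4 : (\sum_(X in Xstar F) #|X| * (#|X| - 4) =
    2 * nul F + 3 * \sum_(X in Xstar F) (#|X| - 4))%N.
  rewrite nE !big_distrr -big_split /=; apply: eq_bigr => X /XstarP[X5 _ _].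
  rewrite s2_double; last by apply: leq_trans X5.
  by move: X5; move: #|X|; clear => r r5; rewrite -mulnDl; congr muln; lia.
have W3 : (3 <= #|W|)%N.
  have /set0Pn[v vW] := W0; have /card_gt0P[X] : (0 < #|[set X in Xstar F | v \in X]|)%N.
    by apply: leq_trans (two _ vW).
  rewrite inE => /andP[XF _]; have /XstarP[X5 _ _] := XF.
  by apply: leq_trans (subset_leq_card (sW _ XF)); apply: leq_trans X5.
have h5 := rho_KW lrR lr5 W3.
have h6 : (lr F <= lr (KW W))%N by apply: rho_mono.
have h7 : (nul F + lr F = #|F|)%N := nulE x y F.
move: h1 h2 h3 h4 h5 h6 h7; rewrite -/lr; move: (lr _) (lr _) (nul F) #|W| #|F|.
move: (\sum_(X in Xstar F) #|X|)%N (\sum_(X in Xstar F) (#|X| - 4))%N (\sum_(X in Xstar F) _)%N.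
by move: W3; clear; lia.
Qed.

Theorem degen_Xstar F : flat F -> degen (Xstar F).
Proof.
have [m] := ubnP #|F|; elim: m F => // m IH F ltF fF Ys sY Y0.
have {}IH W : (#|F :&: KW W| < #|F|)%N -> degen (Xstar (F :&: KW W)).
  by move=> h; apply: IH; [apply: leq_trans h _ | apply: flat_restr].
have [/exists_inP //|/exists_inPn bad] := boolP [exists X in Ys, (#|X :&: \bigcup_(Y in Ys :\ X) Y| <= 4)%N].
exfalso.
have {}bad X : X \in Ys -> (5 <= #|X :&: \bigcup_(Y in Ys :\ X) Y|)%N by move/bad; rewrite -ltnNge.
have inF X : X \in Ys -> X \in Xstar F by apply: (subsetP sY).
(* Restriction to these vertices keeps every overlap of a member with the union of the others, so it
   keeps the failure of degeneracy; by induction it must leave [F] unchanged. *)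
set V2 : {set 'I_n} := [set v | [exists X in Ys, exists Y in Ys, [&& X != Y, v \in X & v \in Y]]].
have V2in X Y v : X \in Ys -> Y \in Ys -> X != Y -> v \in X -> v \in Y -> v \in V2.
  move=> XY YY ne vX vY; rewrite inE; apply/exists_inP; exists X => //.
  by apply/exists_inP; exists Y; rewrite // ne vX.
have capV2 X : X \in Ys -> (5 <= #|X :&: V2|)%N.
  move=> XY; apply: leq_trans (bad _ XY) (subset_leq_card _); apply/subsetP => v.
  rewrite !in_setI => /andP[vX /bigcupP[Y /setD1P[YX YY] vY]]; rewrite vX /=.
  by apply: (V2in X Y); rewrite // eq_sym.
have FV2 : F :&: KW V2 = F.
  apply/eqP; rewrite eqEcard subsetIl /= leqNgt; apply/negP => lt.
  have dW := IH _ lt.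
  have [||X' /imsetP[X XY ->]] := dW ((fun X => X :&: V2) @: Ys).
  - by apply/subsetP => _ /imsetP[X XY ->]; apply/(Xstar_restrP gen _ _ fF); exists X; rewrite ?inF ?capV2.
  - by have /set0Pn[X XY] := Y0; apply/set0Pn; exists (X :&: V2); apply: imset_f.
  apply/negP; rewrite -ltnNge; apply: leq_trans (bad _ XY) (subset_leq_card _).
  apply/subsetP => v; rewrite !in_setI => /andP[vX /bigcupP[Y /setD1P[YX YY] vY]].
  have vV : v \in V2 by apply: (V2in X Y); rewrite // eq_sym.
  rewrite vX vV /=; apply/bigcupP; exists (Y :&: V2); last by rewrite in_setI vY.
  apply/setD1P; split; last exact: imset_f.
  by apply: contraNneq YX => E; apply/eqP; apply: (Xstar_restr_inj gen fF (inF _ YY) (inF _ XY) _ E); apply: capV2.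
have sF : F \subset KW V2 by rewrite -FV2 subsetIr.
have sW X : X \in Xstar F -> X \subset V2.
  case/XstarP => X5 sX _; apply: (@KW_sub2 n); first by apply: leq_trans X5.
  exact: subset_trans sX sF.
have twoE v : v \in V2 -> exists X Y, [/\ X \in Xstar F, Y \in Xstar F, X != Y, v \in X & v \in Y].
  rewrite inE => /exists_inP[X XY /exists_inP[Y YY /and3P[ne vX vY]]].
  by exists X, Y; rewrite !inF.
have two v : v \in V2 -> (2 <= #|[set X in Xstar F | v \in X]|)%N.
  move=> /twoE[X [Y [XF YF ne vX vY]]].
  apply: leq_trans (_ : #|[set X; Y]| <= _)%N; first by rewrite cards2 ne.
  by apply/subset_leq_card/subsetP => Z; rewrite in_set2 inE => /orP[] /eqP ->; apply/andP.
have nbr v : v \in V2 -> exists w, adjF F v w.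
  move=> /twoE[X [_ [/XstarP[X5 sX _] _ _ vX _]]].
  have := KW_VF (leq_trans _ X5) sX; move/(_ isT)/subsetP/(_ _ vX).
  by rewrite in_VF => /existsP.
have W0 : V2 != set0.
  have /set0Pn[X XY] := Y0; have /card_gt0P[v] : (0 < #|X :&: V2|)%N by apply: leq_trans (capV2 _ XY).
  by rewrite in_setI => /andP[_ vV]; apply/set0Pn; exists v.
have delE v : v \in V2 -> nul (del F v) = (\sum_(X in Xstar F) s2 #|X :&: ~: [set v]|)%N.
  move=> vV; have [w vw] := nbr _ vV.
  have lt : (#|F :&: KW (~: [set v])| < #|F|)%N by apply: (restr_proper vw); rewrite !inE eqxx.
  by rewrite /del (degen_nulE _ (IH _ lt)); [apply: etrans (sum_restr gen (~: [set v]) fF); congr bigop.body | exact: (flat_restr gen (~: [set v]) fF)].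
(* If [F] were complete on [V2], it would have only one maximal clique. *)
have [v [vV [w [wV wv nvw]]]] : exists v, v \in V2 /\ exists w, [/\ w \in V2, w != v & ~~ adjF F v w].
  have [v vV] := set0Pn _ W0.
  have [X [Y [XF YF ne _ _]]] := twoE _ vV.
  have : ~~ (KW V2 \subset F).
    apply: contra ne => sV; have /XstarP[_ _ mX] := XF; have /XstarP[_ _ mY] := YF.
    by rewrite -(mX _ sV (sW _ XF)) -(mY _ sV (sW _ YF)).
  move=> nV; have [e eV eF] := subsetPn nV; move: eV; rewrite in_KW => /andP[e1 e2].
  exists (val e).1; split=> //; exists (val e).2; split=> //; last by rewrite adjF_val.
  by rewrite eq_sym edge_neq.
(* [F] is the union of its restriction to [v] and its neighbours and of [F] without [v], meeting in
   the restriction to the neighbours. All three are proper, since [w] is not adjacent to [v], so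
   supermodularity and induction give the missing inequality; a clique at [v] lies entirely in the
   first piece. *)
have nE : nul F = (\sum_(X in Xstar F) s2 #|X|)%N.
  apply/eqP; rewrite eqn_leq nul_upper //=.
  set N := nb F v; have vN : v \notin N := nbii F v.
  have [z wz] := nbr _ wV; have [u vu] := nbr _ vV.
  have lt1 : (#|F :&: KW (v |: N)| < #|F|)%N.
    by apply: (restr_proper wz); rewrite in_setU1 negb_or wv in_nb.
  have lt2 : (#|F :&: KW N| < #|F|)%N by apply: (restr_proper vu).
  have e1 : nul (F :&: KW (v |: N)) = (\sum_(X in Xstar F) s2 #|X :&: (v |: N)|)%N.
    by rewrite (degen_nulE _ (IH _ lt1)); [apply: etrans (sum_restr gen (v |: N) fF); congr bigop.body | exact: (flat_restr gen (v |: N) fF)].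
  have e2 : nul (F :&: KW N) = (\sum_(X in Xstar F) s2 #|X :&: N|)%N.
    by rewrite (degen_nulE _ (IH _ lt2)); [apply: etrans (sum_restr gen N fF); congr bigop.body | exact: (flat_restr gen N fF)].
  have := nul_supmod x y (F :&: KW (v |: N)) (del F v).
  have -> : (F :&: KW (v |: N)) :&: del F v = F :&: KW N.
    rewrite /del setIACA setIid -KWI; congr (_ :&: KW _); apply/setP => a.
    rewrite in_setI in_setU1 in_setC in_set1; have [->|_] := eqVneq a v; last by rewrite andbT.
    by rewrite andbF (negPf vN).
  have -> : (F :&: KW (v |: N)) :|: del F v = F.
    apply/eqP; rewrite eqEsubset subUset !subsetIl /=; apply: sub_adjF => a b h.
    rewrite adjFU adjF_del adjFI adjF_KW h (adjF_neq h) /= !in_setU1 !in_nb.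
    have [E|av] := eqVneq a v; first by rewrite -E h orbT.
    have [E|bv] := eqVneq b v; first by rewrite E [adjF F v a]adjFC -E h !orbT.
    by rewrite !orbT.
  rewrite e1 (delE v vV) e2 -big_split /= => h.
  rewrite -(leq_add2r (\sum_(X in Xstar F) s2 #|X :&: N|)%N); apply: leq_trans h.
  rewrite -big_split /=; apply: leq_sum => X /XstarP[_ sX _].
  have [vX|vX] := boolP (v \in X).
    have -> : X :&: (v |: N) = X.
      apply/setIidPl/subsetP => a aX; rewrite in_setU1 in_nb; have [//|av] := eqVneq a v.
      by apply: (KW_subP _ _ sX); rewrite // eq_sym.
    have -> // : X :&: ~: [set v] = X :&: N.
    apply/setP => a; rewrite !in_setI in_setC in_set1 in_nb.
    have [aX|//] := boolP (a \in X); have [->|av] := eqVneq a v; first by rewrite adjFii.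
    by apply/esym/(KW_subP _ _ sX); rewrite // eq_sym.
  have -> : X :&: (v |: N) = X :&: N.
    apply/setP => a; rewrite !in_setI in_setU1; have [->|//] := eqVneq a v.
    by rewrite (negPf vX).
  rewrite addnC leq_add2l; have -> // : X :&: ~: [set v] = X.
  by apply/setIidPl/subsetP => a aX; rewrite !inE; apply: contraNneq vX => <-.
apply: (count_contra sF W0 sW two nE) => a aV.
have [X [Y [XF YF ne aX aY]]] := twoE _ aV.
(* The degree of [a] is the drop in rank plus the drop in nullity: the former is at least five, and
   the latter is the sum of [#|X| - 4] over the cliques at [a]. *)
have h1 := two_cliques_deg gen fF XF YF ne aX aY.
have h2 : (\sum_(X in Xstar F) s2 #|X| =
    \sum_(X in Xstar F) s2 #|X :&: ~: [set a]| + \sum_(X in Xstar F | a \in X) (#|X| - 4))%N.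
  rewrite [X in (_ + X)%N]big_mkcondr -big_split /=; apply: eq_bigr => Z /XstarP[Z5 _ _].
  have [aZ|aZ] := boolP (a \in Z); last first.
    have -> : Z :&: ~: [set a] = Z by apply/setIidPl/subsetP => b bZ; rewrite !inE; apply: contraNneq aZ => <-.
    by rewrite addn0.
  rewrite s2S; last exact: ltnW.
  by rewrite -setDE (cardsD1 a Z) aZ.
rewrite -nE -delE // in h2.
have h3 := nulE x y F; have h4 := nulE x y (del F a); have h5 := card_del F a.
move: h1 h2 h3 h4 h5; rewrite -/lr; move: (lr _) (lr _) (nul _) (nul _) #|F| #|del F a| #|nb F a|.
by move: (\sum_(X in _ | _) _)%N; clear; lia.
Qed.
End Shellability.

(** * Identification with the rank of the cofactor matrix *)

Section Bridge.
Variables (R : realType) (n : nat) (x y : 'I_n -> R).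
Let p : 'I_n -> R * R := fun i => (x i, y i).
Local Notation V := 'M[R]_(n, 3).
Implicit Types (A : {set edge n}) (v : V).

Fact col_vertex_lt (c : 'I_(3 * n)) : (c %/ 3 < n)%N.
Proof. by rewrite ltn_divLR // [X in (_ < X)%N]mulnC. Qed.
Fact col_pos_lt (c : 'I_(3 * n)) : (c %% 3 < 3)%N.
Proof. exact: ltn_pmod. Qed.
Definition flat_row v : 'rV[R]_(3 * n) :=
  \row_c v (Ordinal (col_vertex_lt c)) (Ordinal (col_pos_lt c)).

Fact flat_row_linear : linear flat_row.
Proof. by move=> k u v; apply/rowP => c; rewrite !mxE. Qed.
HB.instance Definition _ := GRing.isLinear.Build R V 'rV[R]_(3 * n) *:%R flat_row flat_row_linear.

Lemma flat_row_inj : injective flat_row.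
Proof.
move=> u v /rowP h; apply/matrixP => i k.
have lt : (3 * i + k < 3 * n)%N by have := ltn_ord i; have := ltn_ord k; move: (i : nat) (k : nat); clear; lia.
have := h (Ordinal lt); rewrite !mxE.
have -> : Ordinal (col_vertex_lt (Ordinal lt)) = i.
  by apply/val_inj; rewrite /= mulnC divnMDl // divn_small ?addn0.
have -> // : Ordinal (col_pos_lt (Ordinal lt)) = k.
by apply/val_inj; rewrite /= mulnC modnMDl modn_small.
Qed.

Definition maskmx A : 'M[R]_(#|{: edge n}|, 3 * n) :=
  \matrix_(r, c) (if enum_val r \in A then cofmx x y r c else 0).

Lemma row_maskmx A r : row r (maskmx A) =
  if enum_val r \in A then flat_row (rwe p (enum_val r)) else 0.
Proof.
apply/rowP => c; rewrite !mxE; case: ifP => _; last by rewrite mxE.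
rewrite !mxE /Dent /=; set e := val (enum_val r).
have ne : e.1 != e.2 := edge_neq (enum_val r).
have V1 (i : 'I_n) : (Ordinal (col_vertex_lt c) == i) = ((c %/ 3)%N == i) by [].
rewrite !V1.
have [E1|] := eqVneq (c %/ 3)%N e.1; have [E2|] := eqVneq (c %/ 3)%N e.2 => //=.
- by case/eqP: ne; apply/val_inj; rewrite /= -E1 E2.
- by rewrite mul1r mul0r subr0.
- by rewrite mul1r mul0r sub0r.
- by rewrite !mul0r subrr.
Qed.

Lemma maskmxP A v : (flat_row v <= maskmx A)%MS = (v \in spn (rwe p) A).
Proof.
apply/idP/idP => [/submxP[u]|/memv_sumP[f fA ->]].
  rewrite mulmx_sum_row => h.
  suff -> : v = \sum_(r < #|{: edge n}|) u 0 r *: (if enum_val r \in A then rwe p (enum_val r) else 0).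
    apply: memv_suml => r _; apply: memvZ; case: ifP => rA; last exact: mem0v.
    exact: spn_mem.
  apply: flat_row_inj; rewrite h linear_sum; apply: eq_bigr => r _.
  by rewrite linearZ row_maskmx; congr (_ *: _); case: ifP => _ /=; rewrite ?linear0.
rewrite linear_sum summx_sub // => e eA; have /vlineP[k ->] := fA e eA.
rewrite linearZ scalemx_sub //; apply: eq_row_sub (enum_rank e) _.
by rewrite row_maskmx enum_rankK eA.
Qed.

Lemma cofrankE A : cofrank x y A = lrank (rwe p) A.
Proof.
rewrite -[LHS]/(\rank (maskmx A)).
apply: (@rho_ind _ (fun A => \rank (maskmx A) = lrank (rwe p) A) set0) => //; first exact: sub0set.
  rewrite (rho0 (lrank_rank _)); apply/eqP; rewrite mxrank_eq0; apply/eqP/row_matrixP => r.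
  by rewrite row_maskmx inE row0.
(* Edges are added one at a time: each either lies in the current row space, or raises both ranks by
   one because it meets that space trivially. *)
move=> C e _ _ IH; have E : (maskmx (e |: C) :=: maskmx C + flat_row (rwe p e))%MS.
  apply/eqmxP/andP; split.
    apply/row_subP => r; rewrite row_maskmx in_setU1; have [->|_] := eqVneq; first exact: addsmxSr.
    case: ifP => rC; last exact: sub0mx.
    by apply: submx_trans (addsmxSl _ _); rewrite maskmxP spn_mem.
  rewrite addsmx_sub maskmxP spn_mem ?setU11 // andbT; apply/row_subP => r.
  rewrite row_maskmx; case: ifP => rC; last exact: sub0mx.
  by rewrite maskmxP spn_mem // setU1r.
rewrite E; have [he|he] := boolP (rwe p e \in spn (rwe p) C).
  have /addsmx_idPl -> : (flat_row (rwe p e) <= maskmx C)%MS by rewrite maskmxP.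
  by rewrite IH; apply/esym/lrank_cl.
rewrite /lrank spnU spn1 addvC dim_addv1 he -/(lrank _ _) -IH addn1.
have := mxrank_sum_cap (maskmx C) (flat_row (rwe p e)); rewrite rank_rV.
have -> : flat_row (rwe p e) != 0.
  by apply: contra he => /eqP h; rewrite -maskmxP h sub0mx.
rewrite /= addn1 => <-; rewrite [X in (_ + X)%N](_ : _ = 0%N) ?addn0 //.
apply/eqP/negPn/negP => h0; case/negP: he; rewrite -maskmxP.
have h1 : \rank (maskmx C :&: flat_row (rwe p e)) == \rank (flat_row (rwe p e)).
  rewrite eqn_leq mxrankS ?capmxSr //=; apply: leq_trans (rank_leq_row _) _.
  by rewrite lt0n.
have := mxrank_leqif_eq (capmxSr (maskmx C) (flat_row (rwe p e))).
by case=> _; rewrite h1 => /esym/andP[_ h]; apply: submx_trans h (capmxSl _ _).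
Qed.

Lemma is_flatP F : is_flat x y F -> clo (lrank (rwe p)) F \subset F.
Proof.
move=> h; apply/subsetP => e; rewrite inE => /eqP he; apply/negPn/negP => eF.
by have := h e eF; rewrite !cofrankE he ltnn.
Qed.
End Bridge.

(** * Hinges as multiply covered edges, and the final count *)

Section Hinges.
Variable n : nat.
Implicit Types (X Y h : {set 'I_n}) (Xs : {set {set 'I_n}}) (F : {set edge n}).

Definition ends (e : edge n) : {set 'I_n} := [set (val e).1; (val e).2].

Lemma ends_sub e X : (ends e \subset X) = (e \in KW X).
Proof. by rewrite subUset !sub1set in_KW. Qed.

Lemma card_ends e : #|ends e| = 2%N.
Proof. by rewrite cards2 edge_neq. Qed.

Lemma ends_inj : injective ends.
Proof.
move=> e f h; have : f \in KW (ends e) by rewrite -ends_sub h.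
rewrite in_KW !inE => /andP[/orP[] /eqP h1 /orP[] /eqP h2].
- by have := edge_neq f; rewrite h1 h2 eqxx.
- by apply/val_inj; rewrite [RHS]surjective_pairing h1 h2 -surjective_pairing.
- by have := valP f; rewrite /= h1 h2 => /(ltn_trans (valP e)); rewrite ltnn.
- by have := edge_neq f; rewrite h1 h2 eqxx.
Qed.

Lemma ends_onto h : #|h| = 2%N -> exists e, h = ends e.
Proof.
move=> /eqP/cards2P[i [j [ij ->]]]; have [e _ [E|E]] := Ed_neq ij; exists e; rewrite /ends E //=.
by rewrite setUC.
Qed.

(** In a 2-thin family, two members that both contain a pair intersect exactly in it. *)
Lemma hingesE Xs : two_thin Xs -> hinges Xs = ends @: [set e | (2 <= hdeg Xs (ends e))%N].
Proof.
move=> thin; apply/setP => h; apply/idP/imsetP.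
  rewrite inE => /andP[/eqP h2 /exists_inP[X XX /exists_inP[Y YY /andP[XY /eqP E]]]].
  have [e he] := ends_onto h2; exists e => //; rewrite inE -he /hdeg.
  apply: leq_trans (_ : #|[set X; Y]| <= _)%N; first by rewrite cards2 XY.
  apply/subset_leq_card/subsetP => Z; rewrite !inE -E => /orP[] /eqP ->.
    by rewrite XX subsetIl.
  by rewrite YY subsetIr.
case=> e; rewrite inE => /card_gt1P[X [Y [hX hY XY]]] ->.
move: hX hY; rewrite !inE => /andP[XX sX] /andP[YY sY]; rewrite card_ends eqxx /=.
apply/exists_inP; exists X => //; apply/exists_inP; exists Y => //; rewrite XY /=.
by rewrite eq_sym eqEcard subsetI sX sY card_ends thin.
Qed.

(** Summing clique sizes counts an edge once per clique containing it. The hinge terms are the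
    surplus over one, and [F0 F] holds the edges counted zero times. *)
Lemma cover_count F : two_thin (Xstar F) ->
  (#|F| + \sum_(h in hinges (Xstar F)) (hdeg (Xstar F) h - 1) =
   #|F0 F| + \sum_(X in Xstar F) 'C(#|X|, 2))%N.
Proof.
move=> thin; set Xs := Xstar F; pose d e := hdeg Xs (ends e).
have dE e : d e = (\sum_(X in Xs) (e \in KW X))%N.
  rewrite /d /hdeg -sum1dep_card big_mkcondr; apply: eq_bigr => X _.
  by rewrite ends_sub; case: (_ \in _).
have -> : (\sum_(X in Xs) 'C(#|X|, 2) = \sum_(e : edge n) d e)%N.
  rewrite (eq_bigr _ (fun e _ => dE e)) exchange_big; apply: eq_bigr => X _ /=.
  by rewrite -card_KW -sum1_card big_mkcond; apply: eq_bigr => e _; case: (_ \in _).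
have -> : (\sum_(h in hinges Xs) (hdeg Xs h - 1) = \sum_(e : edge n) (d e - 1))%N.
  rewrite hingesE // big_imset /=; last by move=> e f _ _; apply: ends_inj.
  rewrite [RHS](bigID (fun e => 2 <= d e)%N) /= [X in (_ + X)%N]big1 ?addn0; last first.
    by move=> e; rewrite -ltnNge; case: (d e) => [|[]].
  by apply: eq_bigl => e; rewrite inE.
have -> : #|F| = (#|F0 F| + \sum_(e : edge n) (0 < d e))%N.
  rewrite -(cardsID (F0 F) F) (setIidPr _); last by apply/subsetP => e; rewrite inE => /andP[].
  congr (_ + _)%N; rewrite -sum1_card big_mkcond /=; apply: eq_bigr => e _.
  rewrite !inE negb_and negbK; have [eF|eF] := boolP (e \in F) => /=.
    rewrite andbT; suff -> : [exists X in Xs, induced_by X e] = (0 < d e)%N by case: (0 < _)%N.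
    apply/exists_inP/card_gt0P => [[X XX h]|[X]].
      by exists X; rewrite inE XX ends_sub in_KW.
    by rewrite inE ends_sub in_KW => /andP[XX h]; exists X.
  suff -> : d e = 0%N by [].
  rewrite dE big1 // => X /XstarP[_ sX _]; case: (boolP (e \in KW X)) => // /(subsetP sX).
  by rewrite (negPf eF).
rewrite -addnA -big_split /=; congr (_ + _)%N; apply: eq_bigr => e _.
by case: (d e) => [|r]; rewrite ?subSS ?subn0.
Qed.
End Hinges.

Theorem theorem6p3 (R : realType) (n : nat) (x y : 'I_n -> R)
  (Hn : (5 <= n)%N) (Hgen : generic x y) (F : {set edge n})
  (Hflat : is_flat x y F) :
  four_shellable (Xstar F) /\ two_thin (Xstar F) /\
  is_cover (Xstar F) (F :\: F0 F) /\
  (cofrank x y F)%:Z = (#|F0 F|)%:Z + valD (Xstar F).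
Proof.
have fF := is_flatP Hflat; have dF := degen_Xstar Hgen fF.
have thin : two_thin (Xstar F).
  move=> X Y XF YF XY; rewrite leqNgt; apply: contra XY => h; apply/eqP.
  exact: (Xstar_thin Hgen fF XF YF).
split; first exact: degen_shellable.
split=> //; split.
  split=> [X /XstarP[]//|e].
  by rewrite !inE negb_and negbK => /andP[/orP[/negPf -> //|/exists_inP[X XF h]] _]; exists X.
have nE := degen_nulE Hgen fF dF; have rE := nulE x y F; rewrite -cofrankE in rE.
have cE := cover_count thin.
have sE : (\sum_(X in Xstar F) 'C(#|X|, 2) + 6 * #|Xstar F| =
    \sum_(X in Xstar F) s2 #|X| + \sum_(X in Xstar F) 3 * #|X|)%N.
  rewrite mulnC -sum_nat_const -!big_split; apply: eq_bigr => X /XstarP[X5 _ _] /=.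
  by apply: s2_bin; apply: leq_trans X5.
have hE : (\sum_(h in hinges (Xstar F)) ((hdeg (Xstar F) h)%:Z - 1) =
    (\sum_(h in hinges (Xstar F)) (hdeg (Xstar F) h - 1))%N%:Z).
  rewrite (big_morph Posz PoszD (erefl _)); apply: eq_bigr => h; rewrite hingesE // => /imsetP[e].
  (* Hinges have degree at least two, so truncated and integer subtraction agree. *)
  by rewrite inE => h2 ->; rewrite -subzn // ltnW.
have vE : (\sum_(X in Xstar F) ((3 * #|X|)%:Z - 6) =
    (\sum_(X in Xstar F) 3 * #|X|)%N%:Z - (6 * #|Xstar F|)%N%:Z).
  rewrite big_split /= (big_morph Posz PoszD (erefl _)) sumr_const; congr (_ + _).
  by rewrite mulNrn -[(6 * #|Xstar F|)%N%:Z]natz natrM mulr_natr.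
rewrite /valD vE hE; move: nE rE cE sE.
move: (\sum_(X in Xstar F) s2 #|X|)%N (\sum_(h in hinges (Xstar F)) (hdeg (Xstar F) h - 1))%N.
move: (\sum_(X in Xstar F) 'C(#|X|, 2))%N (\sum_(X in Xstar F) 3 * #|X|)%N (nul _ _ _).
by move: (cofrank _ _ _) #|F| #|F0 F| #|Xstar F|; clear; lia.
Qed.
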